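(* Let $0\le j<k\le n-1$. If $f\in L^p(\Gamma_H(n,j))$ with $1\le p<(n-1)/(k-1)$ (i.e. $1\le p<\infty$ when $k=1$), then $(R_Hf)(\mathfrak z)$ is finite for almost all $\mathfrak z\in\Gamma_H(n,k)$.
   Context: $n\ge2$; functions are complex-valued; $\sigma_{m-1}=2\pi^{m/2}/\Gamma(m/2)$ is the area of $S^{m-1}$. $\mathbb E^{n,1}$ is $\mathbb R^{n+1}$ with the form $[x,y]=-x_1y_1-\dots-x_ny_n+x_{n+1}y_{n+1}$, with unit vectors $e_1,\dots,e_{n+1}$; $\mathbb H^n=\{x:[x,x]=1,x_{n+1}>0\}$ with distance $d(x,y)=\cosh^{-1}[x,y]$; $\tilde o=e_{n+1}$. $\Gamma_H(n,d)$ is the set of $d$-dimensional totally geodesic submanifolds of $\mathbb H^n$, i.e. nonempty intersections of $\mathbb H^n$ with $(d+1)$-dimensional linear subspaces; $\|\mathfrak t\|$ is the geodesic distance from $\tilde o$ to $\mathfrak t$. $\mathbb H^d=\mathbb H^n\cap\mathrm{span}(e_{n-d+1},\dots,e_{n+1})$; $g_{i,n+1}(r)$ is the linear map with $e_i\mapsto e_i\cosh r+e_{n+1}\sinh r$, $e_{n+1}\mapsto e_i\sinh r+e_{n+1}\cosh r$, fixing the other $e_l$; $K=SO(n)$ acts on the first $n$ coordinates. The invariant measure on $\Gamma_H(n,d)$ (used for $L^p$ and ''almost all'') is normalized by $$\int_{\Gamma_H(n,d)}\psi(\mathfrak t)\,d\mathfrak t=\sigma_{n-d-1}\int_0^\infty(\sinh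 r)^{n-d-1}(\cosh r)^d\int_K\psi(\alpha g_{n-d,n+1}(r)\mathbb H^d)\,d\alpha\,dr.$$ Definition of $R_H$: let $\mathbb R^k=\mathrm{span}(e_{n-k+1},\dots,e_n)$. Each $\mathfrak z\in\Gamma_H(n,k)$ is $\mathbb H^n\cap\mathrm{span}(\eta+v+e_{n+1})$ for a unique $k$-dimensional linear subspace $\eta\subset\mathbb R^n$ and $v\in\eta^\perp\subset\mathbb R^n$, $|v|<1$. With $r=\|\mathfrak z\|$, choose $\gamma\in K$ with $\gamma\mathbb R^k=\eta$ and $\gamma e_{n-k}=v/|v|$ (the latter if $v\ne0$). Then $(R_Hf)(\mathfrak z)=\int_{\mathfrak t\subset\mathfrak z}f(\mathfrak t)$ is $$\sigma_{k-j-1}\int_0^\infty(\sinh\rho)^{k-j-1}(\cosh\rho)^j\int_{SO(k)}f\big(\gamma g_{n-k,n+1}(r)\,\alpha\, g_{n-j,n+1}(\rho)\mathbb H^j\big)\,d\alpha\,d\rho,$$ where $SO(k)$ acts on $\mathbb R^k$ with Haar probability measure (for $k=1$, read $O(1)$). *)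

(* Defs.v *)
From HB Require Import structures.
From mathcomp Require Import all_boot all_order all_algebra.
From mathcomp Require Import all_classical all_reals all_analysis.
From mathcomp Require Import measurable_realfun complex.
Set Implicit Arguments.
Unset Strict Implicit.
Unset Printing Implicit Defensive.
Import Order.TTheory GRing.Theory Num.Theory.
Import numFieldNormedType.Exports.
Local Open Scope classical_set_scope.
Local Open Scope ring_scope.

Section special_functions.
Variable R : realType.

Definition sinh (x : R) : R := (expR x - expR (- x)) / 2.
Definition cosh (x : R) : R := (expR x + expR (- x)) / 2.
Definition arcosh (x : R) : R := ln (x + Num.sqrt (x ^+ 2 - 1)).

Definition Gamma (x : R) : R :=
  (\int[lebesgue_measure]_(t in `]0%R, +oo[) (t `^ (x - 1) * expR (- t)))%R.

(* [sphere_area m] is sigma_{m-1}, the area of the unit sphere of R^m. *)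
Definition sphere_area (m : nat) : R := 2 * pi `^ (m%:R / 2) / Gamma (m%:R / 2).

End special_functions.

Section complex_integration.
Context d (T : measurableType d) (R : realType).
Implicit Types (mu : {measure set T -> \bar R}) (D : set T) (F : T -> R[i]).

Definition cintegrable mu D F : Prop :=
  mu.-integrable D (fun x => (complex.Re (F x))%:E) /\
  mu.-integrable D (fun x => (complex.Im (F x))%:E).

Definition cintegral mu D F : R[i] :=
  ((\int[mu]_(x in D) complex.Re (F x))%R +i*
   (\int[mu]_(x in D) complex.Im (F x))%R)%C.

Definition cLp mu (p : R) F : Prop :=
  [/\ measurable_fun setT (fun x => complex.Re (F x)),
      measurable_fun setT (fun x => complex.Im (F x)) &
      finite_norm mu p%:E (fun x => ComplexField.Normc.normc (F x))].

End complex_integration.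

Section geometry.
Variable R : realType.

(* e_1, ..., e_m is the standard basis of R^m: the index [i] is 1-based. *)
Definition bvec (m i : nat) : 'cV[R]_m := \col_(l < m) (l.+1 == i)%:R.

Definition dotp (m : nat) (u v : 'cV[R]_m) : R := \sum_(i < m) u i 0 * v i 0.

(* The norm [`|v|] of the library is the sup norm on matrices. *)
Definition enorm (m : nat) (v : 'cV[R]_m) : R := Num.sqrt (dotp v v).

Definition act (m : nat) (M : 'M[R]_m) (t : set 'cV[R]_m) : set 'cV[R]_m :=
  [set M *m x | x in t].

Definition lspan (m : nat) (S : set 'cV[R]_m) : set 'cV[R]_m :=
  [set x | forall W : {vspace 'cV[R]_m}, (forall y, S y -> y \in W) -> x \in W].

Variable n : nat.

Definition mink (x y : 'cV[R]_(n + 1)) : R :=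
  - dotp (usubmx x) (usubmx y) + dotp (dsubmx x) (dsubmx y).

Definition hspace : set 'cV[R]_(n + 1) :=
  [set x | mink x x = 1 /\ 0 < x (rshift n ord0) 0].

Definition hdist (x y : 'cV[R]_(n + 1)) : R := arcosh (mink x y).

Definition horigin : 'cV[R]_(n + 1) := bvec (n + 1) (n + 1).

Definition Gamma_H (d : nat) : set (set 'cV[R]_(n + 1)) :=
  [set t | t !=set0 /\ exists W : {vspace 'cV[R]_(n + 1)},
     \dim W = d.+1 /\ t = hspace `&` [set x | x \in W]].

Definition hnorm (t : set 'cV[R]_(n + 1)) : R :=
  inf [set hdist horigin x | x in t].

Definition hplane (d : nat) : set 'cV[R]_(n + 1) :=
  hspace `&`
  [set x | x \in <<[seq bvec (n + 1) i | i <- iota (n - d + 1) (d + 1)]>>%VS].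

(* The linear map g_{i,n+1}(r), with [i] 1-based, acting on column vectors. *)
Definition boost (i : nat) (r : R) : 'M[R]_(n + 1) :=
  \matrix_(a < n + 1, b < n + 1)
    if ((a.+1 == i) && (b.+1 == i)) || ((a.+1 == n.+1) && (b.+1 == n.+1))
    then cosh r
    else if ((a.+1 == i) && (b.+1 == n.+1)) || ((a.+1 == n.+1) && (b.+1 == i))
    then sinh r
    else (a == b)%:R.

Definition emb (A : 'M[R]_n) : 'M[R]_(n + 1) := block_mx A 0 0 1%:M.

(* The group SO(k) (O(1) if k = 1) acting on R^k = span(e_{n-k+1}, ..., e_n),
   as a group of n x n matrices fixing the other basis vectors; in particular
   [rotgrp n] is SO(n) for n >= 2. *)
Definition rotgrp (k : nat) : set 'M[R]_n :=
  [set A | [/\ A^T *m A = 1%:M, (k != 1)%N -> \det A = 1 &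
     forall i : nat, (1 <= i <= n - k)%N -> A *m bvec n i = bvec n i]].

Definition mxborel := g_sigma_algebraType [set U : set 'M[R]_n | open U].
HB.instance Definition _ := Measurable.on mxborel.

Definition is_haar (G : set 'M[R]_n) (P : probability mxborel R) : Prop :=
  P G = 1%E /\
  forall (g : 'M[R]_n) (A : set mxborel), G g -> measurable A ->
    P [set x : mxborel | A (g *m (x : 'M[R]_n))] = P A.

(* The Borel sets of Gamma_H(n,d) are generated by the sets
   {t | t meets U}, U open in R^{n+1}. Functions and measures on Gamma_H(n,d)
   live on the type of all sets of vectors, where a set is measurable iff its
   trace on Gamma_H(n,d) is Borel: what happens outside Gamma_H(n,d) is
   immaterial, and [invariant_measure] makes the complement null. *)
Definition hgr (d : nat) := g_sigma_algebraType
  [set A : set (set 'cV[R]_(n + 1)) |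
    exists2 U : set 'cV[R]_(n + 1), open U &
      A `&` Gamma_H d = [set t | t `&` U !=set0] `&` Gamma_H d].
HB.instance Definition _ (d : nat) := Measurable.on (hgr d).

Definition hweight (m d : nat) (r : R) : R := sinh r ^+ m * cosh r ^+ d.

Definition invariant_measure (d : nat) (PK : probability mxborel R)
    (mu : {measure set (hgr d) -> \bar R}) : Prop :=
  forall psi : hgr d -> \bar R,
    measurable_fun setT psi -> (forall t, (0 <= psi t)%E) ->
    (\int[mu]_t psi t =
     (sphere_area R (n - d))%:E *
     \int[lebesgue_measure]_(r in `]0%R, +oo[)
       ((hweight (n - d - 1) d r)%:E *
        \int[PK]_(a in rotgrp n) psi (act (emb a *m boost (n - d) r) (hplane d))))%E.

Definition Rsub (k : nat) : set 'cV[R]_n :=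
  [set x | x \in <<[seq bvec n i | i <- iota (n - k + 1) k]>>%VS].

Definition hframe (k : nat) (z : set 'cV[R]_(n + 1)) (g : 'M[R]_n) : Prop :=
  exists (eta : {vspace 'cV[R]_n}) (v : 'cV[R]_n),
    [/\ [/\ \dim eta = k, forall u, u \in eta -> dotp u v = 0 & enorm v < 1],
        z = hspace `&` lspan [set col_mx (u + v) 1%:M | u in [set u | u \in eta]],
        rotgrp n g,
        act g (Rsub k) = [set u | u \in eta] &
        v != 0 -> g *m bvec n (n - k) = (enorm v)^-1 *: v].

Definition frame_of (k : nat) (z : set 'cV[R]_(n + 1)) : 'M[R]_n :=
  xget 1%:M [set g | hframe k z g].

Definition hpoint (k j : nat) (z : set 'cV[R]_(n + 1)) (rho : R) (a : 'M[R]_n) :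
    set 'cV[R]_(n + 1) :=
  act (emb (frame_of k z) *m boost (n - k) (hnorm z) *m
       emb a *m boost (n - j) rho) (hplane j).

(* [is_hradon Pk f z w]: the integral defining (R_H f)(z) converges absolutely
   and its (finite) value is [w]. *)
Definition is_hradon (k j : nat) (Pk : probability mxborel R)
    (f : hgr j -> R[i]) (z : hgr k) (w : R[i]) : Prop :=
  cintegrable (lebesgue_measure \x Pk)%E (`]0%R, +oo[ `*` rotgrp k)
    (fun q : measurableTypeR R * mxborel =>
       (hweight (k - j - 1) j q.1)%:C%C * f (hpoint k j z q.1 q.2)) /\
  w = (sphere_area R (k - j))%:C%C *
      cintegral lebesgue_measure `]0%R, +oo[ (fun rho =>
        (hweight (k - j - 1) j rho)%:C%C *
        cintegral Pk (rotgrp k) (fun a => f (hpoint k j z rho a))).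

End geometry.

(* Main.v *)
Require Import Defs.
From HB Require Import structures.
From mathcomp Require Import all_boot all_order all_algebra.
From mathcomp Require Import all_classical all_reals all_analysis.
From mathcomp Require Import measurable_realfun complex.
From mathcomp Require Import ring lra zify.
Import Order.TTheory GRing.Theory Num.Theory.
Import numFieldNormedType.Exports.
Local Open Scope classical_set_scope.
Local Open Scope ring_scope.

(* Hyperbolic Pythagoras: inside a k-plane z at distance r from the origin, a
   j-plane at distance rho from the point of z nearest to the origin lies at
   distance s from the origin, cosh s = cosh r cosh rho. Hence the average of
   R_H |f| over the rotates of z is a one-dimensional integral of the average
   A(s) of |f| over the j-planes at distance s, and for e < r < N the
   substitution s = s(r) expands distances by at least tanh e, so that
   integrating over r leaves a multiple of the integral of cosh^(k-1) A over
   s > e. As p < (n-1)/(k-1), the pointwise bound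
     C^(k-1) x <= C^(n-1) x^p + C^(k-1-(n-1)/p),  C = cosh s >= 1, x >= 0,
   makes the latter integral finite for f in L^p. So R_H |f| is finite for
   almost all parameters (r, a); the left invariance of the Haar measure on
   SO(k) makes finiteness independent of the frame chosen for z, and inner
   regularity turns the null set of parameters into a measurable null set of
   planes. *)

(** * Hyperbolic functions *)

(** Averaging over rotates replaces [f], of which only a norm is known, by a function of one
    variable. Only upper bounds are wanted, so an expanding change of variable can stand in for a
    Jacobian. Finiteness almost everywhere is local in the parameters, which permits the truncation
    [e < r < N]: at [r = 0] the map [r -> s] is flat and its expansion constant tends to zero, while
    the upper end keeps [s - rho] below [N], so that each [s] is reached from a range of [rho] of
    length at most [N]. The strict inequality on [p] becomes exponential decay of the last term of
    the pointwise bound. The frame of a plane is determined only up to O(k), whereas the Haar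
    measure lives on SO(k) when [k > 1]. Left invariance absorbs a rotation, but a reflection in
    [e_n] may remain, and its presence depends on the frame that was picked. Two integrals, one for
    each sign, are therefore carried along, and both are shown to be finite. *)

Section hyperbolic.
Variable R : realType.
Implicit Types x y r s u e : R.

Lemma expR_mulN x : expR x * expR (- x) = 1.
Proof. by rewrite -expRD subrr expR0. Qed.

Lemma cosh2B x : cosh x ^+ 2 - sinh x ^+ 2 = 1.
Proof.
have h := expR_mulN x; rewrite /cosh /sinh.
move: h; set a := expR x; set b := expR _ => h.
by transitivity (a * b); [field | exact: h].
Qed.

Lemma coshD x y : cosh (x + y) = cosh x * cosh y + sinh x * sinh y.
Proof. by rewrite /cosh /sinh opprD !expRD; field. Qed.

Lemma sinhD x y : sinh (x + y) = sinh x * cosh y + cosh x * sinh y.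
Proof. by rewrite /cosh /sinh opprD !expRD; field. Qed.

Lemma sinh0 : sinh (0 : R) = 0.
Proof. by rewrite /sinh oppr0 subrr mul0r. Qed.

Lemma cosh_gt0 x : 0 < cosh x.
Proof. by rewrite divr_gt0// addr_gt0 ?expR_gt0. Qed.

Lemma sinh_gt0 x : 0 < x -> 0 < sinh x.
Proof. by move=> x0; rewrite divr_gt0// subr_gt0 ltr_expR; lra. Qed.

Lemma sinh_ge0 x : 0 <= x -> 0 <= sinh x.
Proof.
by rewrite le_eqVlt => /predU1P[<-|/sinh_gt0/ltW//]; rewrite sinh0.
Qed.

Lemma normr_sinh_lt_cosh x : `|sinh x| < cosh x.
Proof.
rewrite -(gtr0_norm (cosh_gt0 x)) -ltr_sqr ?nnegrE// !real_normK ?num_real//.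
by have := cosh2B x; lra.
Qed.

Lemma cosh_ge1 x : 1 <= cosh x.
Proof.
have := cosh2B x; have := cosh_gt0 x; have := sqr_ge0 (sinh x).
nra.
Qed.

Lemma cosh_gt1 x : 0 < x -> 1 < cosh x.
Proof.
move=> /sinh_gt0; have := cosh2B x; have := cosh_gt0 x; nra.
Qed.

Lemma coshDsinh x : cosh x + sinh x = expR x.
Proof. by rewrite /cosh /sinh; field. Qed.

Lemma ltr_cosh x y : 0 <= x -> x < y -> cosh x < cosh y.
Proof.
move=> x0 xy; have -> : y = x + (y - x) by ring.
rewrite coshD; have := @cosh_gt1 (y - x); rewrite subr_gt0 => /(_ xy) h1.
have := @sinh_gt0 (y - x); rewrite subr_gt0 => /(_ xy) h2.
have := sinh_ge0 x x0; have := cosh_gt0 x; nra.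
Qed.

Lemma ltr_cosh_inv x y : 0 <= x -> 0 <= y -> cosh x < cosh y -> x < y.
Proof.
move=> x0 y0 h; rewrite ltNge; apply/negP; rewrite le_eqVlt => /predU1P[yx|yx].
  by rewrite yx ltxx in h.
by have := ltr_cosh _ _ y0 yx; rewrite ltNge (ltW h).
Qed.

Lemma ler_sinh_cosh x : 0 <= x -> sinh x <= cosh x.
Proof.
by move=> x0; have := ltW (normr_sinh_lt_cosh x); rewrite ger0_norm// sinh_ge0.
Qed.

Lemma arcosh_cosh x : 0 <= x -> arcosh (cosh x) = x.
Proof.
move=> x0; rewrite /arcosh.
have -> : cosh x ^+ 2 - 1 = sinh x ^+ 2 by have := cosh2B x; lra.
by rewrite sqrtr_sqr ger0_norm ?sinh_ge0// coshDsinh expRK.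
Qed.

Lemma arcosh_ge0 u : 1 <= u -> 0 <= arcosh u.
Proof.
move=> u1; rewrite /arcosh ln_ge0//.
by rewrite (le_trans u1)// lerDl sqrtr_ge0.
Qed.

Lemma cosh_arcosh u : 1 <= u -> cosh (arcosh u) = u.
Proof.
move=> u1; rewrite /arcosh /cosh expRN.
have h : Num.sqrt (u ^+ 2 - 1) ^+ 2 = u ^+ 2 - 1 by rewrite sqr_sqrtr//; nra.
have s0 : 0 <= Num.sqrt (u ^+ 2 - 1) by rewrite sqrtr_ge0.
move: h s0; set s := Num.sqrt _ => h s0.
rewrite lnK ?posrE; last by lra.
have us0 : u + s != 0 by rewrite gt_eqF//; lra.
have -> : (u + s)^-1 = u - s.
  by apply: (mulfI us0); rewrite divff//; nra.
by field.
Qed.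

Lemma ler_arcosh u v : 1 <= u -> u <= v -> arcosh u <= arcosh v.
Proof.
move=> u1 uv; rewrite leNgt; apply/negP => /(ltr_cosh _ _ (arcosh_ge0 _ (le_trans u1 uv))).
by rewrite !cosh_arcosh ?(le_trans u1)// ltNge uv.
Qed.

Lemma expR_le_2cosh x : expR x <= 2 * cosh x.
Proof. by rewrite /cosh; have := expR_gt0 (- x); lra. Qed.

(** Convexity of the exponential: [c * d] is the mean of [d] and [- d] with weights [(1 + c) / 2]
    and [(1 - c) / 2], and the right-hand side is the same mean of [expR d] and [expR (- d)]. *)
Lemma cosh_ge_expR_combination c d : 0 <= c <= 1 ->
  expR (c * d) <= cosh d + c * sinh d :> R.
Proof.
move=> /andP[c0 c1].
have t0 : 0 <= (1 + c) / 2 by lra.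
have t1 : (1 + c) / 2 <= 1 by lra.
have := @convex_expR R (Itv01 t0 t1) d (- d); rewrite !convRE/= /unstable.onem.
have -> : (1 + c) / 2 * d + (1 - (1 + c) / 2) * - d = c * d by field.
move=> /le_trans; apply; rewrite le_eqVlt; apply/orP; left; by apply/eqP; rewrite /cosh /sinh; field.
Qed.

(* [cosh r' / cosh r >= exp (tanh e (r' - r))] for [e <= r <= r'], while
   [cosh s' / cosh s <= exp (s' - s)]. *)
Lemma cosh_ratio_expanding e r r' s s' u : 0 < e -> e <= r -> e <= r' ->
  0 <= s -> 0 <= s' -> cosh s = cosh r * u -> cosh s' = cosh r' * u ->
  sinh e / cosh e * `|r - r'| <= `|s - s'|.
Proof.
move=> e0; wlog rr' : r r' s s' / r <= r' => [H|] er er' s0 s'0 hs hs'.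
  case: (leP r r') => [|/ltW] rr'; first exact: (H r r' s s').
  by rewrite distrC (distrC s); exact: (H r' r s' s).
have ch := cosh_gt0; set c := sinh e / cosh e.
have c0 : 0 <= c by rewrite divr_ge0 ?sinh_ge0 ?ltW.
have c1 : c <= 1 by rewrite ler_pdivrMr// mul1r ler_sinh_cosh ?ltW.
have u0 : 0 < u by have := ch s; rewrite hs pmulr_rgt0.
rewrite distrC ger0_norm ?subr_ge0//.
apply: (@le_trans _ _ (s' - s)); last by rewrite distrC ler_norm.
rewrite -ler_expR; apply: (le_trans (cosh_ge_expR_combination _ (r' - r) _)).
  by rewrite c0.
(* Monotonicity of tanh; once multiplied out, the difference of the two sides is [sinh (r - e)]. *)
have cr : c * cosh r <= sinh r.
  rewrite /c mulrAC ler_pdivrMr//.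
  have [t t0 ->] : exists2 t, 0 <= t & r = e + t.
    by exists (r - e); [rewrite subr_ge0|ring].
  rewrite coshD sinhD -subr_ge0.
  have -> : (sinh e * cosh t + cosh e * sinh t) * cosh e -
      sinh e * (cosh e * cosh t + sinh e * sinh t)
      = (cosh e ^+ 2 - sinh e ^+ 2) * sinh t by ring.
  by rewrite cosh2B mul1r sinh_ge0.
have h1 : cosh r * (cosh (r' - r) + c * sinh (r' - r)) <= cosh r'.
  rewrite -[in leRHS](subrKC r r').
  rewrite [leRHS]coshD mulrDr lerD2l mulrA (mulrC (cosh r)) ler_wpM2r//.
  by rewrite sinh_ge0 ?subr_ge0.
have h2 : cosh s' <= cosh s * expR (s' - s).
  rewrite -[in leLHS](subrKC s s').
  rewrite [leLHS]coshD -coshDsinh mulrDr lerD2l.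
  case: (leP s s') => ss'.
    by rewrite ler_wpM2r ?sinh_ge0 ?subr_ge0// ler_sinh_cosh.
  exfalso; have := ltr_cosh _ _ s'0 ss'; rewrite hs hs' ltr_pM2r// => h.
  move: rr'; rewrite le_eqVlt => /predU1P[rr'|]; first by rewrite rr' ltxx in h.
  by move/(ltr_cosh _ _ (le_trans (ltW e0) er)); rewrite ltNge (ltW h).
rewrite -(ler_pM2l (ch s)) (le_trans _ h2)// hs hs' mulrAC.
by rewrite ler_wpM2r// ltW.
Qed.

End hyperbolic.

(** * One-dimensional estimates *)

Section expanding.
Variable R : realType.
Notation leb := (@lebesgue_measure R).

Lemma lebesgue_measure_diam_le (E : set R) (l : R) : measurable E -> 0 <= l ->
  (forall x y, E x -> E y -> `|x - y| <= l) -> (leb E <= l%:E)%E.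
Proof.
move=> mE l0 El; have [->|/set0P[x0 Ex0]] := eqVneq E set0.
  by rewrite measure0 lee_fin.
have ubE : has_ubound E.
  exists (x0 + l) => y Ey; have := El _ _ Ey Ex0; rewrite ler_norml; lra.
have lbE : has_lbound E.
  exists (x0 - l) => y Ey; have := El _ _ Ey Ex0; rewrite ler_norml; lra.
have EI : E `<=` `[inf E, sup E]%classic.
  move=> y Ey /=; rewrite in_itv/= ge_inf//=.
  by apply: sup_ubound.
apply: (@le_trans _ _ (leb `[inf E, sup E]%classic)).
  by apply: le_measure => //; rewrite inE//; exact: measurable_itv.
have sl : sup E - l <= inf E.
  apply: lb_le_inf; first by exists x0.
  move=> y Ey; rewrite lerBlDr; apply: ge_sup; first by exists x0.
  move=> x Ex; have := El _ _ Ex Ey; rewrite ler_norml; lra.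
rewrite lebesgue_measure_itv/= lte_fin; case: ifPn => // _.
by rewrite -EFinB lee_fin; lra.
Qed.

Variables (D : set R) (T : R -> R) (c : R).
Hypotheses (c0 : 0 < c) (mD : measurable D) (mT : measurable_fun setT T).
Hypothesis DT : forall x y, D x -> D y -> c * `|x - y| <= `|T x - T y|.

(** On [D] the inverse of [T] is Lipschitz with constant [c^-1], so the preimage of an interval has
    diameter at most [c^-1] times its length. Neither monotonicity nor a derivative of [T]
    enters. *)
Lemma lebesgue_measure_expanding (A : set R) : measurable A ->
  (leb (D `&` T @^-1` A) <= (c^-1)%:E * leb A)%E.
Proof.
move=> mA.
have mP (B : set R) : measurable B -> measurable (D `&` T @^-1` B).
  by move=> mB; apply: measurableI => //; rewrite -[X in measurable X]setTI; exact: mT.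
rewrite -lee_pdivrMl ?invr_gt0// invrK.
(* The measure of [A] is an infimum over countable covers by half-open intervals; each cover is
   pulled back separately. *)
apply: le_ereal_inf_tmp => _ [I [mI AI] <-].
have mIb i : measurable (I i : set R).
  by have /ocitvP[->|[[a b] ab ->]] := mI i; [exact: measurable0|exact: measurable_itv].
apply: (@le_trans _ _ (c%:E * \sum_(k <oo) leb (D `&` T @^-1` (I k)))%E).
  rewrite lee_pmul2l//; apply: measure_sigma_subadditive => //.
  - by move=> i; exact: mP.
  - exact: mP.
  - by move=> x [Dx /AI[i _ Ii]]; exists i.
rewrite -nneseriesZl//.
apply: lee_nneseries => [i _|i _].
  by rewrite mule_ge0// lee_fin ltW.
have /ocitvP[->|[[a b]/= ab ->]] := mI i.
  rewrite preimage_set0 setI0 measure0 mule0.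
  by rewrite [leRHS](_ : _ = 0%E)//; exact: wlength0.
rewrite [leRHS](_ : _ = (b - a)%:E); last exact: (wlength_itv_bnd _ _ _ (ltW ab)).
rewrite -lee_pdivlMl//.
apply: le_trans (_ : leb _ <= (c^-1 * (b - a))%:E)%E _; last by rewrite EFinM.
apply: lebesgue_measure_diam_le.
- by apply: mP; exact: measurable_itv.
- by rewrite mulr_ge0// ?invr_ge0 ?subr_ge0 ltW.
move=> x y [Dx /=]; rewrite in_itv/= => /andP[xa xb] [Dy /=].
rewrite in_itv/= => /andP[ya yb].
rewrite ler_pdivlMl// (le_trans (DT _ _ Dx Dy))// ler_norml; lra.
Qed.

(** The pushforward under [T] of Lebesgue measure on [D] is dominated by [c^-1] times Lebesgue
    measure, and integrals of nonnegative functions are monotone in the measure. *)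
Lemma ge0_integral_expanding (H : R -> \bar R) : measurable_fun setT H ->
  (forall x, 0 <= H x)%E ->
  (\int[leb]_(x in D) H (T x) <= (c^-1)%:E * \int[leb]_x H x)%E.
Proof.
move=> mH H0.
have c'0 : 0 <= c^-1 by rewrite invr_ge0 ltW.
apply: (@le_trans _ _ (\int[pushforward (mrestr leb mD)
    (T : measurableTypeR R -> measurableTypeR R)]_x H x)%E).
  rewrite ge0_integral_pushforward//= preimage_setT.
  have mHT : measurable_fun setT (H \o T) by exact: measurableT_comp.
  apply: (@le_trans _ _ (\int[mrestr leb mD]_(x in D) (H \o T) x)%E); last first.
    by apply: ge0_subset_integral => // x _; exact: H0.
  rewrite [leRHS](eq_measure_integral leb)// => A mA AD.
  by transitivity (leb (A `&` D)); [|rewrite setIidl].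
apply: (@le_trans _ _ (\int[mscale (NngNum c'0) leb]_x H x)%E).
  pose m1 : {measure set (measurableTypeR R) -> \bar R} :=
    pushforward (mrestr leb mD) (T : measurableTypeR R -> measurableTypeR R).
  pose m2 : {measure set (measurableTypeR R) -> \bar R} := mscale (NngNum c'0) leb.
  have m12 S : measurable S -> (m1 mT S <= m2 S)%E.
    move=> mS; have := lebesgue_measure_expanding S mS.
    by rewrite /m1 /m2 /pushforward/= /mrestr /mscale/= setIC.
  have h := @ge0_le_measure_integral _ _ _ (m1 mT) m2 m12 H setT measurableT H0.
  have := h mH. exact.
by rewrite ge0_integral_mscale.
Qed.

End expanding.

(** * Tonelli's theorem over rectangles *)

Section tonelli.
Context d1 d2 (T1 : measurableType d1) (T2 : measurableType d2) (R : realType).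
Variables (m1 : {sigma_finite_measure set T1 -> \bar R})
  (m2 : {sigma_finite_measure set T2 -> \bar R}).
Variables (D1 : set T1) (D2 : set T2) (f : T1 * T2 -> \bar R).
Hypotheses (mD1 : measurable D1) (mD2 : measurable D2).
Hypotheses (mf : measurable_fun setT f) (f0 : forall z, (0 <= f z)%E).

Let g := f \_ (D1 `*` D2).

Let mg : measurable_fun setT g.
Proof.
by apply/(measurable_restrictT _ _).1; [exact: measurableX|exact: measurable_funTS].
Qed.

Let g0 z : (0 <= g z)%E.
Proof. exact: erestrict_ge0. Qed.

Let g_in x y : D1 x -> g (x, y) = ((fun y => f (x, y)) \_ D2) y.
Proof. by move=> Dx; rewrite /g /patch in_setX /= mem_set. Qed.

Let g_notin x y : ~ D1 x -> g (x, y) = 0%E.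
Proof. by move=> Dx; rewrite /g patchE memNset// => -[]. Qed.

Let gF x : (\int[m2]_y g (x, y) = ((fun x => \int[m2]_(y in D2) f (x, y)) \_ D1) x)%E.
Proof.
rewrite [in RHS]/patch; case: ifPn; rewrite (inE, notin_setE) => Dx.
  by rewrite [RHS]integral_mkcond; apply: eq_integral => y _; exact: g_in.
by rewrite integral0_eq// => y _; exact: g_notin.
Qed.

Let gG y : (\int[m1]_x g (x, y) = ((fun y => \int[m1]_(x in D1) f (x, y)) \_ D2) y)%E.
Proof.
rewrite [in RHS]/patch; case: ifPn; rewrite (inE, notin_setE) => Dy.
  rewrite [RHS]integral_mkcond; apply: eq_integral => x _.
  by rewrite /g /patch in_setX /= (mem_set Dy) andbT.
by rewrite integral0_eq// => x _; rewrite /g patchE memNset// => -[].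
Qed.

Lemma ge0_fubini1 : (\int[m1 \x m2]_(z in D1 `*` D2) f z =
  \int[m1]_(x in D1) \int[m2]_(y in D2) f (x, y))%E.
Proof.
rewrite integral_mkcond [RHS]integral_mkcond fubini_tonelli1//.
by apply: eq_integral => x _; exact: gF.
Qed.

Lemma ge0_fubini : (\int[m1]_(x in D1) \int[m2]_(y in D2) f (x, y) =
  \int[m2]_(y in D2) \int[m1]_(x in D1) f (x, y))%E.
Proof.
rewrite integral_mkcond [RHS]integral_mkcond.
transitivity (\int[m1]_x \int[m2]_y g (x, y))%E.
  by apply: eq_integral => x _; rewrite -gF.
transitivity (\int[m2]_y \int[m1]_x g (x, y))%E; first exact: fubini_tonelli.
by apply: eq_integral => y _; rewrite gG.
Qed.

End tonelli.

Section tonelli_measurable.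
Context d1 d2 (T1 : measurableType d1) (T2 : measurableType d2) (R : realType).
Variables (m2 : {sigma_finite_measure set T2 -> \bar R}).
Variables (D2 : set T2) (f : T1 * T2 -> \bar R).
Hypotheses (mD2 : measurable D2).
Hypotheses (mf : measurable_fun setT f) (f0 : forall z, (0 <= f z)%E).

Lemma measurable_ge0_integral_section :
  measurable_fun setT (fun x => \int[m2]_(y in D2) f (x, y))%E.
Proof.
have mg : measurable_fun setT (f \_ (setT `*` D2)).
  by apply/(measurable_restrictT _ _).1; [exact: measurableX|exact: measurable_funTS].
rewrite (_ : (fun _ => _) = fubini_F m2 (f \_ (setT `*` D2))).
  by apply: measurable_fun_fubini_tonelli_F => // z; exact: erestrict_ge0.
apply/funext => x; rewrite integral_mkcond; apply: eq_integral => y _.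
by rewrite /patch in_setX /= in_setT.
Qed.

End tonelli_measurable.

Section hyperbolic_measurability.
Variable R : realType.

Lemma measurable_sinh : measurable_fun setT (@sinh R : measurableTypeR R -> measurableTypeR R).
Proof.
apply: measurable_funM => //; apply: measurable_funB; first exact: measurable_expR.
exact: (measurableT_comp (@measurable_expR R) (@oppr_measurable R setT)).
Qed.

Lemma measurable_cosh : measurable_fun setT (@cosh R : measurableTypeR R -> measurableTypeR R).
Proof.
apply: measurable_funM => //; apply: measurable_funD; first exact: measurable_expR.
exact: (measurableT_comp (@measurable_expR R) (@oppr_measurable R setT)).
Qed.

Lemma measurable_arcosh :
  measurable_fun setT (@arcosh R : measurableTypeR R -> measurableTypeR R).
Proof.
apply: (measurableT_comp (@measurable_ln R)); apply: measurable_funD => //.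
apply: (measurableT_comp (continuous_measurable_fun (@sqrt_continuous R))).
by apply: measurable_funB => //; exact: measurable_funX.
Qed.

Lemma measurable_hweight m d :
  measurable_fun setT (@hweight R m d : measurableTypeR R -> measurableTypeR R).
Proof.
apply: measurable_funM.
  exact: (measurable_funX _ measurable_sinh).
exact: (measurable_funX _ measurable_cosh).
Qed.

Lemma hweight_ge0 m d (r : R) : 0 < r -> 0 <= hweight m d r.
Proof.
by move=> r0; rewrite mulr_ge0// exprn_ge0// ltW ?sinh_gt0 ?cosh_gt0.
Qed.

Lemma hweight_le_cosh m d (r : R) : 0 < r -> hweight m d r <= cosh r ^+ (m + d).
Proof.
move=> r0; rewrite /hweight exprD ler_wpM2r ?exprn_ge0// ?(ltW (cosh_gt0 _ _))//.
by apply: lerXn2r; rewrite ?nnegrE ?ler_sinh_cosh ?sinh_ge0 ?(ltW (cosh_gt0 _ _)) ?ltW.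
Qed.

(** [t] is the hypotenuse of the hyperbolic right triangle with legs [r] and [s]: longer than each
    leg, shorter than their sum. *)
Lemma arcosh_coshM_bounds (r s : R) : 0 < r -> 0 < s ->
  let t := arcosh (cosh r * cosh s) in
  [/\ 0 < t, cosh t = cosh r * cosh s, r < t, s < t & t < r + s].
Proof.
move=> r0 s0 t.
have c1 := cosh_gt1 _ _ r0; have c2 := cosh_gt1 _ _ s0.
have ct : cosh t = cosh r * cosh s by rewrite cosh_arcosh//; nra.
have t0 : 0 <= t by apply: arcosh_ge0; nra.
have rt : r < t by apply: ltr_cosh_inv => //; [exact: ltW|rewrite ct; nra].
split=> //; first exact: lt_trans rt.
- by apply: ltr_cosh_inv => //; [exact: ltW|rewrite ct; nra].
- apply: ltr_cosh_inv => //; first by lra.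
  by rewrite ct coshD ltrDl mulr_gt0 ?sinh_gt0.
Qed.

End hyperbolic_measurability.

(** * Integration of the averaged transform over the distance of the k-plane *)

Section averaged_estimate.
Variable R : realType.
Notation leb := (@lebesgue_measure R).
Variables (m d : nat) (Fb : measurableTypeR R -> \bar R) (e N : R).
Hypotheses (mFb : measurable_fun setT Fb) (Fb0 : forall s, (0 <= Fb s)%E).
Hypotheses (e0 : 0 < e) (eN : e < N).
Hypothesis Fb_fin :
  (\int[leb]_(s in `]e, +oo[) ((cosh s ^+ (m + d))%:E * Fb s) < +oo)%E.

Let q : measurableTypeR R -> \bar R :=
  (fun s => (cosh s ^+ (m + d))%:E * Fb s)%E \_ `]e, +oo[%classic.

Let mq : measurable_fun setT q.
Proof.
apply/(measurable_restrictT _ _).1; first exact: measurable_itv.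
apply: measurable_funTS; apply: emeasurable_funM => //.
by apply/measurable_EFinP; exact: (measurable_funX _ (measurable_cosh R)).
Qed.

Let q0 s : (0 <= q s)%E.
Proof.
apply: erestrict_ge0 => t _; rewrite mule_ge0// lee_fin.
by rewrite exprn_ge0// ltW// cosh_gt0.
Qed.

(** The band [0 < t - s < N]. By the right triangle inequalities it contains [(s, t)] whenever [t]
    has legs [r < N] and [s], and its sections at fixed [t] have length at most [N]. *)
Let B : set (measurableTypeR R * measurableTypeR R) :=
  (fun z => z.2 - z.1 : measurableTypeR R) @^-1` `]0, N[%classic.

Let mB : measurable B.
Proof.
rewrite -[X in measurable X]setTI; apply: measurable_funB => //.
Qed.

Let Q (z : measurableTypeR R * measurableTypeR R) : \bar R :=
  (q z.2 * (\1_B z)%:E)%E.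

Let mQ : measurable_fun setT Q.
Proof.
apply: emeasurable_funM.
  exact: (measurableT_comp mq measurable_snd).
by apply/measurable_EFinP; exact: measurable_indic.
Qed.

Let Q0 z : (0 <= Q z)%E.
Proof. by rewrite mule_ge0. Qed.

Let S (z : measurableTypeR R * measurableTypeR R) : measurableTypeR R :=
  arcosh (cosh z.1 * cosh z.2).

Let mS : measurable_fun setT S.
Proof.
apply: (measurableT_comp (measurable_arcosh R)); apply: measurable_funM.
  exact: (measurableT_comp (measurable_cosh R) measurable_fst).
exact: (measurableT_comp (measurable_cosh R) measurable_snd).
Qed.

Let c := sinh e / cosh e.

Let c0 : 0 < c.
Proof. by rewrite divr_gt0 ?sinh_gt0 ?cosh_gt0. Qed.

(* Since [cosh (arcosh (cosh r * cosh s)) >= cosh s], the weight is absorbed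
   by [cosh ^+ (m + d)]; the change of variable in [r] is expanding. *)
Lemma averaged_estimate :
  (\int[leb]_(r in `]e, N[) \int[leb]_(s in `]0%R, +oo[)
     (`|hweight m d s|%:E * Fb (arcosh (cosh r * cosh s))) < +oo)%E.
Proof.
have N0 : 0 < N := lt_trans e0 eN.
pose f z := (`|hweight m d z.2|%:E * Fb (S z))%E.
have mf : measurable_fun setT f.
  apply: emeasurable_funM; last exact: measurableT_comp.
  apply/measurable_EFinP; apply: (measurableT_comp (@normr_measurable R setT)).
  exact: (measurableT_comp (measurable_hweight R m d) measurable_snd).
have f0 z : (0 <= f z)%E by rewrite mule_ge0// lee_fin.
(* With [s] held fixed, the inner integral over [r] is open to the expanding change of variable
   [r -> S (r, s)]. *)
rewrite (@ge0_fubini _ _ _ _ _ leb leb _ _ f)//.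
have mono s : 0 < s ->
    (\int[leb]_(r in `]e, N[) f (r, s) <= (c^-1)%:E * \int[leb]_t Q (s, t))%E.
  move=> s0.
  have mQs : measurable_fun setT (fun t => Q (s, t)).
    by apply: measurableT_comp => //; exact: measurable_pair1.
  have mSs : measurable_fun setT (fun t => S (t, s)).
    by apply: measurableT_comp => //; exact: measurable_pair2.
  have mfs : measurable_fun setT (fun t => f (t, s)).
    by apply: measurableT_comp => //; exact: measurable_pair2.
  apply: le_trans (ge0_integral_expanding R `]e, N[%classic
    (fun t => S (t, s)) c c0 _ _ _ (fun t => Q (s, t)) _ _) => //.
    apply: ge0_le_integral => //.
    - exact: measurable_funTS.
    - by apply: measurable_funTS; exact: (measurableT_comp mQs mSs).
    move=> r /=; rewrite in_itv/= => /andP[er rN].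
    have r0 := lt_trans e0 er.
    have [t0 ct rt st trs] := arcosh_coshM_bounds R r s r0 s0.
    rewrite /f /Q /= {2}/S/= indicE mem_set; last first.
      by rewrite /B/= /S in_itv/= subr_gt0 st/=; lra.
    rewrite mule1 /q patchE mem_set; last by rewrite /= in_itv/= andbT /S/=; lra.
    rewrite lee_wpmul2r// lee_fin ger0_norm ?hweight_ge0//.
    rewrite (le_trans (hweight_le_cosh _ _ _ _ s0))//.
    by apply: lerXn2r; rewrite ?nnegrE ?(ltW (cosh_gt0 _ _))// ltW// ltr_cosh// ltW.
  move=> r r' /=; rewrite !in_itv/= => /andP[er rN] /andP[er' r'N].
  have r0 := lt_trans e0 er; have r'0 := lt_trans e0 er'.
  have [t0 ct _ _ _] := arcosh_coshM_bounds R r s r0 s0.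
  have [t'0 ct' _ _ _] := arcosh_coshM_bounds R r' s r'0 s0.
  by apply: cosh_ratio_expanding ct ct' => //; exact: ltW.
apply: (@le_lt_trans _ _ (\int[leb]_(s in `]0%R, +oo[) ((c^-1)%:E * \int[leb]_t Q (s, t)))%E).
  apply: ge0_le_integral => //.
  - by move=> s _; apply: integral_ge0.
  - apply: measurable_funTS.
    apply: (measurable_ge0_integral_section _ _ _ _ _ leb `]e, N[%classic
      (fun z => f (z.2, z.1))) => //.
    by apply: measurableT_comp => //; exact: measurable_swap.
  - apply: measurable_funTS; apply: emeasurable_funM => //.
    exact: (measurable_ge0_integral_section _ _ _ _ _ leb setT Q).
  - by move=> s /=; rewrite in_itv/= andbT; exact: mono.
have mIQ : measurable_fun setT (fun s => \int[leb]_t Q (s, t))%E.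
  exact: (measurable_ge0_integral_section _ _ _ _ _ leb setT Q).
rewrite ge0_integralZl//; last 3 first.
- exact: measurable_funTS.
- by move=> s _; apply: integral_ge0.
- by rewrite lee_fin invr_ge0 ltW.
apply: lte_mul_pinfty; [by rewrite lee_fin invr_ge0 ltW|by []|].
(* With [t] held fixed instead, [q t] is a constant and the band leaves for [s] only a set of length
   at most [N]. *)
rewrite (@ge0_fubini _ _ _ _ _ leb leb _ _ Q)//.
apply: (@le_lt_trans _ _ (\int[leb]_t (q t * N%:E))%E).
  apply: ge0_le_integral => //.
  - by move=> s _; apply: integral_ge0.
  - apply: (measurable_ge0_integral_section _ _ _ _ _ leb `]0, +oo[%classic
      (fun z => Q (z.2, z.1))) => //.
    by apply: measurableT_comp => //; exact: measurable_swap.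
  - exact: emeasurable_funM.
  move=> t _; rewrite /Q/=.
  have mBt : measurable (ysection B t) by exact: measurable_ysection.
  rewrite (eq_integral (fun s => q t * (\1_(ysection B t) s)%:E))%E; last first.
    by move=> s _; rewrite !indicE mem_ysection.
  rewrite ge0_integralZl//; last first.
    by apply/measurable_funTS/measurable_EFinP; exact: measurable_indic.
  rewrite lee_wpmul2l// integral_indic//.
  apply: (@le_trans _ _ (leb `]t - N, t[%classic)).
    apply: le_measure; rewrite ?inE//; first exact: measurableI.
    move=> s []; rewrite /ysection/= inE /B/= in_itv/= in_itv/= => /andP[? ?] _ /=; rewrite in_itv.
    by rewrite /= ltrBlDl -ltrBlDr -(subr_gt0 (s : R)); apply/andP.
  rewrite lebesgue_measure_itv/= lte_fin; case: ifPn => _; last by rewrite lee_fin ltW.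
  by rewrite -EFinB lee_fin opprB addrC subrK.
rewrite ge0_integralZr//; last by rewrite lee_fin ltW.
rewrite muleC; apply: lte_mul_pinfty; [by rewrite lee_fin ltW|by []|].
by rewrite /q -integral_mkcond.
Qed.

End averaged_estimate.

(** * Exponential integrals and positivity of the sphere area *)

Section exponential_tail.
Variable R : realType.
Notation leb := (@lebesgue_measure R).

(** Up to the factor [a] the integrand is the density of the exponential law, of total mass one. *)
Lemma integral_expRN_lty (a : R) : 0 < a ->
  (\int[leb]_(s in `]0%R, +oo[) (expR (- a * s))%:E < +oo)%E.
Proof.
move=> a0.
have mexp : measurable_fun setT (fun s : measurableTypeR R => (expR (- a * s))%:E).
  apply/measurable_EFinP; apply: (measurableT_comp (@measurable_expR R)).
  exact: mulrl_measurable.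
have mpdf : measurable_fun setT
    (fun s : measurableTypeR R => (exponential_pdf a s)%:E).
  by apply/measurable_EFinP; exact: measurable_exponential_pdf.
apply: (@le_lt_trans _ _ (\int[leb]_(s in `]0%R, +oo[)
    ((a^-1)%:E * (exponential_pdf a s)%:E))%E).
  apply: ge0_le_integral => //.
  - exact: measurable_funTS.
  - by apply: measurable_funTS; exact: emeasurable_funM.
  move=> s /=; rewrite in_itv/= andbT => s0; rewrite exponential_pdfE ?(ltW s0)//.
  by rewrite -EFinM mulKf ?gt_eqF.
rewrite ge0_integralZl//; last 3 first.
- exact: measurable_funTS.
- by move=> s _; rewrite lee_fin exponential_pdf_ge0// ltW.
- by rewrite lee_fin invr_ge0 ltW.
apply: lte_mul_pinfty; [by rewrite lee_fin invr_ge0 ltW|by []|].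
apply: (@le_lt_trans _ _ (\int[leb]_s (exponential_pdf a s)%:E)%E); last first.
  by rewrite integral_exponential_pdf// ltry.
apply: ge0_subset_integral => //.
by move=> s _; rewrite lee_fin exponential_pdf_ge0// ltW.
Qed.

Lemma powR_le_expR (a : R) : 0 <= a ->
  exists2 C : R, 0 < C & forall t, 0 < t -> t `^ a <= C * expR (t / 2).
Proof.
rewrite le_eqVlt => /predU1P[<-|a0].
  exists 1 => // t0 t00; rewrite powRr0 mul1r -expR0 ler_expR.
  by rewrite divr_ge0// ltW.
exists ((2 * a) `^ a); first by rewrite powR_gt0 ?mulr_gt0.
move=> t0 t00; set u := t0 / (2 * a).
have u0 : 0 < u by rewrite divr_gt0 ?mulr_gt0.
have -> : t0 = 2 * a * u by rewrite /u mulrCA mulfV ?mulr1 ?gt_eqF ?mulr_gt0.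
rewrite [leLHS]powRM ?(ltW u0) ?mulr_ge0 ?(ltW a0)// ler_wpM2l ?powR_ge0//.
have -> : 2 * a * u / 2 = u * a by field.
rewrite expRM; apply: ge0_ler_powR; rewrite ?nnegrE ?expR_ge0 ?ltW//.
by have := expR_ge1Dx u; lra.
Qed.

(** The real-valued integral reads an infinite value as zero, so positivity demands convergence as
    well: a lower bound on [[1, 2]] and an exponential upper bound. *)
Lemma Gamma_gt0 (x : R) : 1 <= x -> 0 < Gamma x.
Proof.
move=> x1; rewrite /Gamma /Rintegral.
pose g (t : measurableTypeR R) : \bar R := (t `^ (x - 1) * expR (- t))%:E.
have mg : measurable_fun setT g.
  apply/measurable_EFinP; apply: measurable_funM; first exact: measurable_powR.
  exact: (measurableT_comp (@measurable_expR R) (@oppr_measurable R setT)).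
have g0 t : (0 <= g t)%E by rewrite lee_fin mulr_ge0 ?powR_ge0 ?expR_ge0.
have [|C C0 HC] := powR_le_expR (x - 1); first by lra.
apply: fine_gt0; apply/andP; split.
  apply: (@lt_le_trans _ _ (\int[leb]_(t in `[1%R, 2%R]) (expR (- 2))%:E)%E).
    rewrite integral_cst//= lebesgue_measure_itv/= lte_fin ltr1n.
    by rewrite -EFinB -EFinM lte_fin mulr_gt0 ?expR_gt0//; lra.
  apply: (@le_trans _ _ (\int[leb]_(t in `[1%R, 2%R]) g t)%E).
    apply: ge0_le_integral => //.

    - exact: measurable_funTS.
    move=> t /=; rewrite in_itv/= => /andP[t1 t2]; rewrite lee_fin.
    rewrite -[leLHS]mul1r; apply: ler_pM; rewrite ?expR_ge0//.
      by rewrite -[leLHS](powRr0 t); apply: ler_powR => //; rewrite subr_ge0.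
    by rewrite ler_expR lerN2.
  apply: ge0_subset_integral => //; first exact: measurable_funTS.
  by move=> t /=; rewrite !in_itv/= andbT => /andP[t1 _]; exact: lt_le_trans t1.
apply: (@le_lt_trans _ _ (\int[leb]_(t in `]0%R, +oo[)
    (C%:E * (expR (- 2^-1 * t))%:E))%E).
  apply: ge0_le_integral => //.
  - by move=> t _; exact: g0.
  - exact: (measurable_funTS mg).
  - apply: measurable_funTS; apply: emeasurable_funM => //.
    apply/measurable_EFinP; apply: (measurableT_comp (@measurable_expR R)).
    exact: mulrl_measurable.
  move=> t /=; rewrite in_itv/= andbT => t0; rewrite lee_fin.
  have -> : - 2^-1 * t = t / 2 + - t by field.
  by rewrite expRD mulrA ler_wpM2r ?expR_ge0// HC.
have mE : measurable_fun setT (fun t : measurableTypeR R => (expR (- 2^-1 * t))%:E).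
  apply/measurable_EFinP; apply: (measurableT_comp (@measurable_expR R)).
  exact: mulrl_measurable.
rewrite ge0_integralZl//; last 2 first.
- exact: measurable_funTS.
- by rewrite lee_fin ltW.
apply: lte_mul_pinfty; [by rewrite lee_fin ltW|by []|].
by apply: integral_expRN_lty; rewrite invr_gt0.
Qed.

(** A positive constant in [invariant_measure] lets finiteness pass from the norm of [f] to the
    radial integral. There [m = n - j], at least 2 because [j < k < n]. *)
Lemma sphere_area_gt0 m : (2 <= m)%N -> 0 < sphere_area R m.
Proof.
move=> m2; rewrite /sphere_area divr_gt0 ?mulr_gt0 ?powR_gt0 ?pi_gt0//.
by apply: Gamma_gt0; rewrite ler_pdivlMr// mul1r ler_nat.
Qed.

End exponential_tail.

(** * From the norm of [f] to a weighted integral of its averages *)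

Section weighted_norm.
Variable R : realType.
Notation leb := (@lebesgue_measure R).

(* With [b = N / p], either [x <= C^-b], or [x = x^p x^(1-p) <= x^p C^(N-b)]. *)
Lemma le_powR_weight (p x C : R) (k N : nat) : 1 <= p -> k%:R * p < N%:R ->
  1 <= C -> 0 <= x ->
  C ^+ k * x <= C ^+ N * x `^ p + C `^ (k%:R - N%:R / p).
Proof.
move=> p1 kp C1 x0; set b := N%:R / p.
have p0 : 0 < p by lra.
have kb : k%:R < b by rewrite ltr_pdivlMr.
have C0 : 0 < C by lra.
rewrite -!powR_mulrn ?(ltW C0)//.
case: (leP x (C `^ (- b))) => xC.
  rewrite ler_wpDl ?mulr_ge0 ?powR_ge0//.
  by rewrite powRD ?(gt_eqF C0) ?implybT// ler_wpM2l ?powR_ge0.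
have {x0} x0 : 0 < x by rewrite (lt_trans _ xC)// powR_gt0.
rewrite ler_wpDr ?powR_ge0//.
have hx : x = x `^ p * x `^ (1 - p).
  by rewrite -powRD ?(gt_eqF x0) ?implybT// addrC subrK powRr1 ?ltW.
have bp : b * p = N%:R by rewrite /b divfK// gt_eqF.
have h : x `^ (1 - p) <= C `^ (b * (p - 1)).
  have -> : b * (p - 1) = - b * - (p - 1) by ring.
  rewrite [leRHS]powRrM -(opprB p) !powRN lef_pV2 ?posrE ?powR_gt0 ?invr_gt0 ?powR_gt0//.
  rewrite -powRN.
  by apply: ge0_ler_powR; rewrite ?nnegrE ?powR_ge0 ?(ltW x0) ?(ltW xC)//; lra.
rewrite [X in _ * X <= _]hx mulrCA mulrC ler_wpM2r ?powR_ge0//.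
apply: (@le_trans _ _ (C `^ k%:R * C `^ (b * (p - 1)))).
  by rewrite ler_wpM2l ?powR_ge0.
rewrite -powRD ?(gt_eqF C0) ?implybT//; apply: ler_powR => //.
by rewrite mulrBr bp mulr1; lra.
Qed.

Variables (p : R) (k m d : nat) (Fb Gb : measurableTypeR R -> \bar R) (e : R).
Hypotheses (p1 : 1 <= p) (kp : k%:R * p < (m + d)%:R) (e0 : 0 < e).
Hypotheses (mFb : measurable_fun setT Fb) (Fb0 : forall s, (0 <= Fb s)%E).
Hypotheses (mGb : measurable_fun setT Gb) (Gb0 : forall s, (0 <= Gb s)%E).
Hypothesis FGb : forall s, ((cosh s ^+ k)%:E * Fb s <=
  (cosh s ^+ (m + d))%:E * Gb s + (cosh s `^ (k%:R - (m + d)%:R / p))%:E)%E.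
Hypothesis Gb_fin :
  (\int[leb]_(s in `]0%R, +oo[) ((hweight m d s)%:E * Gb s) < +oo)%E.

Lemma weighted_norm_estimate :
  (\int[leb]_(s in `]e, +oo[) ((cosh s ^+ k)%:E * Fb s) < +oo)%E.
Proof.
pose eta := (m + d)%:R / p - k%:R; pose c := cosh e / sinh e.
have p0 : 0 < p by exact: lt_le_trans p1.
have eta0 : 0 < eta by rewrite subr_gt0 ltr_pdivlMr.
have c0 : 0 < c by rewrite divr_gt0 ?sinh_gt0 ?cosh_gt0.
have mC i : measurable_fun setT (fun s : measurableTypeR R => (cosh s ^+ i)%:E).
  by apply/measurable_EFinP; exact: (measurable_funX _ (measurable_cosh R)).
have mE : measurable_fun setT (fun s : measurableTypeR R => (expR (- eta * s))%:E).
  apply/measurable_EFinP; apply: (measurableT_comp (@measurable_expR R)).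
  exact: mulrl_measurable.
have mW : measurable_fun setT (fun s => (hweight m d s)%:E * Gb s)%E.
  apply: emeasurable_funM => //; apply/measurable_EFinP.
  exact: measurable_hweight.
have pos (s : R) : `]e, +oo[%classic s -> e < s /\ 0 < s.
  by rewrite /= in_itv/= andbT => es; split => //; exact: lt_trans es.
have pt s : `]e, +oo[%classic s -> ((cosh s ^+ k)%:E * Fb s <=
    (c ^+ m)%:E * ((hweight m d s)%:E * Gb s) +
    (2 `^ eta)%:E * (expR (- eta * s))%:E)%E.
  move=> /pos[es s0]; apply: (le_trans (FGb s)); apply: leeD.
    rewrite muleA -EFinM lee_wpmul2r// lee_fin /hweight exprD mulrA.
    rewrite ler_wpM2r ?exprn_ge0 ?(ltW (cosh_gt0 _ _))//.
    rewrite -exprMn; apply: lerXn2r.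
    - by rewrite nnegrE ltW// cosh_gt0.
    - by rewrite nnegrE ltW// mulr_gt0// sinh_gt0.
    rewrite /c mulrAC ler_pdivlMr ?sinh_gt0// -subr_ge0.
    rewrite -(subrKC e s) coshD sinhD.
    have -> : cosh e * (sinh e * cosh (s - e) + cosh e * sinh (s - e)) -
      (cosh e * cosh (s - e) + sinh e * sinh (s - e)) * sinh e
      = (cosh e ^+ 2 - sinh e ^+ 2) * sinh (s - e) by ring.
    by rewrite cosh2B mul1r sinh_ge0// subr_ge0 ltW.
  have -> : k%:R - (m + d)%:R / p = - eta by rewrite /eta opprB.
  have -> : - eta * s = - (s * eta) by ring.
  rewrite -EFinM lee_fin expRN expRM powRN ler_pdivlMr ?powR_gt0 ?expR_gt0//.
  rewrite ler_pdivrMl ?powR_gt0 ?cosh_gt0// mulrC.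
  rewrite -powRM ?(ltW (cosh_gt0 _ _))//; apply: ge0_ler_powR.
  - exact: ltW.
  - by rewrite nnegrE expR_ge0.
  - by rewrite nnegrE mulr_ge0// ltW ?cosh_gt0.
  - exact: expR_le_2cosh.
apply: (@le_lt_trans _ _ (\int[leb]_(s in `]e, +oo[)
   ((c ^+ m)%:E * ((hweight m d s)%:E * Gb s) +
    (2 `^ eta)%:E * (expR (- eta * s))%:E))%E).
  apply: ge0_le_integral => //.
  - by move=> s _; rewrite mule_ge0// lee_fin exprn_ge0// ltW ?cosh_gt0.
  - by apply: measurable_funTS; exact: emeasurable_funM.
  - by apply: measurable_funTS; apply: emeasurable_funD; exact: emeasurable_funM.
have hw0 (s : R) : `]e, +oo[%classic s -> (0 <= (hweight m d s)%:E * Gb s)%E.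
  by move=> /pos[_ s0]; rewrite mule_ge0// lee_fin hweight_ge0.
have cm0 : 0 <= c ^+ m by rewrite exprn_ge0 ?ltW.
have sub : `]e, +oo[%classic `<=` (`]0, +oo[%classic : set R).
  by move=> s /pos[_ s0]; rewrite /= in_itv/= s0.
rewrite ge0_integralD//; last 3 first.
- by move=> s es; rewrite mule_ge0// ?lee_fin// hw0.
- by apply: measurable_funTS; exact: emeasurable_funM.
- by apply: measurable_funTS; exact: emeasurable_funM.
rewrite !ge0_integralZl//; last 2 first.
- exact: measurable_funTS.
- exact: measurable_funTS.
apply: lte_add_pinfty; apply: lte_mul_pinfty => //.
- apply: le_lt_trans Gb_fin; apply: ge0_subset_integral => //.
    exact: measurable_funTS.
  move=> s /=; rewrite in_itv/= andbT => s0.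
  by rewrite mule_ge0// lee_fin hweight_ge0.
apply: le_lt_trans (integral_expRN_lty _ _ eta0); apply: ge0_subset_integral => //.
exact: measurable_funTS.
Qed.

End weighted_norm.

(** * Lorentz matrices and totally geodesic submanifolds *)

Section dot_product.
Variables (R : realType) (m : nat).
Implicit Types (u v w : 'cV[R]_m) (A : 'M[R]_m).

Lemma dotpE u v : dotp u v = (u^T *m v) 0 0.
Proof. by rewrite mxE; apply: eq_bigr => i _; rewrite mxE. Qed.

Lemma dotpC u v : dotp u v = dotp v u.
Proof. by apply: eq_bigr => i _; rewrite mulrC. Qed.

Lemma dotpDl u v w : dotp (u + v) w = dotp u w + dotp v w.
Proof. by rewrite !dotpE linearD/= mulmxDl mxE. Qed.

Lemma dotpDr u v w : dotp w (u + v) = dotp w u + dotp w v.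
Proof. by rewrite !(dotpC w) dotpDl. Qed.

Lemma dotpZl a u w : dotp (a *: u) w = a * dotp u w.
Proof. by rewrite !dotpE linearZ/= -scalemxAl mxE. Qed.

Lemma dotpZr a u w : dotp w (a *: u) = a * dotp w u.
Proof. by rewrite !(dotpC w) dotpZl. Qed.

Lemma dotpNl u w : dotp (- u) w = - dotp u w.
Proof. by rewrite -scaleN1r dotpZl mulN1r. Qed.

Lemma dotp0l w : dotp 0 w = 0.
Proof. by rewrite -(scale0r 0) dotpZl mul0r. Qed.

Lemma dotp_mull A u v : dotp (A *m u) v = dotp u (A^T *m v).
Proof. by rewrite !dotpE trmx_mul mulmxA. Qed.

Lemma dotp_ge0 u : 0 <= dotp u u.
Proof. by apply: sumr_ge0 => i _; rewrite -expr2 sqr_ge0. Qed.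

Lemma dotp_eq0 u : dotp u u = 0 -> u = 0.
Proof.
move=> /eqP; rewrite psumr_eq0 => [/allP h|i _]; last by rewrite -expr2 sqr_ge0.
apply/matrixP => i j; rewrite ord1 mxE; have := h i; rewrite mem_index_enum.
by move=> /(_ isT); rewrite /= mulf_eq0 orbb => /eqP.
Qed.

Lemma enorm_lt1 u : (enorm u < 1) = (dotp u u < 1).
Proof. by rewrite -{1}sqrtr1 ltr_sqrt. Qed.

Lemma bvecE (p : 'I_m) : bvec R m p.+1 = delta_mx p 0.
Proof. by apply/matrixP => i j; rewrite !mxE ord1 eqxx andbT eqSS. Qed.

Lemma dotp_bvecl (p : 'I_m) u : dotp (bvec R m p.+1) u = u p 0.
Proof.
rewrite /dotp (bigD1 p)//= big1 => [|i ip]; first by rewrite mxE eqxx mul1r addr0.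
by rewrite mxE eqSS (_ : (_ == _) = false) ?mul0r//; apply/negbTE.
Qed.

Lemma dotp_bvecr (p : 'I_m) u : dotp u (bvec R m p.+1) = u p 0.
Proof. by rewrite dotpC dotp_bvecl. Qed.

Lemma cV_sum_bvec u : u = \sum_(p < m) u p 0 *: bvec R m p.+1.
Proof.
apply/matrixP => i j; rewrite ord1 summxE (bigD1 i)//= big1 => [|q qi].
  by rewrite !mxE eqxx mulr1 addr0.
by rewrite !mxE eqSS (_ : (_ == _) = false) ?mulr0//; apply/negbTE; rewrite eq_sym.
Qed.

Lemma orthogonal_mxP A :
  (A^T *m A = 1%:M) <-> (forall u v, dotp (A *m u) (A *m v) = dotp u v).
Proof.
split=> [h u v|h]; first by rewrite dotp_mull mulmxA h mul1mx.
apply/matrixP => i j.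
have -> : (A^T *m A) i j = dotp (bvec R m i.+1) (A^T *m A *m bvec R m j.+1).
  by rewrite dotp_bvecl bvecE -colE [RHS]mxE.
rewrite -mulmxA -dotp_mull h.
by rewrite dotp_bvecl bvecE !mxE eqxx andbT.
Qed.

Lemma orthogonal_det_sqr A : A^T *m A = 1%:M -> \det A ^+ 2 = 1.
Proof.
by move=> /(congr1 determinant); rewrite det_mulmx det_tr det1 expr2.
Qed.

(** Basis vectors are numbered from 1 and coordinates from 0: the span of [e_(p+1), ..., e_m] is cut
    out by the coordinates [l < p]. *)
Lemma mem_span_bvec (p q : nat) u : (p + q = m)%N ->
  (u \in <<[seq bvec R m i | i <- iota (p + 1) q]>>%VS) =
  [forall l : 'I_m, (l < p)%N ==> (u l 0 == 0)].
Proof.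
move=> pq; apply/idP/forallP => [/coord_span -> l|h].
  apply/implyP => lp; rewrite summxE big1// => i _.
  have ip := ltn_ord i.
  rewrite mxE (nth_map 0%N) ?size_iota//= nth_iota//.
  by rewrite mxE (_ : (_ == _) = false) ?mulr0//; apply/negbTE; lia.
rewrite (cV_sum_bvec u); apply: memv_suml => l _.
have /implyP := h l; case: ltnP => [_ /(_ isT)/eqP ->|pl _].
  by rewrite scale0r mem0v.
apply: memvZ; apply: memv_span; apply/mapP; exists l.+1 => //.
by rewrite mem_iota; have := ltn_ord l; lia.
Qed.

Lemma dim_span_bvec (p q : nat) : (p + q = m)%N ->
  \dim <<[seq bvec R m i | i <- iota (p + 1) q]>>%VS = q.
Proof.
move=> pq; set X := map _ _.
have sX : size X = q by rewrite size_map size_iota.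
rewrite -[RHS]sX; apply/eqP; change (free X).
apply/(@freeP _ _ _ (in_tuple X)) => c cX i.
have ip := ltn_ord i; rewrite [X in (_ < X)%N]sX in ip.
have pm : (p + i < m)%N by move: ip; rewrite -(ltn_add2l p) pq.
move: cX => /matrixP/(_ (Ordinal pm) 0); rewrite summxE mxE (bigD1 i)//= big1.
  rewrite mxE (nth_map 0%N) ?size_iota// nth_iota// mxE /=.
  by rewrite addnAC addn1 eqxx mulr1 addr0.
move=> j ji; have jp := ltn_ord j; rewrite [X in (_ < X)%N]sX in jp.
rewrite mxE (nth_map 0%N) ?size_iota// nth_iota// mxE /=.
rewrite (_ : (_ == _) = false) ?mulr0//; apply/negbTE.
apply: contra ji => /eqP h; apply/eqP/val_inj => /=; lia.
Qed.

End dot_product.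

Set Implicit Arguments.
Unset Strict Implicit.
Unset Printing Implicit Defensive.

Section lorentz.
Variables (R : realType) (n : nat).
Implicit Types (u v : 'cV[R]_n) (s t r : R) (x y z : 'cV[R]_(n + 1)).
Implicit Types (M : 'M[R]_(n + 1)) (A B : 'M[R]_n).

Definition last_ord : 'I_(n + 1) := rshift n ord0.

Definition vec u s : 'cV[R]_(n + 1) := col_mx u s%:M.

Definition minkmx : 'M[R]_(n + 1) := block_mx (- 1%:M) 0 0 1%:M.

(** The Lorentz transformations that preserve the sheet: the corner entry is the last coordinate of
    the image of the origin. *)
Definition lorentz : set 'M[R]_(n + 1) :=
  [set M | M^T *m minkmx *m M = minkmx /\ 0 < M last_ord last_ord].

Lemma vecK x : vec (usubmx x) (x last_ord 0) = x.
Proof.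
rewrite -[RHS]vsubmxK /vec; congr col_mx; apply/matrixP => i j.
by rewrite !ord1 !mxE eqxx.
Qed.

Lemma vec_last u s : vec u s last_ord 0 = s.
Proof. by rewrite col_mxEd mxE eqxx. Qed.

Lemma vec_coord u s (p : 'I_n) : vec u s (lshift 1 p) 0 = u p 0.
Proof. by rewrite col_mxEu. Qed.

Lemma vecZ a u s : a *: vec u s = vec (a *: u) (a * s).
Proof. by rewrite /vec scale_col_mx scale_scalar_mx. Qed.

Lemma vecD u s v t : vec u s + vec v t = vec (u + v) (s + t).
Proof. by rewrite /vec add_col_mx raddfD. Qed.

Lemma minkE x y : mink x y = (x^T *m minkmx *m y) 0 0.
Proof.
rewrite /mink !dotpE -{3}(vsubmxK x) -{3}(vsubmxK y) tr_col_mx mul_row_block.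
by rewrite !mulmx0 !mulmx1 addr0 add0r mulmxN mulmx1 mul_row_col mulNmx !mxE.
Qed.

Lemma mink_vec u s v t : mink (vec u s) (vec v t) = - dotp u v + s * t.
Proof.
rewrite /mink /vec !col_mxKu !col_mxKd; congr (_ + _).
by rewrite /dotp big_ord1 !mxE eqxx.
Qed.

Lemma minkC x y : mink x y = mink y x.
Proof. by rewrite /mink dotpC (dotpC _ _ (dsubmx x)). Qed.

Lemma minkDl x y z : mink (x + y) z = mink x z + mink y z.
Proof. by rewrite !minkE linearD/= !mulmxDl mxE. Qed.

Lemma minkZl a x z : mink (a *: x) z = a * mink x z.
Proof. by rewrite !minkE linearZ/= -!scalemxAl mxE. Qed.

Lemma minkDr x y z : mink z (x + y) = mink z x + mink z y.
Proof. by rewrite !(minkC z) minkDl. Qed.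

Lemma minkZr a x z : mink z (a *: x) = a * mink z x.
Proof. by rewrite !(minkC z) minkZl. Qed.

Lemma hspace_vec u s : hspace (vec u s) <-> (s ^+ 2 - dotp u u = 1 /\ 0 < s).
Proof. by rewrite /hspace/= mink_vec vec_last addrC expr2. Qed.

Lemma minkmxK : minkmx *m minkmx = 1%:M.
Proof.
rewrite mulmx_block !mulmx0 !mul0mx !addr0 !add0r mulmx1 mulNmx mul1mx opprK.
by rewrite -scalar_mx_block.
Qed.

Lemma minkE_dotp x y : mink x y = dotp x (minkmx *m y).
Proof. by rewrite minkE dotpE mulmxA. Qed.

Lemma lorentzP M :
  M^T *m minkmx *m M = minkmx <-> forall x y, mink (M *m x) (M *m y) = mink x y.
Proof.
split=> [h x y|h]; first by rewrite !minkE trmx_mul !mulmxA -(mulmxA _ M^T) -(mulmxA _ _ M) h.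
apply/matrixP => i j.
have e (B : 'M[R]_(n + 1)) : B i j = dotp (bvec R _ i.+1) (B *m bvec R _ j.+1).
  by rewrite dotp_bvecl bvecE -colE [RHS]mxE.
rewrite [LHS]e [RHS]e -minkE_dotp -h minkE_dotp dotp_mull !mulmxA.
by [].
Qed.

(** The inverse on [lorentz], by a formula that is continuous on all matrices. *)
Definition lorentz_inv M := minkmx *m M^T *m minkmx.

Lemma lorentz_mulVmx M : lorentz M -> lorentz_inv M *m M = 1%:M.
Proof. by move=> [h _]; rewrite /lorentz_inv -!mulmxA (mulmxA M^T) h minkmxK. Qed.

Lemma lorentz_mulmxV M : lorentz M -> M *m lorentz_inv M = 1%:M.
Proof. by move=> /lorentz_mulVmx/mulmx1C. Qed.

Lemma lorentz_mink M x y : lorentz M -> mink (M *m x) (M *m y) = mink x y.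
Proof. by move=> [/lorentzP]. Qed.

(** With [q = - t / s > 0] the vector [q *: x + y] has last coordinate zero, so the form is
    nonpositive on it: [q ^+ 2 + 2 * q * mink x y + 1 <= 0]. *)
Lemma mink_lt0 x y : hspace x -> mink y y = 1 -> y last_ord 0 < 0 -> mink x y < 0.
Proof.
rewrite -(vecK x) -(vecK y).
move: (usubmx x) (x last_ord 0) (usubmx y) (y last_ord 0) => u s v t.
move=> /hspace_vec[us s0]; rewrite !mink_vec vec_last => vt t0.
set q := - t / s.
have q0 : 0 < q by rewrite divr_gt0// oppr_gt0.
have := dotp_ge0 _ _ (q *: u + v).
rewrite dotpDl !dotpDr !dotpZl !dotpZr (dotpC _ _ v u) => h.
have qs : q * s = - t by rewrite /q divfK// gt_eqF.
have h2 : 0 < 2 * q * (dotp u v - s * t).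
  have -> : 2 * q * (dotp u v - s * t) = 2 * q * dotp u v - 2 * (q * s) * t by ring.
  rewrite qs; have : q * (q * dotp u u) = t ^+ 2 - q ^+ 2.
    have -> : dotp u u = s ^+ 2 - 1 by rewrite -us; ring.
    have -> : t ^+ 2 = (q * s) ^+ 2 by rewrite qs sqrrN.
    by ring.
  move: h q0 vt; nra.
rewrite addrC subr_lt0 -subr_gt0.
by move: h2; rewrite pmulr_rgt0// mulr_gt0.
Qed.

Lemma mink_gt0 x y : hspace x -> hspace y -> 0 < mink x y.
Proof.
move=> hx [yy y0]; rewrite -oppr_lt0 -mulN1r -minkZr; apply: mink_lt0 => //.
  by rewrite minkZl minkZr yy; ring.
by rewrite mxE mulN1r oppr_lt0.
Qed.

Lemma hspace_mink_gt0 x y : hspace x -> mink y y = 1 -> 0 < mink x y -> hspace y.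
Proof.
move=> hx yy xy; split=> //; rewrite ltNge le_eqVlt; apply/negP => /orP[|].
  move/eqP => y0; move: yy; rewrite -(vecK y) mink_vec y0 mulr0 addr0.
  have := dotp_ge0 _ _ (usubmx y); lra.
by move/(mink_lt0 hx yy); rewrite ltNge (ltW xy).
Qed.

Lemma horiginE : horigin R n = vec 0 1.
Proof.
apply/matrixP => i j; rewrite ord1 !mxE; case: splitP => k ik; rewrite !mxE ik.
  by rewrite (_ : (_ == _) = false)//; apply/negbTE; have := ltn_ord k; lia.
by rewrite ord1 /= addn0 addn1 eqxx.
Qed.

Lemma hspace_horigin : hspace (horigin R n).
Proof. by rewrite horiginE; apply/hspace_vec; rewrite dotp0l; split; lra. Qed.

Lemma mink_horiginl x : mink (horigin R n) x = x last_ord 0.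
Proof. by rewrite horiginE -(vecK x) mink_vec vec_last dotp0l; lra. Qed.

Lemma lorentz_hspace_horigin M : lorentz M -> hspace (M *m horigin R n).
Proof.
move=> MR; split.
  by rewrite lorentz_mink//; case: hspace_horigin.
have -> : horigin R n = delta_mx last_ord 0.
  by rewrite /horigin -[in RHS]bvecE /= addn0 addn1.
by rewrite -colE mxE; case: MR.
Qed.

(** The sheet of a unit vector is read off from the sign of its product with one point of [hspace],
    and the product of [M *m x] with the image of the origin is the last coordinate of [x]. *)
Lemma lorentz_hspace M x : lorentz M -> hspace (M *m x) <-> hspace x.
Proof.
move=> ML; have ho := lorentz_hspace_horigin ML.
have e := lorentz_mink (horigin R n) x ML; rewrite mink_horiginl in e.
split=> hx.
  have [h _] := hx; split; first by rewrite -h lorentz_mink.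
  by rewrite -/last_ord -e mink_gt0.
have [h x0] := hx; apply: (hspace_mink_gt0 ho); first by rewrite lorentz_mink.
by rewrite e.
Qed.

Lemma lorentz_mulmx M1 M2 : lorentz M1 -> lorentz M2 -> lorentz (M1 *m M2).
Proof.
move=> M1L M2L; have h : hspace (M1 *m M2 *m horigin R n).
  by rewrite -mulmxA; apply/(lorentz_hspace _ M1L); exact: lorentz_hspace_horigin.
split; first by apply/lorentzP => x y; rewrite -!mulmxA !lorentz_mink.
case: h => _; have -> : horigin R n = delta_mx last_ord 0.
  by rewrite /horigin -[in RHS]bvecE /= addn0 addn1.
by rewrite -colE mxE.
Qed.

Lemma emb_vec A u s : emb A *m vec u s = vec (A *m u) s.
Proof. by rewrite /emb /vec mul_block_col !mul0mx mul1mx addr0 add0r. Qed.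

Lemma embM A B : emb (A *m B) = emb A *m emb B.
Proof. by rewrite /emb mulmx_block !mulmx0 !mul0mx !addr0 !add0r mulmx1. Qed.

Lemma lorentz_emb A : A^T *m A = 1%:M -> lorentz (emb A).
Proof.
move=> hA; split; last by rewrite block_mxEdr mxE eqxx.
apply/lorentzP => x y; rewrite -(vecK x) -(vecK y) !emb_vec !mink_vec.
by move/orthogonal_mxP: hA => ->.
Qed.

Lemma bvec_vec (p : 'I_n) : vec (bvec R n p.+1) 0 = delta_mx (lshift 1 p) 0.
Proof.
rewrite bvecE /vec raddf0; apply/matrixP => i j; rewrite ord1.
case: (fintype.split_ordP i) => k ->.
  by rewrite col_mxEu !mxE eq_lshift.
by rewrite col_mxEd !mxE eq_rlshift.
Qed.

Lemma boostE (p : 'I_n) r : boost n p.+1 r = 1%:M +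
  ((cosh r - 1) *: (delta_mx (lshift 1 p) (lshift 1 p) + delta_mx last_ord last_ord) +
   sinh r *: (delta_mx (lshift 1 p) last_ord + delta_mx last_ord (lshift 1 p))).
Proof.
have e1 (i : 'I_(n + 1)) : (i.+1 == p.+1) = (i == lshift 1 p).
  by rewrite eqSS -val_eqE.
have e2 (i : 'I_(n + 1)) : (i.+1 == n.+1) = (i == last_ord).
  by rewrite eqSS -val_eqE /= addn0.
have pl : (lshift 1 p == last_ord) = false.
  by apply/negbTE/eqP => /(congr1 val)/=; have := ltn_ord p; lia.
have lp : (last_ord == lshift 1 p) = false by rewrite eq_sym.
apply/matrixP => i j; rewrite !mxE !e1 !e2.
have [->|iE] := eqVneq i (lshift 1 p); have [->|jE] := eqVneq j (lshift 1 p).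
- by rewrite ?eqxx ?pl /=; ring.
- rewrite ?pl /=.
  by case: (j == last_ord) => /=; ring.
- rewrite ?lp /= ?andbF ?andbT.
  by case: (i == last_ord) => /=; rewrite ?pl ?(negbTE iE) /=; ring.
have [->|iL] := eqVneq i last_ord.
  by rewrite (eq_sym last_ord j); case: (j == last_ord) => /=; ring.
by rewrite /=; ring.
Qed.

Lemma boost_vec (p : 'I_n) r u s : boost n p.+1 r *m vec u s =
  vec (u + ((cosh r - 1) * u p 0 + sinh r * s) *: bvec R n p.+1)
      (cosh r * s + sinh r * u p 0).
Proof.
have d (i j : 'I_(n + 1)) (x : 'cV[R]_(n + 1)) : delta_mx i j *m x = x j 0 *: delta_mx i 0.
  apply/matrixP => a b; rewrite ord1 !mxE (bigD1 j)//= big1 => [|c cj].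
    by rewrite !mxE !eqxx !andbT addr0 mulrC.
  by rewrite !mxE (negbTE cj) andbF mul0r.
have l : delta_mx last_ord 0 = vec 0 1 :> 'cV[R]_(n + 1).
  by rewrite -horiginE /horigin -[in LHS]bvecE /= addn0 addn1.
rewrite boostE !mulmxDl mul1mx -!scalemxAl !mulmxDl !d vec_coord vec_last.
rewrite -bvec_vec l !vecZ !vecD !vecZ !vecD; congr vec; last by ring.
by rewrite !(scaler0, addr0, add0r) !scalerA -!scalerDl.
Qed.

Lemma lorentz_boost (p : 'I_n) r : lorentz (boost n p.+1 r).
Proof.
split; last by rewrite mxE /= addn0 eqxx andbT orbT cosh_gt0.
apply/lorentzP => x y; rewrite -(vecK x) -(vecK y) !boost_vec !mink_vec.
have ep : bvec R n p.+1 p 0 = 1 by rewrite mxE eqxx.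
rewrite dotpDl !dotpDr !dotpZl !dotpZr !dotp_bvecr !dotp_bvecl ep.
have := cosh2B _ r; set c := cosh r; set s := sinh r => cs.
set a := usubmx x p 0; set b := usubmx y p 0; set e := x _ _; set f := y _ _.
apply/eqP; rewrite -subr_eq0; apply/eqP.
transitivity ((c ^+ 2 - s ^+ 2 - 1) * (e * f - a * b)); first by ring.
by rewrite cs subrr mul0r.
Qed.

Lemma eq_act M1 M2 (t : set 'cV[R]_(n + 1)) :
  (forall x, t x -> M1 *m x = M2 *m x) -> act M1 t = act M2 t.
Proof.
move=> h; apply/seteqP; split=> _ [x tx <-]; first by exists x => //; rewrite h.
by exists x => //; rewrite h.
Qed.

Definition hsubspace d : {vspace 'cV[R]_(n + 1)} :=
  <<[seq bvec R (n + 1) i | i <- iota (n - d + 1) (d + 1)]>>%VS.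

Lemma dim_hsubspace d : (d <= n)%N -> \dim (hsubspace d) = d.+1.
Proof. by move=> dn; rewrite dim_span_bvec ?addn1//; lia. Qed.

Lemma mem_hsubspace d u s : (d <= n)%N ->
  vec u s \in hsubspace d <-> (forall l : 'I_n, (l < n - d)%N -> u l 0 = 0).
Proof.
move=> dn; rewrite mem_span_bvec; last by lia.
split=> [/forallP h l ld|h].
  by have := h (lshift 1 l); rewrite vec_coord/= ld /= => /eqP.
apply/forallP => l; apply/implyP; case: (fintype.split_ordP l) => i -> /= il.
  by rewrite vec_coord h.
lia.
Qed.

Lemma hplane_vec d u s : (d <= n)%N -> @hplane R n d (vec u s) <->
  hspace (vec u s) /\ (forall l : 'I_n, (l < n - d)%N -> u l 0 = 0).
Proof.
move=> dn; split=> [[hx hu]|[hx hu]]; first by split=> //; apply/(mem_hsubspace _ s dn).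
by split=> //; apply/mem_hsubspace.
Qed.

Lemma act_hplaneP d M x : lorentz M ->
  act M (@hplane R n d) x <-> @hplane R n d (lorentz_inv M *m x).
Proof.
move=> ML; split=> [[y hy <-]|hx].
  by rewrite mulmxA lorentz_mulVmx// mul1mx.
by exists (lorentz_inv M *m x) => //; rewrite mulmxA lorentz_mulmxV// mul1mx.
Qed.

Lemma Gamma_H_act d M : (d <= n)%N -> lorentz M -> Gamma_H d (act M (@hplane R n d)).
Proof.
move=> dn ML; split.
  exists (M *m horigin R n); exists (horigin R n) => //.
  rewrite horiginE; apply/hplane_vec => //; split=> [|l _]; last by rewrite mxE.
  by rewrite -horiginE; exact: hspace_horigin.
have linM : linear (fun x : 'cV[R]_(n + 1) => M *m x) by move=> a x y; rewrite linearP.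
exists (linfun (mulmx M) @: hsubspace d)%VS; split.
  rewrite limg_dim_eq ?dim_hsubspace//; apply/eqP; rewrite -subv0; apply/subvP => x.
  rewrite memv_cap memv_ker lfunE /= memv0 => /andP[_ /eqP Mx].
  by rewrite -[x]mul1mx -(lorentz_mulVmx ML) -mulmxA Mx mulmx0.
apply/seteqP; split=> [_ [x [hx xW] <-]|y [hy /= /memv_imgP[x xW]]].
  split; first exact/(lorentz_hspace _ ML).
  by apply/memv_imgP; exists x => //; rewrite lfunE.
rewrite lfunE /= => yM; exists x => //; split=> //.
by apply/(lorentz_hspace _ ML); rewrite -yM.
Qed.

(* A small perturbation of a point of [t] inside its linear span can be
   rescaled back to [t]: a totally geodesic submanifold spans its subspace. *)
Lemma hspace_span_sub (W W' : {vspace 'cV[R]_(n + 1)}) :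
  (@hspace R n `&` [set x | x \in W]) !=set0 ->
  @hspace R n `&` [set x | x \in W] `<=` [set x | x \in W'] -> (W <= W')%VS.
Proof.
move=> [x [[xx x0] /= xW]] WW'; apply/subvP => w wW.
have xW' : x \in W' by apply: WW'.
have A0 := normr_ge0 (mink x w); have B0 := normr_ge0 (mink w w).
have C0 : 0 <= `|w last_ord 0| / x last_ord 0 by rewrite divr_ge0// ltW.
(* [K] dominates the three quantities that limit the step: with [e = 1 / (4 K)] both [mink y y] and
   the last coordinate of [y = x + e *: w] stay positive. *)
set K := `|mink x w| + `|mink w w| + `|w last_ord 0| / x last_ord 0 + 1.
have K1 : 1 <= K by rewrite /K; lra.
pose e := (4 * K)^-1.
have e0 : 0 < e by rewrite invr_gt0; lra.
have eK : K * e = 4^-1 by rewrite /e invfM mulrCA mulfV ?mulr1// gt_eqF//; lra.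
have e1 : e <= 4^-1 by rewrite -eK; nra.
have b1 : `|mink x w| * e <= 4^-1.
  by rewrite -eK ler_wpM2r ?(ltW e0)// /K; lra.
have b2 : `|mink w w| * e <= 4^-1.
  by rewrite -eK ler_wpM2r ?(ltW e0)// /K; lra.
have b3 : `|w last_ord 0| * e < x last_ord 0.
  have : `|w last_ord 0| / x last_ord 0 * e < 1.
    apply: (@le_lt_trans _ _ 4^-1); last by lra.
    by rewrite -eK ler_wpM2r ?(ltW e0)// /K; lra.
  by rewrite mulrAC ltr_pdivrMr// mul1r.
pose y := x + e *: w.
have yW : y \in W by rewrite memvD// memvZ.
have yy : 0 < mink y y.
  rewrite /y minkDl !minkDr !minkZl !minkZr xx (minkC w x).
  have := ler_norm (- mink x w); have := ler_norm (- mink w w); rewrite !normrN.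
  move: b1 b2; nra.
have y0 : 0 < y last_ord 0.
  rewrite !mxE; have := ler_norm (- w last_ord 0); rewrite normrN; nra.
have yW' : y \in W'.
  set q := (Num.sqrt (mink y y))^-1.
  have q0 : 0 < q by rewrite invr_gt0 sqrtr_gt0.
  have : q *: y \in W'.
    apply: WW'; split; last by rewrite /= memvZ.
    split; last by rewrite mxE mulr_gt0.
    rewrite minkZl minkZr mulrA -expr2 /q exprVn sqr_sqrtr ?(ltW yy)// mulVf//.
    by rewrite gt_eqF.
  move=> /(@memvZ _ _ W' q^-1)/=; rewrite scalerA mulVf ?scale1r//.
  by rewrite gt_eqF.
have : e^-1 *: (y - x) \in W' by rewrite memvZ// memvB.
by rewrite /y addrAC subrr add0r scalerA mulVf ?scale1r// gt_eqF.
Qed.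

(** The spans are nested and of equal dimension. Consequently two distinct planes of the same
    dimension are told apart by a point of the first lying off the second. *)
Lemma Gamma_H_sub d (t t' : set 'cV[R]_(n + 1)) : Gamma_H d t -> Gamma_H d t' ->
  t `<=` t' -> t = t'.
Proof.
move=> [t0 [W [dW tE]]] [_ [W' [dW' t'E]]] tt'; rewrite tE t'E; congr (_ `&` _).
have WW' : (W <= W')%VS.
  apply: hspace_span_sub; first by rewrite -tE.
  by rewrite -tE => x /tt'; rewrite t'E => -[].
suff -> : W = W' by [].
by apply/eqP; rewrite eqEdim WW' dW dW' /=.
Qed.

End lorentz.

(** * Rotations and the hyperbolic right triangle *)

Section rotations.
Variables (R : realType) (n : nat).
Implicit Types (u v : 'cV[R]_n) (s t r : R) (A B : 'M[R]_n) (p q : 'I_n).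

Definition refl p : 'M[R]_n := diag_mx (\row_l (if l == p then -1 else 1)).

Lemma refl_coord p u l : (refl p *m u) l 0 = if l == p then - u l 0 else u l 0.
Proof.
rewrite /refl mul_diag_mx !mxE; case: ifP => _; first by rewrite mulN1r.
by rewrite mul1r.
Qed.

Lemma refl_fix p u : u p 0 = 0 -> refl p *m u = u.
Proof.
move=> up; apply/matrixP => l j; rewrite ord1 refl_coord.
by case: eqP => [->|//]; rewrite up oppr0.
Qed.

Lemma refl_orthogonal p : (refl p)^T *m refl p = 1%:M.
Proof.
apply/orthogonal_mxP => u v; apply: eq_bigr => l _; rewrite !refl_coord.
by case: ifP => _ //; rewrite mulrNN.
Qed.

Lemma reflK p : refl p *m refl p = 1%:M.
Proof. by rewrite -{1}[refl p]tr_diag_mx refl_orthogonal. Qed.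

Lemma det_refl p : \det (refl p) = -1.
Proof.
rewrite det_diag (bigD1 p)//= big1 => [|i ip]; first by rewrite mxE eqxx mulr1.
by rewrite mxE (negbTE ip).
Qed.

Lemma orthogonal_mulmx A B : A^T *m A = 1%:M -> B^T *m B = 1%:M ->
  (A *m B)^T *m (A *m B) = 1%:M.
Proof. by move=> hA hB; rewrite trmx_mul !mulmxA -(mulmxA _ A^T) hA mulmx1. Qed.

Lemma orthogonal_tr A : A^T *m A = 1%:M -> A^T^T *m A^T = 1%:M.
Proof. by move=> hA; rewrite trmxK; exact: mulmx1C. Qed.

Lemma orthogonal_det A : A^T *m A = 1%:M -> \det A = 1 \/ \det A = -1.
Proof.
by move=> /orthogonal_det_sqr/eqP; rewrite sqrf_eq1 => /orP[]/eqP; [left|right].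
Qed.

Lemma orthogonal_tr_fix A u : A^T *m A = 1%:M -> A *m u = u -> A^T *m u = u.
Proof. by move=> hA Au; rewrite -{1}Au mulmxA hA mul1mx. Qed.

(* A reflection acting trivially on the vectors at hand corrects the sign of
   the determinant. *)
Lemma rotation_extension A p : A^T *m A = 1%:M ->
  exists2 c, rotgrp n c & forall u, u p 0 = 0 -> c *m u = A *m u.
Proof.
move=> hA; have fixed i : (1 <= i <= n - n)%N -> False by lia.
case: (orthogonal_det hA) => dA.
  by exists A => //; split=> // i /fixed.
exists (A *m refl p); last by move=> u up; rewrite -mulmxA refl_fix.
split=> [|_|i /fixed//]; last by rewrite det_mulmx dA det_refl mulrNN mulr1.
by apply: orthogonal_mulmx => //; exact: refl_orthogonal.
Qed.

Lemma rotgrp_orthogonal k A : rotgrp k A -> A^T *m A = 1%:M.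
Proof. by case. Qed.

Lemma rotgrp_mulmx k A B : rotgrp k A -> rotgrp k B -> rotgrp k (A *m B).
Proof.
move=> [oA dA fA] [oB dB fB]; split=> [|k1|i ik].
- exact: orthogonal_mulmx.
- by rewrite det_mulmx dA// dB// mulr1.
- by rewrite -mulmxA fB// fA.
Qed.

Lemma rotgrp_tr k A : rotgrp k A -> rotgrp k A^T.
Proof.
move=> [oA dA fA]; split=> [|k1|i ik]; first exact: orthogonal_tr.
- by rewrite det_tr dA.
- by apply: orthogonal_tr_fix => //; exact: fA.
Qed.

Lemma rotgrp_fix k A p : rotgrp k A -> (p.+1 <= n - k)%N ->
  A *m bvec R n p.+1 = bvec R n p.+1.
Proof. by move=> [_ _ h] pk; apply: h. Qed.

(** The boost acts in the plane of [e_p] and [e_(n+1)], and [A] acts on its orthogonal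
    complement. *)
Lemma emb_boostC A p r u s : A^T *m A = 1%:M -> A *m bvec R n p.+1 = bvec R n p.+1 ->
  emb A *m (boost n p.+1 r *m vec u s) = boost n p.+1 r *m (emb A *m vec u s).
Proof.
move=> oA Ap; rewrite !(boost_vec, emb_vec).
have -> : (A *m u) p 0 = u p 0.
  by rewrite -[LHS]dotp_bvecr dotp_mull (orthogonal_tr_fix oA Ap) dotp_bvecr.
by rewrite mulmxDr -scalemxAr Ap.
Qed.

(** The plane rotation taking [e_p] to [c e_p + s e_q], when [c] and [s] are a cosine and a sine. *)
Definition givens p q (c s : R) : 'M[R]_n :=
  1%:M + (c - 1) *: (delta_mx p p + delta_mx q q) + s *: (delta_mx q p - delta_mx p q).

Lemma givens_vec p q c s u : givens p q c s *m u =
  u + ((c - 1) * u p 0 - s * u q 0) *: bvec R n p.+1 +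
  (s * u p 0 + (c - 1) * u q 0) *: bvec R n q.+1.
Proof.
have d i j : delta_mx i j *m u = u j 0 *: bvec R n i.+1.
  rewrite bvecE; apply/matrixP => a b; rewrite ord1 !mxE (bigD1 j)//= big1 => [|e ej].
    by rewrite !mxE !eqxx !andbT addr0 mulrC.
  by rewrite !mxE (negbTE ej) andbF mul0r.
rewrite /givens !mulmxDl mul1mx -!scalemxAl !mulmxDl mulNmx !d.
apply/matrixP => i j; rewrite !mxE; ring.
Qed.

Lemma givens_orthogonal p q c s : p != q -> c ^+ 2 + s ^+ 2 = 1 ->
  (givens p q c s)^T *m givens p q c s = 1%:M.
Proof.
move=> pq cs; apply/orthogonal_mxP => u v; rewrite !givens_vec.
have epp (l : 'I_n) : bvec R n l.+1 l 0 = 1 by rewrite mxE eqxx.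
have epq : bvec R n p.+1 q 0 = 0.
  by rewrite mxE eqSS (_ : (_ == _) = false)//; apply/negbTE; rewrite eq_sym.
have eqp : bvec R n q.+1 p 0 = 0.
  by rewrite mxE eqSS (_ : (_ == _) = false)//; apply/negbTE.
rewrite !dotpDl !dotpDr !dotpZl !dotpZr !dotp_bvecr !dotp_bvecl !epp epq eqp.
apply/eqP; rewrite -subr_eq0; apply/eqP.
transitivity ((c ^+ 2 + s ^+ 2 - 1) * (u p 0 * v p 0 + u q 0 * v q 0)); first by ring.
by rewrite cs subrr mul0r.
Qed.

Variables (k j : nat) (pk pj : 'I_n).
Hypotheses (pkE : (pk.+1 = n - k)%N) (pjE : (pj.+1 = n - j)%N) (jk : (j < k)%N).

(* Hyperbolic Pythagoras: a [j]-plane at distance [rho] from the nearest point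
   of a [k]-plane at distance [r] lies at distance [arcosh (cosh r cosh rho)]. *)
Lemma boost_emb_boost B r rho : B^T *m B = 1%:M ->
  B *m bvec R n pk.+1 = bvec R n pk.+1 -> 0 < r -> 0 < rho ->
  exists2 c, rotgrp n c & forall x, hplane j x ->
    boost n (n - k) r *m (emb B *m (boost n (n - j) rho *m x)) =
    emb c *m (boost n (n - j) (arcosh (cosh r * cosh rho)) *m x).
Proof.
move=> oB Bk r0 rho0; rewrite -pkE -pjE.
have [S0 cS _ _ _] := arcosh_coshM_bounds _ _ _ r0 rho0.
set S := arcosh _ in S0 cS *; have sS0 := sinh_gt0 _ _ S0.
have pkj : pk != pj by apply/eqP => h; move: pkE pjE; rewrite h; have := ltn_ord pj; lia.
(* Sine and cosine of the angle at the origin in the right triangle with legs [r] and [rho]: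
   [c e_(n-j) + s e_(n-k)] is, before [B] is applied, the direction of the nearest point of the
   j-plane. *)
pose c := sinh rho / sinh S; pose s := cosh rho * sinh r / sinh S.
have cs : c ^+ 2 + s ^+ 2 = 1.
  have hS : sinh S ^+ 2 = sinh rho ^+ 2 + (cosh rho * sinh r) ^+ 2.
    have h1 : sinh S ^+ 2 = cosh S ^+ 2 - 1 by rewrite -(cosh2B _ S); ring.
    have h2 : sinh r ^+ 2 = cosh r ^+ 2 - 1 by rewrite -(cosh2B _ r); ring.
    have h3 : sinh rho ^+ 2 = cosh rho ^+ 2 - 1 by rewrite -(cosh2B _ rho); ring.
    rewrite h1 cS h3; have -> : (cosh rho * sinh r) ^+ 2 = cosh rho ^+ 2 * sinh r ^+ 2 by ring.
    by rewrite h2; ring.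
  have -> : c ^+ 2 + s ^+ 2 =
      (sinh rho ^+ 2 + (cosh rho * sinh r) ^+ 2) / sinh S ^+ 2.
    by rewrite /c /s; field; rewrite gt_eqF.
  by rewrite -hS divff// expf_neq0// gt_eqF.
have oG := givens_orthogonal (negbT (etrans (eq_sym _ _) (negbTE pkj))) cs.
(* The determinant of the product may be -1; every vector it is applied to below has coordinate [pk]
   zero, so a reflection in [e_(n-k)] corrects it unnoticed. *)
have [d dG dE] := rotation_extension pk (orthogonal_mulmx oB oG).
exists d => // x; rewrite -(vecK x); move: (usubmx x) (x _ 0) => u t {x}.
have jn : (j <= n)%N by have := ltn_ord pj; lia.
move=> /(hplane_vec _ _ jn)[_ hu].
have uk : u pk 0 = 0 by apply: hu; rewrite -pjE; have := ltn_ord pj; lia.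
have uj : u pj 0 = 0 by apply: hu; rewrite -pjE.
have kj : bvec R n pj.+1 pk 0 = 0.
  by rewrite mxE eqSS (_ : (_ == _) = false)//; apply/negbTE.
have jj : bvec R n pj.+1 pj 0 = 1 by rewrite mxE eqxx.
have wk a : (u + a *: bvec R n pj.+1) pk 0 = 0 by rewrite mxE uk add0r mxE kj mulr0.
have wj a : (u + a *: bvec R n pj.+1) pj 0 = a by rewrite mxE uj add0r mxE jj mulr1.
rewrite [boost n pj.+1 rho *m _]boost_vec -emb_boostC// !boost_vec !emb_vec.
rewrite dE ?wk// ?uj.
rewrite !mulr0 !add0r !addr0; congr vec; last by rewrite cS mulrA.
rewrite -mulmxA; congr (B *m _); rewrite givens_vec wk wj -!addrA; congr (_ + _).
rewrite !mulr0 subr0 addr0 addrA -scalerDl; congr (_ *: _ + _ *: _).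
  by rewrite /c; field; rewrite gt_eqF.
by rewrite /s; field; rewrite gt_eqF.
Qed.

End rotations.

(** * Frames *)

Section cones.
Variables (R : realType) (n : nat).
Implicit Types (u v w : 'cV[R]_n) (x : 'cV[R]_(n + 1)) (eta : {vspace 'cV[R]_n}).

(** The span of [eta + v + e_(n+1)] that occurs in [hframe], as an explicit linear condition. *)
Definition cone eta v : set 'cV[R]_(n + 1) :=
  [set x | usubmx x - x (last_ord n) 0 *: v \in eta].

Lemma cone_vec eta v w (s : R) : cone eta v (vec w s) <-> w - s *: v \in eta.
Proof. by rewrite /cone/= vec_last col_mxKu. Qed.

Lemma coneZ eta v a x : cone eta v x -> cone eta v (a *: x).
Proof.
rewrite -(vecK x) vecZ !cone_vec => h.
by rewrite -scalerA -scalerBr memvZ.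
Qed.

Lemma lspan_cone eta v :
  lspan [set col_mx (u + v) 1%:M | u in [set u | u \in eta]] = cone eta v.
Proof.
apply/seteqP; split=> x.
  pose phi (y : 'cV[R]_(n + 1)) := usubmx y - y (last_ord n) 0 *: v.
  have phi_lin : linear phi.
    by move=> a y z; apply/matrixP => i j; rewrite !mxE; ring.
  pose phiL := GRing.isLinear.Build _ _ _ _ phi phi_lin.
  pose phil : {linear _ -> _} := HB.pack phi phiL.
  move=> /(_ (linfun phil @^-1: eta)%VS) h; suff : x \in (linfun phil @^-1: eta)%VS.
    by rewrite -memv_preim lfunE.
  apply: h => _ [u /= ueta <-]; rewrite -memv_preim (lfunE phil) /= /phi.
  have -> : col_mx (u + v) 1%:M = vec (u + v) 1 by [].
  by rewrite vec_last col_mxKu scale1r addrK.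
move=> xc W hW; move: xc; rewrite -(vecK x).
move: (usubmx x) (x _ 0) => w s; rewrite cone_vec => ws.
have -> : vec w s = vec (w - s *: v + v) 1 + (s - 1) *: vec (0 + v) 1.
  rewrite vecZ vecD add0r; congr vec; last by ring.
  by apply/matrixP => i j; rewrite !mxE; ring.
by rewrite memvD// ?memvZ//; apply: hW; [exists (w - s *: v)|exists 0; rewrite //= mem0v].
Qed.

(** Klein model: each point of the open unit ball, placed at height 1, lies on a ray through
    [hspace]. *)
Lemma hspace_unit_scale w : dotp w w < 1 ->
  exists2 q : R, 0 < q & hspace (q *: vec w 1).
Proof.
move=> w1; set m := 1 - dotp w w; have m0 : 0 < m by rewrite subr_gt0.
exists (Num.sqrt m)^-1; first by rewrite invr_gt0 sqrtr_gt0.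
rewrite vecZ hspace_vec mulr1; split; last by rewrite invr_gt0 sqrtr_gt0.
rewrite dotpZl dotpZr mulrA -expr2 -[X in X - _]mulr1 -mulrBr exprVn sqr_sqrtr ?ltW//.
by rewrite mulVf// gt_eqF.
Qed.

Lemma cone_sub_ball eta eta' v v' w :
  @hspace R n `&` cone eta v `<=` cone eta' v' -> dotp w w < 1 ->
  w - v \in eta -> w - v' \in eta'.
Proof.
move=> cc w1 wv; have [q q0 hq] := hspace_unit_scale w1.
have : cone eta' v' (q *: vec w 1).
  by apply: cc; split=> //; apply: coneZ; apply/cone_vec; rewrite scale1r.
move=> /(coneZ q^-1); rewrite scalerA mulVf ?gt_eqF// scale1r.
by move/cone_vec; rewrite scale1r.
Qed.

(** Uniqueness of [eta] and [v], seen in the Klein ball: the ball contains [v] and all small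
    translates [v + e *: u] with [u] in [eta], which gives [eta <= eta']. Then [v - v'] lies in the
    common space, to which [v] and [v'] are both orthogonal. *)
Lemma cone_inj eta eta' v v' : \dim eta = \dim eta' ->
  (forall u, u \in eta -> dotp u v = 0) -> (forall u, u \in eta' -> dotp u v' = 0) ->
  dotp v v < 1 -> @hspace R n `&` cone eta v = @hspace R n `&` cone eta' v' ->
  eta = eta' /\ v = v'.
Proof.
move=> de ev ev' v1 cc.
have cs : @hspace R n `&` cone eta v `<=` cone eta' v' by rewrite cc; exact: subIsetr.
have vv' : v - v' \in eta'.
  by apply: (cone_sub_ball cs v1); rewrite subrr mem0v.
have ee' : (eta <= eta')%VS.
  apply/subvP => u ue; set d := 1 - dotp v v.
  have d0 : 0 < d by rewrite subr_gt0.
  have u0 := dotp_ge0 _ _ u; have v0 := dotp_ge0 _ _ v.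
  pose e := d / (1 + dotp u u).
  have e0 : 0 < e by rewrite divr_gt0//; lra.
  have eE : e * (1 + dotp u u) = d by rewrite /e divfK// gt_eqF//; lra.
  have h1 : dotp (e *: u + v) (e *: u + v) < 1.
    rewrite dotpDl !dotpDr !dotpZl !dotpZr (dotpC _ _ v u) ev// !mulr0 add0r addr0.
    by rewrite -ltrBrDr -/d; move: eE e0 d0 v0; rewrite /d; nra.
  have : e *: u + v - v' \in eta'.
    by apply: (cone_sub_ball cs h1); rewrite addrK memvZ.
  rewrite -addrA => h; have : e *: u \in eta'.
    by rewrite -(addrK (v - v') (e *: u)) memvB.
  move=> /(@memvZ _ _ eta' e^-1)/=; rewrite scalerA mulVf ?scale1r//.
  by rewrite gt_eqF.
have ee : eta = eta' by apply/eqP; rewrite eqEdim ee' de /=.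
split=> //; apply/eqP; rewrite -subr_eq0; apply/eqP; apply: dotp_eq0.
have h1 : dotp (v - v') v = 0 by rewrite ev// ee.
have h2 : dotp (v - v') v' = 0 by rewrite ev'.
by rewrite dotpDr h1 add0r dotpC dotpNl dotpC h2 oppr0.
Qed.

Lemma mem_Rsub k u : (k <= n)%N ->
  Rsub k u <-> (forall l : 'I_n, (l < n - k)%N -> u l 0 = 0).
Proof.
move=> kn; rewrite /Rsub/= mem_span_bvec; last by lia.
split=> [/forallP h l ld|h]; first by have := h l; rewrite ld => /eqP.
by apply/forallP => l; apply/implyP => ld; rewrite h.
Qed.

End cones.

Section frames.
Variables (R : realType) (n k : nat) (pk : 'I_n) (a : 'M[R]_n) (r : R).
Hypotheses (pkE : (pk.+1 = n - k)%N) (ha : rotgrp n a) (r0 : 0 < r).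
Implicit Types (u v w : 'cV[R]_n).

Notation e := (bvec R n pk.+1).
Let z := act (emb a *m boost n (n - k) r) (hplane k).
Let Rk : {vspace 'cV[R]_n} := <<[seq bvec R n i | i <- iota (n - k + 1) k]>>%VS.
Let eta0 := (linfun (mulmx a) @: Rk)%VS.
(** The point of [z] nearest to the origin, in Klein coordinates: Euclidean norm [tanh r], direction
    [a *m e]. *)
Let v0 := (sinh r / cosh r) *: (a *m e).

Let kn : (k <= n)%N. Proof. by have := ltn_ord pk; lia. Qed.

Let oa : a^T *m a = 1%:M. Proof. exact: rotgrp_orthogonal ha. Qed.

Let mem_eta0 u : u \in eta0 <-> Rsub k (a^T *m u).
Proof.
split=> [/memv_imgP[x xR ->]|h]; first by rewrite lfunE /= mulmxA oa mul1mx.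
by apply/memv_imgP; exists (a^T *m u) => //; rewrite lfunE /= mulmxA mulmx1C// mul1mx.
Qed.

Let z_cone : z = @hspace R n `&` cone eta0 v0.
Proof.
have ML : lorentz (emb a *m boost n pk.+1 r).
  by apply: lorentz_mulmx; [exact: lorentz_emb|exact: lorentz_boost].
have c0 := cosh_gt0 _ r.
rewrite /z -pkE; apply/seteqP; split=> [_ [x hx <-]|x].
  have [xH _] := hx; split; first exact/(lorentz_hspace _ ML).
  move: hx; rewrite -(vecK x); move: (usubmx x) (x _ 0) => u t /(hplane_vec _ _ kn)[_ hu].
  have uk : u pk 0 = 0 by apply: hu; lia.
  rewrite -mulmxA boost_vec emb_vec cone_vec uk !mulr0 add0r addr0.
  apply/mem_eta0; rewrite mulmxBr mulmxA oa mul1mx /v0 -!scalemxAr (mulmxA a^T) oa mul1mx.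
  rewrite scalerA; have -> : cosh r * t * (sinh r / cosh r) = sinh r * t.
    by field; rewrite gt_eqF.
  by rewrite addrK; apply/mem_Rsub.
rewrite -(vecK x); move: (usubmx x) (x _ 0) => w s [xH /cone_vec/mem_eta0].
set u := (_ *m _) => /mem_Rsub-/(_ kn) hu.
have uk : u pk 0 = 0 by apply: hu; lia.
have xE : (emb a *m boost n pk.+1 r) *m vec u (s / cosh r) = vec w s.
  rewrite -mulmxA boost_vec emb_vec uk !mulr0 add0r addr0; congr vec.
    rewrite mulmxDr /u mulmxA mulmx1C// mul1mx -scalemxAr /v0 scalerA.
    have -> : s * (sinh r / cosh r) = sinh r * (s / cosh r) by ring.
    by rewrite subrK.
  by field; rewrite gt_eqF.
exists (vec u (s / cosh r)) => //; apply/hplane_vec => //; split=> //.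
by apply/(lorentz_hspace _ ML); rewrite xE.
Qed.

Let dim_eta0 : \dim eta0 = k.
Proof.
rewrite limg_dim_eq ?dim_span_bvec//; first by have := ltn_ord pk; lia.
apply/eqP; rewrite -subv0; apply/subvP => x.
rewrite memv_cap memv_ker lfunE /= memv0 => /andP[_ /eqP ax].
by rewrite -[x]mul1mx -oa -mulmxA ax mulmx0.
Qed.

Let eta0_v0 u : u \in eta0 -> dotp u v0 = 0.
Proof.
move=> /mem_eta0/(mem_Rsub _ kn) hu; rewrite /v0 dotpZr dotpC dotp_mull dotp_bvecl.
by rewrite hu ?mulr0//; lia.
Qed.

Let ee : dotp (a *m e) (a *m e) = 1.
Proof.
by move/orthogonal_mxP: oa => ->; rewrite dotp_bvecl mxE eqxx.
Qed.

Let v0_sqr : dotp v0 v0 = (sinh r / cosh r) ^+ 2.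
Proof. by rewrite /v0 dotpZl dotpZr ee mulr1 expr2. Qed.

Let enorm_v0 : enorm v0 = sinh r / cosh r.
Proof.
by rewrite /enorm v0_sqr sqrtr_sqr ger0_norm// ltW// divr_gt0 ?sinh_gt0 ?cosh_gt0.
Qed.

Let v0_lt1 : dotp v0 v0 < 1.
Proof.
have t0 : 0 <= sinh r / cosh r by rewrite ltW// divr_gt0 ?sinh_gt0 ?cosh_gt0.
rewrite v0_sqr expr_lt1// ltr_pdivrMr ?cosh_gt0// mul1r.
by rewrite (le_lt_trans (ler_norm _))// normr_sinh_lt_cosh.
Qed.

Let act_eta0 : act a (Rsub k) = [set u | u \in eta0].
Proof.
apply/seteqP; split=> [_ [u uR <-]|u /mem_eta0 h] /=.
  by apply/mem_eta0; rewrite mulmxA oa mul1mx.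
by exists (a^T *m u) => //; rewrite mulmxA mulmx1C// mul1mx.
Qed.

Lemma hframe_act : hframe k z a.
Proof.
exists eta0, v0; split=> //.
- by split=> //; rewrite enorm_lt1.
- by rewrite lspan_cone -z_cone.
move=> _; rewrite enorm_v0 /v0 scalerA mulVf ?scale1r ?pkE//.
by rewrite gt_eqF// divr_gt0 ?sinh_gt0 ?cosh_gt0.
Qed.

(** As [r > 0], the vector [v0] is nonzero and its direction is imposed on every frame. Hence
    [a^T *m g] preserves [R^k] and fixes [e_(n-k)], but may act on [R^k] with determinant -1. *)
Lemma hframe_eq g : hframe k z g ->
  [/\ rotgrp n g, forall u, Rsub k u -> Rsub k (a^T *m (g *m u)) & g *m e = a *m e].
Proof.
move=> [eta [v [[deta ev v1] zE hg gR ge]]].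
rewrite lspan_cone z_cone in zE; rewrite enorm_lt1 in v1.
have de : \dim eta0 = \dim eta by rewrite dim_eta0 deta.
have [eE vE] := cone_inj de eta0_v0 ev v0_lt1 zE.
split=> // [u uR|].
  apply/mem_eta0; have : act g (Rsub k) (g *m u) by exists u.
  by rewrite gR -eE.
have t0 : sinh r / cosh r != 0 by rewrite gt_eqF// divr_gt0 ?sinh_gt0 ?cosh_gt0.
have v0n : v0 != 0.
  apply/eqP => v00; have := v0_sqr; rewrite v00 dotp0l => /esym/eqP.
  by rewrite sqrf_eq0 (negbTE t0).
rewrite -vE in ge; rewrite pkE ge// enorm_v0 /v0 scalerA mulVf// scale1r.
by rewrite pkE.
Qed.

(** The last coordinate on [z] is [cosh r * t], where [t >= 1] is that of a point of [hplane k]; the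
    image of the origin attains the minimum. *)
Lemma hnorm_act : hnorm z = r.
Proof.
have c0 := cosh_gt0 _ r.
have lb x : z x -> r <= hdist (horigin R n) x.
  move=> [y hy <-]; rewrite /hdist mink_horiginl -pkE.
  move: hy; rewrite -(vecK y); move: (usubmx y) (y _ 0) => u t hy.
  have [/hspace_vec[ut t0] hu] := (hplane_vec u t kn).1 hy.
  have uk : u pk 0 = 0 by apply: hu; lia.
  rewrite -mulmxA boost_vec emb_vec vec_last uk mulr0 addr0.
  have t1 : 1 <= t by have := dotp_ge0 _ _ u; nra.
  rewrite -{1}(arcosh_cosh _ _ (ltW r0)); apply: ler_arcosh; first exact: cosh_ge1.
  by rewrite ler_peMr// ltW.
have zo : z ((emb a *m boost n (n - k) r) *m horigin R n).
  exists (horigin R n) => //; rewrite horiginE; apply/hplane_vec => //.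
  by split=> [|l _]; [rewrite -horiginE; exact: hspace_horigin|rewrite mxE].
have ro : hdist (horigin R n) ((emb a *m boost n (n - k) r) *m horigin R n) = r.
  rewrite /hdist mink_horiginl horiginE -mulmxA -pkE boost_vec emb_vec vec_last.
  by rewrite mxE mulr0 addr0 mulr1 arcosh_cosh// ltW.
apply/eqP; rewrite eq_le; apply/andP; split.
  rewrite -[leRHS]ro; apply: ge_inf; last by exists ((emb a *m boost n (n - k) r) *m horigin R n).
  by exists r => _ [x zx <-]; exact: lb.
apply: lb_le_inf; last by move=> _ [x zx <-]; exact: lb.
by exists r; exists ((emb a *m boost n (n - k) r) *m horigin R n).
Qed.

End frames.

(** * Dependence on the chosen frame *)

Section frame_change.
Variables (R : realType) (n k : nat) (pk pl : 'I_n).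
Hypotheses (pkE : (pk.+1 = n - k)%N) (plE : (pl.+1 = n)%N) (k0 : (0 < k)%N).
Implicit Types (u v w : 'cV[R]_n) (c b : 'M[R]_n).

Let kn : (k <= n)%N. Proof. by have := ltn_ord pk; lia. Qed.

Lemma rotgrp_Rsub b u : rotgrp k b -> Rsub k u -> Rsub k (b *m u).
Proof.
move=> hb /(mem_Rsub _ kn) hu; apply/mem_Rsub => // l ln.
rewrite -dotp_bvecr dotp_mull (rotgrp_fix (rotgrp_tr hb)) ?dotp_bvecr ?hu//.
Qed.

Let proj : 'M[R]_n := diag_mx (\row_l (if (l < n - k)%N then 0 else 1)).

Let projE u l : (proj *m u) l 0 = if (l < n - k)%N then 0 else u l 0.
Proof. by rewrite mul_diag_mx !mxE; case: ifP => _; rewrite ?mul0r ?mul1r. Qed.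

Let proj_Rsub u : Rsub k (proj *m u).
Proof. by apply/mem_Rsub => // l ln; rewrite projE ln. Qed.

Let proj_id u : Rsub k u -> proj *m u = u.
Proof.
move=> /(mem_Rsub _ kn) hu; apply/matrixP => l i; rewrite ord1 projE.
by case: ifP => // /hu.
Qed.

Let orth_Rsub u w : Rsub k u -> dotp u (w - proj *m w) = 0.
Proof.
move=> /(mem_Rsub _ kn) hu; apply: big1 => l _.
have [/hu ->|ln] := boolP (l < n - k)%N; first by rewrite mul0r.
by rewrite mxE [X in _ + X]mxE projE (negbTE ln) subrr mulr0.
Qed.

(* [b] is [c] restricted to [R^k] and extended by the identity, corrected by the
   reflection in [e_n] when the determinant is [-1]. *)
Lemma rotgrp_restriction c : c^T *m c = 1%:M ->
  (forall u, Rsub k u -> Rsub k (c *m u)) ->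
  exists (s : bool) b, rotgrp k b /\
    forall u, Rsub k u -> c *m u = (if s then refl R pl else 1%:M) *m (b *m u).
Proof.
move=> oc cR; pose b0 := c *m proj + (1%:M - proj).
have b0E u : b0 *m u = c *m (proj *m u) + (u - proj *m u).
  by rewrite /b0 mulmxDl mulmxBl mul1mx mulmxA.
have b0R u : Rsub k u -> b0 *m u = c *m u.
  by move=> uR; rewrite b0E proj_id// subrr addr0.
have ob0 : b0^T *m b0 = 1%:M.
  apply/orthogonal_mxP => u v; rewrite !b0E.
  have h1 := orth_Rsub v (cR _ (proj_Rsub u)).
  have h2 := orth_Rsub u (cR _ (proj_Rsub v)).
  have h3 := orth_Rsub v (proj_Rsub u); have h4 := orth_Rsub u (proj_Rsub v).
  rewrite -[in RHS](subrKC (proj *m u) u) -[in RHS](subrKC (proj *m v) v).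
  move: h1 h2 h3 h4; move: (u - proj *m u) (v - proj *m v) => u' v' h1 h2 h3 h4.
  rewrite !dotpDl !dotpDr h1 h3 (dotpC _ _ u' (c *m _)) h2 (dotpC _ _ u' (proj *m _)) h4.
  by move/orthogonal_mxP: oc => ->.
have fb0 (i : nat) : (1 <= i <= n - k)%N -> b0 *m bvec R n i = bvec R n i.
  case: i => // i /= ik; have il : (i < n)%N by lia.
  have -> : i = Ordinal il by [].
  rewrite b0E; suff -> : proj *m bvec R n (Ordinal il).+1 = 0.
    by rewrite mulmx0 add0r subr0.
  apply/matrixP => l m; rewrite ord1 projE [RHS]mxE; case: ifP => // lk.
  rewrite mxE eqSS (_ : (_ == _) = false)//; apply/negbTE/eqP => h.
  by move: lk; rewrite h /= ik.
(* For [k = 1] the group is O(1), which contains [b0] whatever its determinant. *)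
have [k1|k1] := eqVneq k 1%N.
  exists false, b0; split; last by move=> u uR; rewrite mul1mx b0R.
  by split=> //; rewrite k1.
have [d1|d1] := orthogonal_det ob0.
  by exists false, b0; split; last by move=> u uR; rewrite mul1mx b0R.
exists true, (refl R pl *m b0); split; last first.
  by move=> u uR; rewrite !mulmxA reflK mul1mx b0R.
split=> [|_|i ik]; first by apply: orthogonal_mulmx => //; exact: refl_orthogonal.
  by rewrite det_mulmx det_refl d1 mulrNN mulr1.
rewrite -mulmxA fb0// refl_fix// mxE (_ : (_ == _) = false)//.
by apply/negbTE; lia.
Qed.

Variables (j : nat) (pj : 'I_n).
Hypotheses (pjE : (pj.+1 = n - j)%N) (jk : (j < k)%N).

(** The chosen frame is [a] followed by an orthogonal map of [R^k]. Its rotation part [b0] merges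
    with the integration variable [b]; the sign [s] survives as a reflection that fixes [e_(n-k)].
    Both depend on [z] and [a] only. *)
Lemma hpoint_act (a : 'M[R]_n) (r : R) : rotgrp n a -> 0 < r ->
  let z := act (emb a *m boost n (n - k) r) (hplane k) in
  exists (s : bool) b0, rotgrp k b0 /\
    forall rho b, rotgrp k b -> hpoint k j z rho b =
      act (emb a *m boost n (n - k) r *m emb (if s then refl R pl else 1%:M) *m
           emb (b0 *m b) *m boost n (n - j) rho) (hplane j).
Proof.
move=> ha r0 z; set g := frame_of k z.
(* The set of frames contains [a], so [frame_of] does not return its default value. *)
have /(hframe_eq pkE ha r0)[hg gR ge] : hframe k z g.
  by apply: (@xgetPex _ 1%:M [set g | hframe k z g]); exists a; exact: (hframe_act pkE).
have oa := rotgrp_orthogonal ha.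
have [|u uR|s [b0 [hb0 cb0]]] := @rotgrp_restriction (a^T *m g).
- apply: orthogonal_mulmx; first by apply: orthogonal_tr.
  exact: rotgrp_orthogonal hg.
- by rewrite -mulmxA; exact: gR.
exists s, b0; split=> // rho b hb; set S := (if s then _ else _).
have oS : S^T *m S = 1%:M.
  by rewrite /S; case: (s); [exact: refl_orthogonal|rewrite trmx1 mul1mx].
have Se : S *m bvec R n pk.+1 = bvec R n pk.+1.
  rewrite /S; case: (s); last by rewrite mul1mx.
  rewrite refl_fix// mxE (_ : (_ == _) = false)//; apply/negbTE.
  by have := ltn_ord pk; lia.
have gw w : Rsub k w -> g *m w = a *m (S *m (b0 *m w)).
  by move=> wR; rewrite -cb0// !mulmxA (mulmx1C oa) mul1mx.
rewrite /hpoint -/g (hnorm_act pkE ha r0); apply: eq_act => x.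
rewrite -(vecK x); move: (usubmx x) (x _ 0) => u t {x}.
have jn : (j <= n)%N by lia.
move=> /(hplane_vec _ _ jn)[_ hu].
have uj : u pj 0 = 0 by apply: hu; rewrite -pjE.
rewrite -!mulmxA -{1 2}pkE -{1 2}pjE boost_vec !emb_vec uj !mulr0 !(add0r, addr0).
set w := u + _ *: _.
have wR : Rsub k w.
  apply/mem_Rsub => // l lk; rewrite mxE hu ?add0r; last by lia.
  rewrite mxE mxE (_ : (_ == _) = false) ?mulr0//; apply/negbTE.
  by rewrite eqSS; lia.
move: w wR => w wR.
have Rk u1 : Rsub k u1 -> u1 pk 0 = 0.
  by move=> /(mem_Rsub _ kn); apply; lia.
have SR : (S *m (b0 *m (b *m w))) pk 0 = 0.
  rewrite -dotp_bvecr dotp_mull (orthogonal_tr_fix oS Se) dotp_bvecr Rk//.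
  by do 2!apply: rotgrp_Rsub => //.
have bwR := rotgrp_Rsub hb wR.
rewrite -[b0 *m b *m w]mulmxA !boost_vec !emb_vec SR (Rk _ bwR).
rewrite !mulr0 !(add0r, addr0) !mulmxDr -!scalemxAr ge gw//.
Qed.

End frame_change.

(** * Measurability of matrix-valued maps *)

Section matrix_continuity.
Context (R : realType) (T : topologicalType).

Lemma continuous_mx m n (f : T -> 'M[R]_(m, n)) :
  (forall i j, continuous (fun t => f t i j)) -> continuous f.
Proof.
move=> cf t A [P PA sub]; rewrite nbhs_simpl.
apply: (@filterS _ (nbhs t) _ [set t | forall i j, P i j (f t i j)]) => [s h|].
  exact: sub.
apply: filter_forall => i; apply: filter_forall => j.
exact: (cf i j t _ (PA i j)).
Qed.

Lemma continuous_coord m n (f : T -> 'M[R]_(m, n)) i j :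
  continuous f -> continuous (fun t => f t i j).
Proof.
move=> cf t; apply: (@continuous_comp _ _ _ f (fun M : 'M[R]_(m, n) => M i j)).
  exact: cf.
exact: coord_continuous.
Qed.

Lemma continuous_mulmx m n p (f : T -> 'M[R]_(m, n)) (g : T -> 'M[R]_(n, p)) :
  continuous f -> continuous g -> continuous (fun t => f t *m g t).
Proof.
move=> cf cg; apply: continuous_mx => i j.
rewrite (_ : (fun _ => _) = (fun t => \sum_k f t i k * g t k j)); last first.
  by apply/funext => t; rewrite mxE.
elim: (index_enum _) => [|k s ih] t.
  by under eq_fun do rewrite big_nil; exact: cvg_cst.
under eq_fun do rewrite big_cons.
apply: cvgD; last exact: ih.
by apply: continuousM; exact: continuous_coord.
Qed.

End matrix_continuity.

Section rational_boxes.
Context (R : realType) (m n : nat).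

(** A countable base of the topology, with rational centre [I.1] and radius [1 / (I.2 + 1)]; its
    finite subfamilies are countable in number too. *)
Definition rat_box (I : 'M[rat]_(m, n) * nat) : set 'M[R]_(m, n) :=
  [set M | forall i j, `|M i j - ratr (I.1 i j)| < I.2.+1%:R^-1].

Lemma open_rat_box I : open (rat_box I).
Proof.
rewrite openE => M h.
have nb (i : 'I_m) (j : 'I_n) : nbhs M [set M' : 'M[R]_(m, n) | `|M' i j - ratr (I.1 i j)| < I.2.+1%:R^-1].
  have oB : open (ball (ratr (I.1 i j) : R) I.2.+1%:R^-1) by exact: ball_open.
  have MB : ball (ratr (I.1 i j) : R) I.2.+1%:R^-1 (M i j).
    by rewrite /ball/= distrC; exact: h.
  have nB : nbhs (M i j) (ball (ratr (I.1 i j) : R) I.2.+1%:R^-1) by exact: open_nbhs_nbhs.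
  have cM := @coord_continuous R m n i j M _ nB.
  apply: (@filterS _ (nbhs M) _ _ _ _ cM) => N.
  by rewrite /ball/= distrC.
exact: (@filter_forall _ _ (fun i => [set M' : 'M[R]_(m, n) | forall j,
  `|M' i j - ratr (I.1 i j)| < I.2.+1%:R^-1]) (nbhs M) _
  (fun i => @filter_forall _ _ _ (nbhs M) _ (nb i))).
Qed.

Lemma rat_box_basis (U : set 'M[R]_(m, n)) M : open U -> U M ->
  exists I, rat_box I M /\ rat_box I `<=` U.
Proof.
move=> oU UM; have /nbhs_ballP[e /= e0 eU] : nbhs M U by exact: open_nbhs_nbhs.
have [k ke] : exists k : nat, k.+1%:R^-1 < e / 2.
  have e20 : 0 < e / 2 by rewrite divr_gt0.
  exists (Num.bound (e / 2)^-1); rewrite invf_plt ?posrE//.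
  rewrite (lt_le_trans (archi_boundP _))// ?ler_nat// invr_ge0 ltW//.
have dense i j : exists q : rat, `|M i j - ratr q| < k.+1%:R^-1.
  have k0 : 0 < k.+1%:R^-1 :> R by rewrite invr_gt0.
  have /rat_in_itvoo[q] : M i j - k.+1%:R^-1 < M i j + k.+1%:R^-1 by rewrite ltrBlDr -addrA ltrDl addr_gt0.
  by rewrite in_itv/= => qM; exists q; rewrite ltr_distlC.
pose N := \matrix_(i, j) projT1 (cid (dense i j)).
exists (N, k); split=> [i j /=|M' hM'].
  by rewrite mxE; exact: (projT2 (cid (dense i j))).
apply: eU; split=> // i j; have := hM' i j; rewrite /ball/= mxE.
have := projT2 (cid (dense i j)); set q := projT1 _ => h1 h2.
rewrite (_ : M i j - M' i j = (M i j - ratr q) - (M' i j - ratr q)); last by ring.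
by rewrite (splitr e) (le_lt_trans (ler_normB _ _))// ltrD// (lt_trans _ ke).
Qed.

End rational_boxes.

Section matrix_measurability.
Context d (T : measurableType d) (R : realType).

(** Entrywise measurability passes through products and blocks of any shape; for square matrices it
    yields measurability into [mxborel], since an open set is a countable union of boxes. *)
Definition mxmeas m n (f : T -> 'M[R]_(m, n)) :=
  forall i j, measurable_fun setT (fun t => f t i j : measurableTypeR R).

Lemma mxmeas_cst m n (A : 'M[R]_(m, n)) : mxmeas (fun=> A).
Proof. by move=> i j; exact: measurable_cst. Qed.

Lemma mxmeas_mulmx m n p (f : T -> 'M[R]_(m, n)) (g : T -> 'M[R]_(n, p)) :
  mxmeas f -> mxmeas g -> mxmeas (fun t => f t *m g t).
Proof.
move=> mf mg i j.
rewrite (_ : (fun _ => _) = (fun t => \sum_k f t i k * g t k j)); last first.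
  by apply/funext => t; rewrite mxE.
by apply: measurable_sum => k; apply: measurable_funM; [exact: mf|exact: mg].
Qed.

Lemma mxmeas_tr m n (f : T -> 'M[R]_(m, n)) : mxmeas f -> mxmeas (fun t => (f t)^T).
Proof.
move=> mf i j; rewrite (_ : (fun _ => _) = (fun t => f t j i)); first exact: mf.
by apply/funext => t; rewrite mxE.
Qed.

Lemma mxmeas_block m1 m2 n1 n2 (f1 : T -> 'M[R]_(m1, n1)) (f2 : T -> 'M[R]_(m1, n2))
    (f3 : T -> 'M[R]_(m2, n1)) (f4 : T -> 'M[R]_(m2, n2)) :
  mxmeas f1 -> mxmeas f2 -> mxmeas f3 -> mxmeas f4 ->
  mxmeas (fun t => block_mx (f1 t) (f2 t) (f3 t) (f4 t)).
Proof.
move=> h1 h2 h3 h4 i j.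
case: (fintype.split_ordP i) => i' ->; case: (fintype.split_ordP j) => j' ->.
- rewrite (_ : (fun _ => _) = (fun t => f1 t i' j')); first exact: h1.
  by apply/funext => t; rewrite block_mxEul.
- rewrite (_ : (fun _ => _) = (fun t => f2 t i' j')); first exact: h2.
  by apply/funext => t; rewrite block_mxEur.
- rewrite (_ : (fun _ => _) = (fun t => f3 t i' j')); first exact: h3.
  by apply/funext => t; rewrite block_mxEdl.
- rewrite (_ : (fun _ => _) = (fun t => f4 t i' j')); first exact: h4.
  by apply/funext => t; rewrite block_mxEdr.
Qed.

Lemma mxmeas_emb n (f : T -> 'M[R]_n) : mxmeas f -> mxmeas (fun t => emb (f t)).
Proof. by move=> mf; apply: mxmeas_block => //; exact: mxmeas_cst. Qed.

Lemma mxmeas_scalar (f : T -> measurableTypeR R) : measurable_fun setT f ->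
  mxmeas (fun t => (f t)%:M : 'M[R]_1).
Proof.
move=> mf i j; rewrite !ord1 (_ : (fun _ => _) = f)//.
by apply/funext => t; rewrite mxE eqxx.
Qed.

Lemma mxmeas_boost n i (f : T -> measurableTypeR R) : measurable_fun setT f ->
  mxmeas (fun t => boost n i (f t)).
Proof.
move=> mf a b; rewrite (_ : (fun _ => _) = (fun t =>
    if ((a.+1 == i) && (b.+1 == i)) || ((a.+1 == n.+1) && (b.+1 == n.+1)) then cosh (f t)
    else if ((a.+1 == i) && (b.+1 == n.+1)) || ((a.+1 == n.+1) && (b.+1 == i))
    then sinh (f t) else (a == b)%:R)); last by apply/funext => t; rewrite mxE.
case: (_ || _); first exact: (measurableT_comp (measurable_cosh R)).
case: (_ || _); first exact: (measurableT_comp (measurable_sinh R)).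
exact: measurable_cst.
Qed.

Lemma measurable_det n (f : T -> 'M[R]_n) : mxmeas f ->
  measurable_fun setT (fun t => \det (f t) : measurableTypeR R).
Proof.
move=> mf; apply: measurable_sum => s; apply: measurable_funM => //.
by apply: measurable_prod => i _; exact: mf.
Qed.

Lemma mxmeas_open m n (f : T -> 'M[R]_(m, n)) U : mxmeas f -> open U ->
  measurable (f @^-1` U).
Proof.
move=> mf oU.
have -> : f @^-1` U = \bigcup_(I : 'M[rat]_(m, n) * nat) (if `[< rat_box I `<=` U >] then f @^-1` (rat_box I) else set0).
  apply/seteqP; split=> [t Ut|t [I _]].
    have [I [It IU]] := rat_box_basis oU Ut.
    by exists I => //; rewrite ifT//; exact/asboolP.
  by case: ifPn => // /asboolP IU; exact: IU.
apply: countable_bigcupT_measurable => // I; case: ifPn => // _.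
have -> : f @^-1` rat_box I = \big[setI/setT]_i \big[setI/setT]_j
    ((fun t => f t i j : measurableTypeR R) @^-1` ball (ratr (I.1 i j) : R) I.2.+1%:R^-1).
  apply/seteqP; split=> [t h|t].
    rewrite -bigcap_seq => i _ /=; rewrite -bigcap_seq => j _ /=.
    by rewrite /ball/= distrC; exact: h.
  rewrite -bigcap_seq => h i j; have := h i (mem_index_enum _).
  rewrite -bigcap_seq => /(_ j (mem_index_enum _)).
  by rewrite /= /ball/= distrC.
apply: bigsetI_measurable => i _; apply: bigsetI_measurable => j _.
rewrite -[X in measurable X]setTI; apply: mf => //.
exact: measurable_ball.
Qed.

Lemma mxmeas_measurable n (f : T -> 'M[R]_n) : mxmeas f ->
  measurable_fun setT (f : T -> mxborel R n).
Proof.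
move=> mf; apply: (@measurability _ _ T (mxborel R n) setT f [set U : set 'M[R]_n | open U]) => //.
by move=> _ [U oU <-]; rewrite setTI; exact: mxmeas_open.
Qed.

Lemma measurable_mx_eq m n (f : T -> 'M[R]_(m, n)) A : mxmeas f ->
  measurable [set t | f t = A].
Proof.
move=> mf; have -> : [set t | f t = A] = \big[setI/setT]_i \big[setI/setT]_j
    ((fun t => f t i j : measurableTypeR R) @^-1` [set A i j]).
  apply/seteqP; split=> [t h|t].
    by rewrite -bigcap_seq => i _ /=; rewrite -bigcap_seq => j _ /=; rewrite h.
  rewrite -bigcap_seq => h; apply/matrixP => i j; have := h i (mem_index_enum _).
  by rewrite -bigcap_seq => /(_ j (mem_index_enum _)).
apply: bigsetI_measurable => i _; apply: bigsetI_measurable => j _.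
by rewrite -[X in measurable X]setTI; apply: mf.
Qed.

End matrix_measurability.

Section matrix_groups.
Variables (R : realType) (n : nat).

Lemma mxmeas_id : mxmeas (fun M : mxborel R n => M : 'M[R]_n).
Proof.
move=> i j; apply: (measurability _ (RGenOpens.measurableE R)).
move=> _ [_ [a [b ->] <-]]; rewrite setTI; apply: sub_sigma_algebra => /=.
apply: (@open_comp _ _ (fun M : 'M[R]_n => M i j)); last exact: interval_open.
by move=> M _; exact: coord_continuous.
Qed.

Lemma measurable_open_mxborel (U : set 'M[R]_n) : open U -> measurable (U : set (mxborel R n)).
Proof. by move=> oU; exact: sub_sigma_algebra. Qed.

Lemma measurable_rotgrp k : measurable (@rotgrp R n k : set (mxborel R n)).
Proof.
have -> : (@rotgrp R n k : set (mxborel R n)) =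
  [set A : mxborel R n | (A : 'M[R]_n)^T *m A = 1%:M] `&`
  ((if (k != 1)%N then [set A : mxborel R n | \det (A : 'M[R]_n) = 1] else setT) `&`
  \bigcap_i (if (1 <= i <= n - k)%N
    then [set A : mxborel R n | (A : 'M[R]_n) *m bvec R n i = bvec R n i] else setT)).
  apply/seteqP; split=> [A [h1 h2 h3]|A [h1 [h2 h3]]].
    split=> //; split=> [|i _]; first by case: ifP => // /h2.
    by case: ifP => // ik; exact: h3.
  split=> // [k1|i ik]; first by move: h2; rewrite k1.
  by have := h3 i I; rewrite ik.
apply: measurableI; first by apply: measurable_mx_eq; apply: mxmeas_mulmx; [apply: mxmeas_tr|]; exact: mxmeas_id.
apply: measurableI.
  case: ifP => // _; have := measurable_det mxmeas_id measurableT (measurable_set1 1).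
  by rewrite setTI.
apply: bigcap_measurableType => i _; case: ifP => // _.
by apply: measurable_mx_eq; apply: mxmeas_mulmx; [exact: mxmeas_id|exact: mxmeas_cst].
Qed.

End matrix_groups.

(** * Haar integrals and planes *)

Section haar.
Variables (R : realType) (n k : nat) (P : probability (mxborel R n) R).
Hypothesis hP : is_haar (rotgrp k) P.
Notation G := (@rotgrp R n k).

Let mG : measurable (G : set (mxborel R n)) := @measurable_rotgrp R n k.

Lemma haar_null : P (~` G) = 0%E.
Proof.
by rewrite probability_setC//; case: hP => -> _; rewrite subee.
Qed.

Lemma haar_integralT (F : mxborel R n -> \bar R) : measurable_fun setT F ->
  (forall x, (0 <= F x)%E) -> (\int[P]_(x in G) F x = \int[P]_x F x)%E.
Proof.
move=> mF F0; rewrite [RHS](@ge0_negligible_integral _ (mxborel R n) _ _ setT (~` G))//.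
- by rewrite setTD setCK.
- exact: measurableC.
- exact: haar_null.
Qed.

Lemma measurable_mulmx_borel d (T : measurableType d) (f g : T -> mxborel R n) :
  measurable_fun setT f -> measurable_fun setT g ->
  measurable_fun setT (fun t => (f t : 'M[R]_n) *m (g t : 'M[R]_n) : mxborel R n).
Proof.
move=> mf mg; apply: mxmeas_measurable; apply: mxmeas_mulmx => i j.
  exact: (measurableT_comp (mxmeas_id i j) mf).
exact: (measurableT_comp (mxmeas_id i j) mg).
Qed.

Lemma measurable_trmx_borel d (T : measurableType d) (f : T -> mxborel R n) :
  measurable_fun setT f ->
  measurable_fun setT (fun t => (f t : 'M[R]_n)^T : mxborel R n).
Proof.
move=> mf; apply: mxmeas_measurable; apply: mxmeas_tr => i j.
exact: (measurableT_comp (mxmeas_id i j) mf).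
Qed.

Lemma haar_left (F : mxborel R n -> \bar R) (g : 'M[R]_n) : measurable_fun setT F ->
  (forall x, (0 <= F x)%E) -> G g ->
  (\int[P]_(x in G) F (g *m (x : 'M[R]_n)) = \int[P]_(x in G) F x)%E.
Proof.
move=> mF F0 Gg.
have mg : measurable_fun setT (fun x : mxborel R n => g *m (x : 'M[R]_n) : mxborel R n).
  by apply: measurable_mulmx_borel => //; exact: measurable_cst.
have mFg : measurable_fun setT (fun x : mxborel R n => F (g *m (x : 'M[R]_n))).
  exact: (measurableT_comp mF mg).
rewrite !haar_integralT//.
have -> : (\int[P]_x F (g *m (x : 'M[R]_n)) = \int[pushforward P
    (fun x : mxborel R n => g *m (x : 'M[R]_n) : mxborel R n)]_x F x)%E.
  by rewrite ge0_integral_pushforward//= preimage_setT.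
pose Pg : {measure set (mxborel R n) -> \bar R} :=
  pushforward P (fun x : mxborel R n => g *m (x : 'M[R]_n) : mxborel R n).
transitivity (\int[Pg mg]_x F x)%E; first by [].
apply: eq_measure_integral => A mA _.
by case: hP => _ /(_ g A Gg mA).
Qed.

(** [is_haar] grants left invariance alone. Integrating [F (x^T *m y)] over both variables gives the
    left side when [x] is integrated first and the right side when [y] is, each time by left
    invariance. *)
Lemma haar_tr (F : mxborel R n -> \bar R) : measurable_fun setT F ->
  (forall x, (0 <= F x)%E) ->
  (\int[P]_(x in G) F (x : 'M[R]_n)^T = \int[P]_(x in G) F x)%E.
Proof.
move=> mF F0.
have mT : measurable_fun setT (fun x : mxborel R n => (x : 'M[R]_n)^T : mxborel R n).
  by apply: measurable_trmx_borel.
have mFT : measurable_fun setT (fun x : mxborel R n => F (x : 'M[R]_n)^T).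
  exact: (measurableT_comp mF mT).
pose H (z : mxborel R n * mxborel R n) := F ((z.1 : 'M[R]_n)^T *m (z.2 : 'M[R]_n)).
have mH : measurable_fun setT H.
  apply: (measurableT_comp mF); apply: measurable_mulmx_borel; last exact: measurable_snd.
  by apply: measurable_trmx_borel; exact: measurable_fst.
have cst (c : \bar R) : (0 <= c)%E -> (\int[P]_(x in G) c = c)%E.
  by move=> c0; rewrite integral_cst// -[RHS]mule1; congr (_ * _)%E; case: hP.
have I0 : (0 <= \int[P]_(x in G) F x)%E by apply: integral_ge0.
have I1 : (0 <= \int[P]_(x in G) F (x : 'M[R]_n)^T)%E by apply: integral_ge0.
(* The group has mass one, so a second integration can be introduced on either side. *)
rewrite -[LHS]cst// -[RHS]cst//.
transitivity (\int[P]_(y in G) \int[P]_(x in G) H (x, y))%E.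
  apply: eq_integral => y; rewrite inE => Gy; rewrite -(haar_left mFT _ (rotgrp_tr Gy))//.
  by apply: eq_integral => x _; rewrite /H/= trmx_mul trmxK.
have H0 z : (0 <= H z)%E by exact: F0.
rewrite -(ge0_fubini _ _ _ _ _ P P G G H mG mG)//.
by apply: eq_integral => x; rewrite inE => Gx; rewrite -(haar_left mF _ (rotgrp_tr Gx)).
Qed.

(** Transposition exchanges right and left translations. *)
Lemma haar_right (F : mxborel R n -> \bar R) (c : 'M[R]_n) : measurable_fun setT F ->
  (forall x, (0 <= F x)%E) -> G c ->
  (\int[P]_(x in G) F ((x : 'M[R]_n) *m c) = \int[P]_(x in G) F x)%E.
Proof.
move=> mF F0 Gc.
have mT : measurable_fun setT (fun x : mxborel R n => (x : 'M[R]_n)^T : mxborel R n).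
  by apply: measurable_trmx_borel.
have mFT : measurable_fun setT (fun x : mxborel R n => F (x : 'M[R]_n)^T).
  exact: (measurableT_comp mF mT).
have mc : measurable_fun setT (fun x : mxborel R n => (x : 'M[R]_n) *m c : mxborel R n).
  by apply: measurable_mulmx_borel => //; exact: measurable_cst.
have mFc : measurable_fun setT (fun x : mxborel R n => F ((x : 'M[R]_n) *m c)).
  exact: (measurableT_comp mF mc).
rewrite -(haar_tr mFc)// -(haar_tr mF)// -(haar_left mFT _ (rotgrp_tr Gc))//.
by apply: eq_integral => x _; rewrite trmx_mul trmxK.
Qed.

End haar.

(** * Planes as images under Lorentz matrices *)

Section planes.
Variables (R : realType) (n d : nat).
Hypothesis dn : (d <= n)%N.

Lemma measurable_lorentz : measurable (@lorentz R n : set (mxborel R (n + 1))).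
Proof.
have -> : (@lorentz R n : set (mxborel R (n + 1))) =
  [set M : mxborel R (n + 1) | (M : 'M[R]_(n + 1))^T *m minkmx R n *m M = minkmx R n] `&`
  [set M : mxborel R (n + 1) | 0 < (M : 'M[R]_(n + 1)) (last_ord n) (last_ord n)].
  by apply/seteqP; split.
have mid := @mxmeas_id R (n + 1).
apply: measurableI.
  apply: measurable_mx_eq; apply: mxmeas_mulmx => //; apply: mxmeas_mulmx.
    exact: mxmeas_tr.
  exact: mxmeas_cst.
have := mid (last_ord n) (last_ord n) measurableT _ (measurable_itv `]0, +oo[).
rewrite setTI; congr (measurable _); apply/seteqP.
by split=> M; rewrite /= in_itv/= andbT.
Qed.

Definition plane (M : mxborel R (n + 1)) : hgr R n d := act M (@hplane R n d).

Lemma open_act (S U : set 'cV[R]_(n + 1)) : open U ->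
  open [set M : 'M[R]_(n + 1) | act M S `&` U !=set0].
Proof.
move=> oU; have -> : [set M : 'M[R]_(n + 1) | act M S `&` U !=set0] =
    \bigcup_(x in S) ((fun M : 'M[R]_(n + 1) => M *m x) @^-1` U).
  apply/seteqP; split=> [M [_ [[x Sx <-] UMx]]|M [x Sx UMx]]; first by exists x.
  by exists (M *m x); split=> //; exists x.
apply: bigcup_open => x _; apply: open_comp => // M _.
have cid : continuous (fun N : 'M[R]_(n + 1) => N) by move=> N; exact: cvg_id.
have cx : continuous (fun _ : 'M[R]_(n + 1) => x) by move=> N; apply: cst_continuous.
exact: (continuous_mulmx cid cx).
Qed.

(** A generator of [hgr] is known only through its trace on [Gamma_H], hence the restriction to
    [lorentz], whose matrices produce members of [Gamma_H]; there its preimage is the trace of an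
    open set. *)
Lemma measurable_plane : measurable_fun (@lorentz R n : set (mxborel R (n + 1))) plane.
Proof.
apply: (@measurability _ _ (mxborel R (n + 1)) (hgr R n d)
  (@lorentz R n : set (mxborel R (n + 1))) plane
  [set A : set (set 'cV[R]_(n + 1)) |
    exists2 U : set 'cV[R]_(n + 1), open U &
      A `&` Gamma_H d = [set t | t `&` U !=set0] `&` Gamma_H d]) => //.
move=> _ [A [U oU AU] <-].
have -> : (@lorentz R n : set (mxborel R (n + 1))) `&` plane @^-1` A =
    (@lorentz R n : set (mxborel R (n + 1))) `&` [set M : mxborel R (n + 1) | act M (@hplane R n d) `&` U !=set0].
  apply/seteqP; split=> M [ML h]; split=> //.
    have : (A `&` Gamma_H d) (plane M) by split=> //; exact: Gamma_H_act.
    by rewrite AU => -[].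
  have : ([set t | t `&` U !=set0] `&` Gamma_H d) (plane M).
    by split=> //; exact: Gamma_H_act.
  by rewrite -AU => -[].
apply: measurableI; first exact: measurable_lorentz.
by apply: measurable_open_mxborel; exact: open_act.
Qed.

(* Outside the Lorentz group the value is irrelevant; zero makes the function
   measurable on all matrices. *)
Definition plane_lift (F : hgr R n d -> \bar R) : mxborel R (n + 1) -> \bar R :=
  (F \o plane) \_ (@lorentz R n : set (mxborel R (n + 1))).

Lemma measurable_plane_lift F : measurable_fun setT F -> measurable_fun setT (plane_lift F).
Proof.
move=> mF; rewrite /plane_lift; apply/(measurable_restrictT _ _).1; first exact: measurable_lorentz.
exact: (measurableT_comp mF measurable_plane).
Qed.

Lemma plane_lift_ge0 F : (forall t, (0 <= F t)%E) -> forall M, (0 <= plane_lift F M)%E.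
Proof. by move=> F0 M; rewrite /plane_lift; apply: erestrict_ge0 => N _ /=. Qed.

Lemma plane_liftE F M : lorentz M -> plane_lift F M = F (act M (@hplane R n d)).
Proof. by move=> ML; rewrite /plane_lift patchE mem_set. Qed.

End planes.

(** * Compact approximation and images of compacts *)

Section regularity.
Variables (R : realType) (m : nat) (nu : {measure set (mxborel R m) -> \bar R}).
Hypothesis nu_fin : (nu setT < +oo)%E.
Notation M := (mxborel R m).
Implicit Types (A C U : set 'M[R]_m).

Let le_nu (A B : set M) : measurable A -> measurable B -> A `<=` B -> (nu A <= nu B)%E.
Proof. by move=> mA mB AB; apply: le_measure => //; rewrite inE. Qed.

Lemma measure_decreasing_lt (F : (set M)^nat) (e : \bar R) :
  (forall i, measurable (F i)) -> nonincreasing_seq F ->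
  (nu (\bigcap_n F n) < e)%E -> exists N, (nu (F N) < e)%E.
Proof.
move=> mF nF Fe; apply: contrapT => /forallNP h.
have mcap : measurable (\bigcap_n F n) by exact: bigcap_measurableType.
have cv := nonincreasing_cvg_mu (le_lt_trans (le_nu (mF 0%N) measurableT (@subsetT _ _)) nu_fin) mF mcap nF.
suff : (e <= nu (\bigcap_n F n))%E by rewrite leNgt Fe.
rewrite -(cvg_lim _ cv)//; apply: lime_ge; first by apply/cvg_ex; eexists; exact: cv.
by apply: nearW => n /=; rewrite leNgt; apply/negP; exact: h.
Qed.

Let closed_meas C : closed C -> measurable (C : set M).
Proof.
move=> cC; rewrite -(setCK C); apply: measurableC; apply: measurable_open_mxborel.
exact: closed_openC.
Qed.

Let open_meas U : open U -> measurable (U : set M).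
Proof. exact: measurable_open_mxborel. Qed.

Definition approximable (A : set 'M[R]_m) := forall e : R, 0 < e -> exists C U,
  [/\ closed C, open U, C `<=` A, A `<=` U & (nu (U `\` C) < e%:E)%E].

Lemma approximable_open V : open V -> approximable V.
Proof.
move=> oV e e0.
(* The points at distance at least [1 / (k + 1)] from the complement of [V]; these closed sets
   increase to [V]. *)
pose C k : set 'M[R]_m := ~` \bigcup_(y in ~` V) ball y (k.+1%:R^-1 : R).
have cC k : closed (C k).
  by apply: open_closedC; apply: bigcup_open => y _; exact: ball_open.
have CV k : C k `<=` V.
  move=> x Cx; apply: contrapT => Vx; apply: Cx; exists x => //.
  exact: ballxx.
have [|||N NV] := @measure_decreasing_lt (fun k => V `\` C k) e%:E.
- by move=> k; apply: measurableD; [exact: open_meas|exact: closed_meas].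
- apply/nonincreasing_seqP => k; apply/subsetPset => x [Vx nCx]; split=> //.
  move=> Ckx; apply: nCx => -[y Vy yx]; apply: Ckx; exists y => //.
  by apply: le_ball yx; rewrite lef_pV2 ?posrE// ler_nat.
- rewrite (_ : \bigcap_k _ = set0) ?measure0 ?lte_fin//.
  rewrite -subset0 => x h.
  have Vx : V x by have [] := h 0%N I.
  have /nbhs_ballP[r /= r0 rV] : nbhs x V by exact: open_nbhs_nbhs.
  have [k kr] : exists k : nat, k.+1%:R^-1 < r.
    exists (Num.bound r^-1); rewrite invf_plt ?posrE//.
    by rewrite (lt_le_trans (archi_boundP _))// ?ler_nat// invr_ge0 ltW.
  have [_] := h k I; apply => -[y Vy yx]; apply: Vy; apply: rV.
  by apply: ball_sym; apply: le_ball yx; exact: ltW.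
by exists (C N), V; split.
Qed.

(** Regularity of a finite Borel measure: complements exchange the inner closed and the outer open
    set, so only countable unions need an argument. *)
Lemma approximable_sigma_algebra : sigma_algebra setT approximable.
Proof.
split=> [e e0|A hA e e0|F hF e e0].
- exists set0, set0; split=> //; last by rewrite set0D measure0 lte_fin.
  exact: closed0.
- have [C [U [cC oU CA AU UC]]] := hA e e0.
  exists (~` U), (~` C); split.
  + exact: open_closedC.
  + exact: closed_openC.
  + by rewrite setTD; exact: subsetC.
  + by rewrite setTD; exact: subsetC.
  + by rewrite setDE setCK setIC -setDE.
have e20 : 0 < e / 2 by rewrite divr_gt0.
have hFk k : exists CU : set 'M[R]_m * set 'M[R]_m,
    [/\ closed CU.1, open CU.2, CU.1 `<=` F k, F k `<=` CU.2 &
    (nu (CU.2 `\` CU.1) < (e / 2 / (2 ^ k.+1)%:R)%:E)%E].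
  have [|C [U h]] := hF k (e / 2 / (2 ^ k.+1)%:R); last by exists (C, U).
  by rewrite divr_gt0// ltr0n expn_gt0.
have [CU hCU] := choice hFk.
(* Only finite unions of the closed sets are known to be closed; continuity from above of the finite
   measure tells how many suffice. *)
pose U := \bigcup_k (CU k).2; pose S N := \big[setU/set0]_(k < N) (CU k).1.
have cS N : closed (S N).
  by apply: closed_bigsetU => k _; have [] := hCU k.
have oU : open U by apply: bigcup_open => k _; have [] := hCU k.
have mC k : measurable ((CU k).1 : set M) by apply: closed_meas; have [] := hCU k.
have mU k : measurable ((CU k).2 : set M) by apply: open_meas; have [] := hCU k.
have [|||N NV] := @measure_decreasing_lt (fun N => U `\` S N) e%:E.
- by move=> k; apply: measurableD; [exact: open_meas|exact: closed_meas].
- apply/nonincreasing_seqP => k; apply/subsetPset; apply: setDS.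
  by rewrite /S big_ord_recr/=; exact: subsetUl.
- apply: (@le_lt_trans _ _ (nu (\bigcup_k ((CU k).2 `\` (CU k).1)))).
    apply: le_nu.
    + apply: bigcap_measurableType => k _; apply: measurableD.
        exact: open_meas.
      exact: closed_meas.
    + by apply: bigcupT_measurable => k; exact: measurableD.
    move=> x h; have [k _ Ukx] : U x by have [] := h 0%N I.
    exists k => //; split=> // Ckx; have [_] := h k.+1 I; apply.
    by rewrite /S big_ord_recr/=; right.
  apply: (@le_lt_trans _ _ (\sum_(k <oo) nu ((CU k).2 `\` (CU k).1))%E).
    apply: measure_sigma_subadditive => // [k|].
      exact: measurableD.
    by apply: bigcupT_measurable => k; exact: measurableD.
  apply: (@le_lt_trans _ _ (\sum_(k <oo) (e / 2 / (2 ^ k.+1)%:R)%:E)%E).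
    by apply: lee_nneseries => // k _; apply: ltW; have [] := hCU k.
  apply: (le_lt_trans (epsilon_trick0 xpredT (ltW e20))).
  by rewrite lte_fin ltr_pdivrMr// ltr_pMr// ltr1n.
exists (S N), U; split=> //.
  rewrite /S -(bigcup_mkord N (fun k => (CU k).1)) => x [k _ Ckx]; exists k => //.
  by have [_ _ + _ _] := hCU k; apply.
move=> x [k _ Fkx]; exists k => //.
by have [_ _ _ + _] := hCU k; apply.
Qed.

Lemma approximable_measurable (A : set M) : measurable A -> approximable A.
Proof.
move=> mA; apply: (@smallest_sub _ (sigma_algebra setT) [set U : set 'M[R]_m | open U]
  approximable) => //.
  exact: approximable_sigma_algebra.
exact: approximable_open.
Qed.

Let box (N : nat) : set 'M[R]_m := [set A | forall i j, `|A i j| <= N%:R].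

Lemma compact_box N : compact (box N).
Proof.
have -> : box N = vec_mx @` [set v : 'rV[R]_(m * m) | forall i, `[- N%:R, N%:R]%classic (v ord0 i)].
  apply/seteqP; split=> [A h|_ [v h <-] i j].
    exists (mxvec A); last by rewrite mxvecK.
    by move=> i /=; case/mxvec_indexP: i => i j; rewrite mxvecE in_itv/= -ler_norml; exact: h.
  by rewrite mxE; have := h (mxvec_index i j); rewrite /= in_itv/= ler_norml.
apply: continuous_compact.
  apply: continuous_subspaceT; apply: continuous_mx => i j v.
  rewrite (_ : (fun _ => _) = (fun v : 'rV[R]_(m * m) => v ord0 (mxvec_index i j))).
    exact: coord_continuous.
  by apply/funext => w; rewrite mxE.
apply: (@rV_compact R (m * m) (fun=> `[- N%:R, N%:R]%classic)) => i; exact: segment_compact.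
Qed.

(** The inner closed set is intersected with a box large enough to lose little mass, the boxes being
    compact and exhausting the space. *)
Lemma inner_regular_compact (A : set M) (e : R) : measurable A -> 0 < e ->
  exists K : set 'M[R]_m, [/\ compact K, closed K, K `<=` A & (nu (A `\` K) < e%:E)%E].
Proof.
move=> mA e0; have e20 : 0 < e / 2 by rewrite divr_gt0.
have [C [U [cC oU CA AU UC]]] := approximable_measurable mA e20.
have mC := closed_meas cC.
have cbox N : closed (box N).
  by apply: compact_closed; [exact: norm_hausdorff|exact: compact_box].
have [|||N NV] := @measure_decreasing_lt (fun N => C `\` box N) (e / 2)%:E.
- by move=> k; apply: measurableD => //; exact: closed_meas.
- apply/nonincreasing_seqP => k; apply/subsetPset; apply: setDS => B h i j.
  by rewrite (le_trans (h i j))// ler_nat.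
- rewrite (_ : \bigcap_k _ = set0) ?measure0 ?lte_fin//.
  rewrite -subset0 => x h.
  pose s : R := \sum_(p : 'I_m * 'I_m) `|x p.1 p.2|.
  have s0 : 0 <= s by apply: sumr_ge0.
  have [_] := h (Num.bound s) I; apply => i j.
  rewrite (le_trans _ (ltW (archi_boundP s0)))// /s (bigD1 (i, j))//= lerDl.
  exact: sumr_ge0.
exists (C `&` box N); split.
- by rewrite setIC; apply: compact_closedI => //; exact: compact_box.
- exact: closedI.
- by move=> x [/CA].
have mbox := closed_meas (cbox N).
apply: (@le_lt_trans _ _ (nu ((U `\` C) `|` (C `\` box N)))).
  apply: le_nu.
  - by apply: measurableD => //; exact: measurableI.
  - by apply: measurableU; apply: measurableD => //; exact: open_meas.
  move=> x [Ax nCx]; have [Cx|Cx] := pselect (C x); last by left; split=> //; exact: AU.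
  by right; split=> // bx; exact: nCx.
apply: (le_lt_trans (measureU2 _ _ _)).
- by apply: measurableD => //; exact: open_meas.
- exact: measurableD.
by rewrite (splitr e) EFinD lteD.
Qed.

End regularity.

(** * Planes coming from a compact set of matrices *)

Section plane_image.
Variables (R : realType) (n d : nat).
Hypothesis dn : (d <= n)%N.
Notation idx := ('M[rat]_(n + 1, 1) * nat)%type.
Notation H := (hgr R n d).

Lemma measurable_hit (U : set 'cV[R]_(n + 1)) : open U ->
  measurable ([set t | t `&` U !=set0] : set H).
Proof. by move=> oU; apply: sub_sigma_algebra; exists U. Qed.

(** Such a set is itself a generator, with [U] empty. *)
Lemma measurable_notin_Gamma (S : set H) : S `&` Gamma_H d = set0 -> measurable S.
Proof.
move=> S0; apply: sub_sigma_algebra; exists set0; first exact: open0.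
rewrite S0; apply/esym; rewrite -subset0 => t [[x [_ []]]].
Qed.

Lemma continuous_lorentz_inv (l : 'I_(n + 1)) :
  continuous (fun p : 'M[R]_(n + 1) * 'cV[R]_(n + 1) => (lorentz_inv p.1 *m p.2) l 0).
Proof.
apply: continuous_coord; apply: continuous_mulmx; last by move=> p; exact: cvg_snd.
apply: continuous_mulmx; last by move=> p; exact: cst_continuous.
apply: continuous_mulmx; first by move=> p; exact: cst_continuous.
apply: continuous_mx => i j.
rewrite (_ : (fun _ => _) = (fun p : 'M[R]_(n + 1) * 'cV[R]_(n + 1) => p.1 j i)).
  by apply: continuous_coord => p; exact: cvg_fst.
by apply/funext => p; rewrite mxE.
Qed.

(* Disjointness of [act M (hplane d)] from a box, witnessed by one coordinate;
   unlike disjointness itself it survives small perturbations of [M]. *)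
Definition misses (I : idx) : set 'M[R]_(n + 1) :=
  [set M | exists2 l : 'I_n, (l < n - d)%N &
     forall y, rat_box I y -> (lorentz_inv M *m y) (lshift 1 l) 0 != 0].

Lemma misses_disjoint I M : lorentz M -> misses I M ->
  act M (hplane d) `&` rat_box I = set0.
Proof.
move=> ML [l ld hl]; rewrite -subset0 => y [/(act_hplaneP _ _ ML) hy /hl].
move: hy; rewrite -(vecK (_ *m y)); move: (usubmx _) (_ _ 0) => u s.
by rewrite vec_coord => /(hplane_vec _ _ dn)[_ hu] /eqP; apply; exact: hu.
Qed.

(** A point of [hspace] off the plane has, after [lorentz_inv M], a nonzero coordinate among those
    that vanish on [hplane d]. Joint continuity keeps it nonzero on a box around [x] for all
    matrices near [M]. *)
Lemma exists_misses M x : lorentz M -> hspace x -> ~ act M (hplane d) x ->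
  exists I, rat_box I x /\ (misses I)° M.
Proof.
move=> ML xH nx.
have [l ld xl] : exists2 l : 'I_n, (l < n - d)%N &
    (lorentz_inv M *m x) (lshift 1 l) 0 != 0.
  apply: contrapT => h; apply: nx; apply/act_hplaneP => //.
  have hx : hspace (lorentz_inv M *m x).
    by apply/(lorentz_hspace _ ML); rewrite mulmxA lorentz_mulmxV// mul1mx.
  move: hx h; rewrite -(vecK (lorentz_inv M *m x)) => hx h.
  apply/hplane_vec => //; split=> // l ld; apply: contrapT => /eqP ul.
  by apply: h; exists l => //; rewrite vec_coord.
have oN : open [set r : R | r != 0] by exact: open_neq.
have nN : nbhs ((lorentz_inv M *m x) (lshift 1 l) 0) [set r : R | r != 0].
  exact: open_nbhs_nbhs.
have [[P Q] /= [PM Qx] PQ] := @continuous_lorentz_inv (lshift 1 l) (M, x) _ nN.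
have [I [Ix IQ]] : exists I, rat_box I x /\ rat_box I `<=` Q°.
  by apply: rat_box_basis; [exact: open_interior|].
exists I; split=> //; rewrite /interior.
apply: filterS PM => N PN; exists l => // y /IQ/interior_subset Qy.
exact: (PQ (N, y)).
Qed.

(* A plane outside the image is separated from all planes of the image by
   finitely many boxes that it meets; there are countably many such families. *)
Lemma measurable_plane_image (K : set 'M[R]_(n + 1)) : compact K ->
  K `<=` lorentz (n := n) -> measurable ((fun M => act M (hplane d)) @` K : set H).
Proof.
move=> cK KL.
pose bad : set H := \bigcup_(s : seq idx)
  (if `[< K `<=` \bigcup_(I in [set` s]) (misses I)° >]
   then \big[setI/setT]_(I <- s) ([set t | t `&` rat_box I !=set0] : set H) else set0).
have mbad : measurable bad.
  apply: countable_bigcupT_measurable => // s; case: ifPn => // _.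
  apply: bigsetI_measurable => I _; apply: measurable_hit; exact: open_rat_box.
rewrite (_ : image _ _ = ~` (~` (Gamma_H d : set H) `|` bad)); last first.
  apply/seteqP; split=> [_ [M KM <-] [nG|[s _]]|t /not_orP[/contrapT tG tb]].
  - by apply: nG; apply: Gamma_H_act => //; exact: KL.
  - case: ifPn => // /asboolP /(_ M KM)[I Is /interior_subset IM].
    rewrite -bigcap_seq => /(_ I Is)/=.
    by rewrite (misses_disjoint (KL _ KM) IM) => -[].
  apply: contrapT => nt; apply: tb.
  pose D : set idx := [set I | t `&` rat_box I !=set0].
  have : cover_compact K by rewrite -compact_cover.
  move=> /(_ idx D (fun I => (misses I)°)).
  case=> [I _|M KM|D' D'D KD']; first exact: open_interior.
    have [x tx nx] : exists2 x, t x & ~ act M (hplane d) x.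
      apply: contrapT => h; apply: nt; exists M => //; apply/esym.
      apply: (Gamma_H_sub tG (Gamma_H_act dn (KL _ KM))) => x tx.
      by apply: contrapT => nx; apply: h; exists x.
    have xH : hspace x by case: tG => _ [W [_ tE]]; move: tx; rewrite tE => -[].
    have [I [Ix IM]] := exists_misses (KL _ KM) xH nx.
    by exists I => //; exists x.
  exists (finmap.enum_fset D') => //; case: ifPn => [_|/asboolP]; last first.
    by case=> M /KD'[I ID' IM]; exists I.
  rewrite -bigcap_seq => I ID'; have : I \in D by apply: D'D.
  by rewrite inE.
apply: measurableC; apply: measurableU => //.
by apply: measurable_notin_Gamma; rewrite setICl.
Qed.

End plane_image.

(** * Averages and the Radon transform *)

Section averages.
Variables (R : realType) (n j : nat) (PK : probability (mxborel R n) R).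
Hypotheses (hPK : is_haar (rotgrp n) PK) (jn : (j < n)%N).
Notation G := (@rotgrp R n n).
Notation leb := (@lebesgue_measure R).
Notation TR := (measurableTypeR R).

Let mG : measurable (G : set (mxborel R n)) := @measurable_rotgrp R n n.

Definition polar_mx (a : mxborel R n) (s : TR) : mxborel R (n + 1) :=
  emb a *m boost n (n - j) s.

Let pjE : exists pj : 'I_n, (pj.+1 = n - j)%N.
Proof.
have h : ((n - j).-1 < n)%N by lia.
by exists (Ordinal h) => /=; lia.
Qed.

Lemma lorentz_boost_sub r : lorentz (boost n (n - j) r : 'M[R]_(n + 1)).
Proof. by have [pj <-] := pjE; exact: lorentz_boost. Qed.

Lemma lorentz_polar_mx a s : G a -> lorentz (polar_mx a s).
Proof.
move=> Ga; apply: lorentz_mulmx; last exact: lorentz_boost_sub.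
by apply: lorentz_emb; exact: rotgrp_orthogonal Ga.
Qed.

(** The mean [A(s)] over the j-planes at distance [s]; [plane_lift] makes the integrand measurable
    jointly in [a] and [s]. *)
Definition average (E : hgr R n j -> \bar R) (s : TR) : \bar R :=
  (\int[PK]_(a in G) plane_lift E (polar_mx a s))%E.

Lemma measurable_polar_mx d (T : measurableType d) (a : T -> mxborel R n) (s : T -> TR) :
  measurable_fun setT a -> measurable_fun setT s ->
  measurable_fun setT (fun t => polar_mx (a t) (s t)).
Proof.
move=> ma ms; apply: mxmeas_measurable; apply: mxmeas_mulmx.
  by apply: mxmeas_emb => i l; exact: (measurableT_comp (mxmeas_id i l) ma).
exact: mxmeas_boost.
Qed.

Section integrand.
Variable (E : hgr R n j -> \bar R).
Hypotheses (mE : measurable_fun setT E) (E0 : forall t, (0 <= E t)%E).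

Lemma measurable_average : measurable_fun setT (average E).
Proof.
apply: (measurable_ge0_integral_section _ _ _ _ _ PK G
  (fun z : TR * mxborel R n => plane_lift E (polar_mx z.2 z.1))) => //.
  apply: (measurableT_comp (measurable_plane_lift (ltnW jn) mE)).
  by apply: measurable_polar_mx; [exact: measurable_snd|exact: measurable_fst].
by move=> z; exact: plane_lift_ge0.
Qed.

Lemma average_ge0 s : (0 <= average E s)%E.
Proof. by apply: integral_ge0 => a _; exact: plane_lift_ge0. Qed.

End integrand.

Variables (F : hgr R n j -> R) (p : R).
Hypotheses (mF : measurable_fun setT (F : hgr R n j -> TR)) (F0 : forall t, 0 <= F t).
Hypothesis (p1 : 1 <= p).

Let E t := (F t)%:E.
Let Ep t := (F t `^ p)%:E.

Let mE : measurable_fun setT E.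
Proof. exact/measurable_EFinP. Qed.

Let mEp : measurable_fun setT Ep.
Proof. by apply/measurable_EFinP; exact: (measurableT_comp (measurable_powR p)). Qed.

Let E0 t : (0 <= E t)%E. Proof. by rewrite lee_fin. Qed.
Let Ep0 t : (0 <= Ep t)%E. Proof. by rewrite lee_fin powR_ge0. Qed.

Let mgeo s : measurable_fun setT (fun a : mxborel R n => polar_mx a s).
Proof. by apply: measurable_polar_mx => //; exact: measurable_cst. Qed.

Let mliftE s : measurable_fun setT (fun a : mxborel R n => plane_lift E (polar_mx a s)).
Proof. exact: (measurableT_comp (measurable_plane_lift (ltnW jn) mE) (mgeo s)). Qed.

Let mliftEp s : measurable_fun setT (fun a : mxborel R n => plane_lift Ep (polar_mx a s)).
Proof. exact: (measurableT_comp (measurable_plane_lift (ltnW jn) mEp) (mgeo s)). Qed.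

Lemma average_le_weight (k : nat) (s : TR) : k%:R * p < (n - 1)%:R ->
  ((cosh s ^+ k)%:E * average E s <= (cosh s ^+ (n - 1))%:E * average Ep s +
    (cosh s `^ (k%:R - (n - 1)%:R / p))%:E)%E.
Proof.
move=> kp; have c0 := cosh_gt0 _ s.
have ck i : 0 <= cosh s ^+ i by rewrite exprn_ge0// ltW.
have lE0 a : (0 <= plane_lift E (polar_mx a s))%E by exact: plane_lift_ge0.
have lEp0 a : (0 <= plane_lift Ep (polar_mx a s))%E by exact: plane_lift_ge0.
rewrite /average -ge0_integralZl//; last 2 first.
- by apply: measurable_funTS; exact: mliftE.
- by rewrite lee_fin.
rewrite -ge0_integralZl//; last 2 first.
- by apply: measurable_funTS; exact: mliftEp.
- by rewrite lee_fin.
have -> : (cosh s `^ (k%:R - (n - 1)%:R / p))%:E =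
    (\int[PK]_(a in G) (cosh s `^ (k%:R - (n - 1)%:R / p))%:E)%E.
  by rewrite integral_cst// -[LHS]mule1; congr (_ * _)%E; case: hPK.
rewrite -ge0_integralD//; last 3 first.
- by move=> a _; rewrite mule_ge0// lee_fin.
- apply: measurable_funTS; apply: emeasurable_funM => //; exact: mliftEp.
- by rewrite lee_fin powR_ge0.
apply: ge0_le_integral => //.
- by move=> a _; rewrite mule_ge0// lee_fin.
- by apply: measurable_funTS; apply: emeasurable_funM => //; exact: mliftE.
- apply: measurable_funTS; apply: emeasurable_funD => //.
  by apply: emeasurable_funM => //; exact: mliftEp.
move=> a Ga; have La := lorentz_polar_mx s Ga.
rewrite !plane_liftE// -!EFinM -EFinD lee_fin.
exact: le_powR_weight (cosh_ge1 _ _) (F0 _).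
Qed.

Variable (muj : {measure set (hgr R n j) -> \bar R}).
Hypotheses (hmuj : invariant_measure PK muj) (jn2 : (2 <= n - j)%N).
Hypothesis Fp : (\int[muj]_t (F t `^ p)%:E < +oo)%E.

(** This is [invariant_measure] applied to the p-th power of [F]: were the radial integral infinite,
    its product with the positive sphere area would be infinite too. *)
Lemma average_fin : (\int[leb]_(s in `]0%R, +oo[)
  ((hweight (n - j - 1) j s)%:E * average Ep s) < +oo)%E.
Proof.
have s0 := sphere_area_gt0 R _ jn2.
have h := hmuj mEp Ep0; rewrite ltNge leye_eq; apply/negP => /eqP X.
move: Fp; rewrite h.
rewrite [X in (_ * X)%E](_ : _ = +oo%E); first by rewrite gt0_muley ?lte_fin ?ltxx.
rewrite -X; apply: eq_integral => s _; congr (_ * _)%E.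
by apply: eq_integral => a; rewrite inE => Ga; rewrite plane_liftE//; exact: lorentz_polar_mx.
Qed.

Lemma average_tail (k : nat) (e : R) : k%:R * p < (n - 1)%:R -> 0 < e ->
  (\int[leb]_(s in `]e, +oo[) ((cosh s ^+ k)%:E * average E s) < +oo)%E.
Proof.
move=> kp e0; have nE : (n - 1 = n - j - 1 + j)%N by lia.
have kp' : k%:R * p < (n - j - 1 + j)%:R by rewrite -nE.
apply: (weighted_norm_estimate R p k (n - j - 1) j _ (average Ep) e p1 kp' e0) => //.
- exact: measurable_average.
- exact: average_ge0.
- exact: measurable_average.
- exact: average_ge0.
- by move=> s; rewrite -nE; exact: average_le_weight.
- exact: average_fin.
Qed.

End averages.

Section product_sigma_finite.
Context d1 d2 (T1 : measurableType d1) (T2 : measurableType d2) (R : realType).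
Variables (m1 : {sigma_finite_measure set T1 -> \bar R}) (P : probability T2 R).

Lemma sigma_finite_product_probability : sigma_finite setT (m1 \x P)%E.
Proof.
have [F FT mF] := sigma_finiteT m1; exists (fun i => F i `*` setT).
  apply/seteqP; split=> // -[x y] _; have : [set: T1] x by [].
  by rewrite FT => -[i _ Fx]; exists i.
move=> i; have [mFi Fi] := mF i; split; first exact: measurableX.
rewrite [X in (X < _)%E](_ : _ = m1 (F i))//.
rewrite product_measure1E// -[RHS]mule1; congr (_ * _)%E; exact: probability_setT.
Qed.

(** Bundled as sigma-finite so that this product can itself be a factor in Tonelli's theorem. *)
Definition product_probability : {sigma_finite_measure set (T1 * T2)%type -> \bar R} :=
  HB.pack (m1 \x P)%E (Measure_isSigmaFinite.Build _ _ _ (m1 \x P)%E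
    sigma_finite_product_probability).

End product_sigma_finite.

(** * The Radon integral of a nonnegative function *)

Section radon_integral.
Variables (R : realType) (n k j : nat) (pl : 'I_n).
Variables (PK Pk : probability (mxborel R n) R).
Hypotheses (hPK : is_haar (rotgrp n) PK) (hPk : is_haar (rotgrp k) Pk).
Hypotheses (jk : (j < k)%N) (kn : (k <= n - 1)%N) (plE : (pl.+1 = n)%N).
Notation G := (@rotgrp R n n).
Notation Gk := (@rotgrp R n k).
Notation leb := (@lebesgue_measure R).
Notation TR := (measurableTypeR R).
Notation TT := (TR * mxborel R n)%type.

Notation lebP := (product_probability leb Pk).

Let mG : measurable (G : set (mxborel R n)) := @measurable_rotgrp R n n.
Let mGk : measurable (Gk : set (mxborel R n)) := @measurable_rotgrp R n k.
Let jn : (j < n)%N. Proof. lia. Qed.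

Definition sign_mx (s : bool) : 'M[R]_n := if s then refl R pl else 1%:M.

(** The matrix of [hpoint] with the frame made explicit: [x = (r, a)] places the k-plane,
    [q = (rho, b)] the j-plane inside it. *)
Definition frame_mx (s : bool) (x q : TT) : mxborel R (n + 1) :=
  emb (x.2 : 'M[R]_n) *m boost n (n - k) x.1 *m emb (sign_mx s) *m emb (q.2 : 'M[R]_n) *m
  boost n (n - j) q.1.

Let pkE : exists pk : 'I_n, (pk.+1 = n - k)%N.
Proof.
have h : ((n - k).-1 < n)%N by lia.
by exists (Ordinal h) => /=; lia.
Qed.

Let pjE : exists pj : 'I_n, (pj.+1 = n - j)%N.
Proof.
have h : ((n - j).-1 < n)%N by lia.
by exists (Ordinal h) => /=; lia.
Qed.

Lemma sign_mx_orthogonal s : (sign_mx s)^T *m sign_mx s = 1%:M.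
Proof. by case: s; [exact: refl_orthogonal|rewrite /sign_mx trmx1 mul1mx]. Qed.

Lemma lorentz_frame_mx s x q : G x.2 -> Gk q.2 -> lorentz (frame_mx s x q).
Proof.
move=> Gx Gq; have [pk pk1] := pkE; have [pj pj1] := pjE.
rewrite /frame_mx -pk1 -pj1; do 4?apply: lorentz_mulmx; try exact: lorentz_boost.
- by apply: lorentz_emb; exact: rotgrp_orthogonal Gx.
- by apply: lorentz_emb; exact: sign_mx_orthogonal.
- by apply: lorentz_emb; exact: rotgrp_orthogonal Gq.
Qed.

(** [c] does not depend on [a], so right invariance removes it when [a] is averaged. *)
Lemma frame_mx_polar s (r : R) (q : TT) : 0 < r -> 0 < q.1 -> Gk q.2 ->
  exists2 c, G c & forall a : mxborel R n,
    act (frame_mx s (r, a) q) (@hplane R n j) =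
    act (polar_mx j ((a : 'M[R]_n) *m c : mxborel R n) (arcosh (cosh r * cosh q.1))) (@hplane R n j).
Proof.
move=> r0 q0 Gq; have [pk pk1] := pkE; have [pj pj1] := pjE.
have oB : (sign_mx s *m q.2)^T *m (sign_mx s *m q.2) = 1%:M.
  by apply: orthogonal_mulmx; [exact: sign_mx_orthogonal|exact: rotgrp_orthogonal Gq].
have Be : sign_mx s *m q.2 *m bvec R n pk.+1 = bvec R n pk.+1.
  rewrite -mulmxA (rotgrp_fix Gq) ?pk1// -pk1 /sign_mx; case: (s); last by rewrite mul1mx.
  rewrite refl_fix// mxE (_ : (_ == _) = false)//; apply/negbTE.
  by have := ltn_ord pk; lia.
have [c Gc ce] := boost_emb_boost pk1 pj1 jk oB Be r0 q0.
exists c => // a; apply: eq_act => x hx.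
by rewrite /frame_mx /polar_mx /= embM -!mulmxA -ce// embM -!mulmxA.
Qed.

Lemma measurable_frame_mx s d (T : measurableType d) (x q : T -> TT) :
  measurable_fun setT x -> measurable_fun setT q ->
  measurable_fun setT (fun t => frame_mx s (x t) (q t)).
Proof.
move=> mx mq; apply: mxmeas_measurable.
have m1 : measurable_fun setT (fun t => (x t).1) by exact: (measurableT_comp measurable_fst mx).
have m2 : measurable_fun setT (fun t => (x t).2) by exact: (measurableT_comp measurable_snd mx).
have m3 : measurable_fun setT (fun t => (q t).1) by exact: (measurableT_comp measurable_fst mq).
have m4 : measurable_fun setT (fun t => (q t).2) by exact: (measurableT_comp measurable_snd mq).
apply: mxmeas_mulmx; last exact: mxmeas_boost.
apply: mxmeas_mulmx; last first.
  by apply: mxmeas_emb => i l; exact: (measurableT_comp (mxmeas_id i l) m4).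
apply: mxmeas_mulmx; last exact: mxmeas_cst.
apply: mxmeas_mulmx; last exact: mxmeas_boost.
by apply: mxmeas_emb => i l; exact: (measurableT_comp (mxmeas_id i l) m2).
Qed.

Definition radon_dom : set TT := `]0, +oo[%classic `*` Gk.

Lemma measurable_radon_dom : measurable radon_dom.
Proof. by apply: measurableX => //; exact: measurable_itv. Qed.

Variable (E : hgr R n j -> \bar R).
Hypotheses (mE : measurable_fun setT E) (E0 : forall t, (0 <= E t)%E).

(* The absolute value makes the integrand nonnegative outside [radon_dom] too. *)
Let w (q : TT) : \bar R := `|hweight (k - j - 1) j q.1|%:E.

Definition radon_integrand s (z : TT * TT) : \bar R :=
  (w z.2 * plane_lift E (frame_mx s z.1 z.2))%E.

(** Up to the sphere constant, the transform of [E] at the plane with parameters [x], computed in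
    the frame [x.2] changed by the sign [s]. *)
Definition radon_int s (x : TT) : \bar R :=
  (\int[lebP]_(q in radon_dom) radon_integrand s (x, q))%E.

Let mw : measurable_fun setT w.
Proof.
apply/measurable_EFinP; apply: (measurableT_comp (@normr_measurable R setT)).
exact: (measurableT_comp (measurable_hweight R _ _) measurable_fst).
Qed.

Lemma measurable_radon_integrand s : measurable_fun setT (radon_integrand s).
Proof.
apply: emeasurable_funM; first exact: (measurableT_comp mw measurable_snd).
apply: (measurableT_comp (measurable_plane_lift (ltnW jn) mE)).
by apply: measurable_frame_mx; [exact: measurable_fst|exact: measurable_snd].
Qed.

Lemma radon_integrand_ge0 s z : (0 <= radon_integrand s z)%E.
Proof. by rewrite mule_ge0 ?lee_fin//; exact: plane_lift_ge0. Qed.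

Lemma measurable_radon_int s : measurable_fun setT (radon_int s).
Proof.
apply: (measurable_ge0_integral_section _ _ _ _ _ lebP radon_dom
  (radon_integrand s)) => //.
- exact: measurable_radon_dom.
- exact: measurable_radon_integrand.
- exact: radon_integrand_ge0.
Qed.

Lemma radon_int_ge0 s x : (0 <= radon_int s x)%E.
Proof. by apply: integral_ge0 => q _; exact: radon_integrand_ge0. Qed.

(* Averaging over [a] removes all dependence on the plane but its distance to
   the origin, which is [arcosh (cosh r * cosh rho)]. *)
Lemma average_radon_int s (r : R) : 0 < r ->
  (\int[PK]_(a in G) radon_int s (r, a) =
   \int[leb]_(rho in `]0%R, +oo[)
     (`|hweight (k - j - 1) j rho|%:E * average PK E (arcosh (cosh r * cosh rho))))%E.
Proof.
move=> r0.
pose f (z : mxborel R n * TT) := radon_integrand s ((r : TR, z.1), z.2).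
have mf : measurable_fun setT f.
  apply: (measurableT_comp (measurable_radon_integrand s)).
  apply: measurable_fun_pair; last exact: measurable_snd.
  by apply: measurable_fun_pair; [exact: measurable_cst|exact: measurable_fst].
have f0 z : (0 <= f z)%E by exact: radon_integrand_ge0.
rewrite /radon_int (ge0_fubini _ _ _ _ _ PK lebP G radon_dom f mG measurable_radon_dom mf f0).
pose g (q : TT) := (w q * average PK E (arcosh (cosh r * cosh q.1)))%E.
have mS : measurable_fun setT (fun t : TR => arcosh (cosh r * cosh t) : TR).
  apply: (measurableT_comp (measurable_arcosh R)); apply: measurable_funM => //.
  exact: measurable_cosh.
have mav := measurable_average PK jn mE E0.
have mg : measurable_fun setT g.
  apply: emeasurable_funM; first exact: mw.
  have mS1 : measurable_fun setT (fun q : TT => arcosh (cosh r * cosh q.1) : TR).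
    exact: (measurableT_comp mS measurable_fst).
  exact: (measurableT_comp mav mS1).
have g0 q : (0 <= g q)%E by rewrite mule_ge0 ?lee_fin//; exact: average_ge0.
transitivity (\int[lebP]_(q in radon_dom) g q)%E.
  apply: eq_integral => q; rewrite inE => -[q0 Gq].
  have {}q0 : 0 < q.1 by move: q0; rewrite /= in_itv/= andbT.
  have [c Gc ce] := frame_mx_polar s r0 q0 Gq.
  have mg2 : measurable_fun setT (fun a : mxborel R n =>
      plane_lift E (polar_mx j a (arcosh (cosh r * cosh q.1)))).
    apply: (measurableT_comp (measurable_plane_lift (ltnW jn) mE)).
    by apply: measurable_polar_mx => //; exact: measurable_cst.
  have pl0 a : (0 <= plane_lift E (polar_mx j a (arcosh (cosh r * cosh q.1))))%E by exact: plane_lift_ge0.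
  pose A := fun a : mxborel R n => plane_lift E (polar_mx j a (arcosh (cosh r * cosh q.1))).
  have AcE := haar_right hPK mg2 pl0 Gc.
  transitivity (\int[PK]_(a in G) (w q * A ((a : 'M[R]_n) *m c)))%E.
    apply: eq_integral => a; rewrite inE => Ga; congr (_ * _)%E.
    have L1 := lorentz_frame_mx s (x := (r : TR, a)) Ga Gq.
    have L2 := lorentz_polar_mx jn (arcosh (cosh r * cosh q.1)) (rotgrp_mulmx Ga Gc).
    by rewrite /A (plane_liftE E L1) (plane_liftE E L2) ce.
  rewrite ge0_integralZl//.
  - by congr (_ * _)%E; exact: AcE.
  - apply: measurable_funTS; apply: (measurableT_comp mg2).
    by apply: measurable_mulmx_borel => //; exact: measurable_cst.
  - by move=> a _; exact: pl0.
  - by rewrite lee_fin.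
(* [g] no longer depends on the rotation [b], and [Gk] has mass one. *)
transitivity (\int[leb]_(rho in `]0%R, +oo[) \int[Pk]_(b in Gk) g (rho, b))%E.
  exact: (ge0_fubini1 _ _ _ _ _ leb Pk `]0, +oo[%classic Gk g (measurable_itv _) mGk mg g0).
apply: eq_integral => rho _; rewrite [LHS](_ : _ = \int[Pk]_(b in Gk) cst
  (`|hweight (k - j - 1) j rho|%:E * average PK E (arcosh (cosh r * cosh rho))) b)%E//.
rewrite integral_cst// -[RHS]mule1; congr (_ * _)%E.
by case: hPk.
Qed.

Lemma radon_int_fin s (e N : R) : 0 < e -> e < N ->
  (\int[leb]_(t in `]e, +oo[) ((cosh t ^+ (k - 1))%:E * average PK E t) < +oo)%E ->
  (\int[leb]_(r in `]e, N[) \int[PK]_(a in G) radon_int s (r, a) < +oo)%E.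
Proof.
move=> e0 eN fin.
have -> : (\int[leb]_(r in `]e, N[) \int[PK]_(a in G) radon_int s (r, a) =
    \int[leb]_(r in `]e, N[) \int[leb]_(rho in `]0%R, +oo[)
      (`|hweight (k - j - 1) j rho|%:E * average PK E (arcosh (cosh r * cosh rho))))%E.
  apply: eq_integral => r; rewrite inE/= in_itv/= => /andP[er _].
  by apply: average_radon_int; exact: lt_trans er.
apply: (averaged_estimate R) => //.
- exact: measurable_average.
- exact: average_ge0.
- by have -> : (k - j - 1 + j = k - 1)%N by lia.
Qed.

End radon_integral.

(** * Null sets of planes *)

Section null_sets.
Variables (R : realType) (n k : nat) (PK : probability (mxborel R n) R).
Variable (muk : {measure set (hgr R n k) -> \bar R}).
Hypotheses (hPK : is_haar (rotgrp n) PK) (hmuk : invariant_measure PK muk) (kn : (k < n)%N).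
Notation G := (@rotgrp R n n).
Notation leb := (@lebesgue_measure R).
Notation TR := (measurableTypeR R).
Notation TT := (TR * mxborel R n)%type.
Notation lebP := (product_probability leb PK).

Let mG : measurable (G : set (mxborel R n)) := @measurable_rotgrp R n n.

Let D0 : set TT := `]0, +oo[%classic `*` G.
Let mD0 : measurable D0. Proof. by apply: measurableX => //; exact: measurable_itv. Qed.

(** Parameters [(r, a)] are stored in one square matrix, so that inner regularity and compactness on
    matrices apply to them. *)
Let enc (x : TT) : mxborel R (n + 1) := block_mx (x.2 : 'M[R]_n) 0 0 (x.1 : R)%:M.
Let dec (X : mxborel R (n + 1)) : TT :=
  ((X : 'M[R]_(n + 1)) (last_ord n) (last_ord n), ulsubmx (X : 'M[R]_(n + 1)) : mxborel R n).

Let encK x : dec (enc x) = x.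
Proof.
by case: x => r a; rewrite /dec /enc block_mxKul block_mxEdr mxE eqxx.
Qed.

Let menc : measurable_fun setT enc.
Proof.
apply: mxmeas_measurable; apply: mxmeas_block; try exact: mxmeas_cst.
  by move=> i l; exact: (measurableT_comp (mxmeas_id i l) measurable_snd).
by apply: mxmeas_scalar; exact: measurable_fst.
Qed.

Let mdec : measurable_fun setT dec.
Proof.
apply: measurable_fun_pair; first exact: mxmeas_id.
apply: mxmeas_measurable => i l.
rewrite (_ : (fun _ => _) = (fun X : mxborel R (n + 1) =>
  (X : 'M[R]_(n + 1)) (lshift 1 i) (lshift 1 l) : TR)); first exact: mxmeas_id.
by apply/funext => X; rewrite !mxE.
Qed.

Variable B : set TT.
Hypotheses (mB : measurable B)
  (hB : forall e N : R, 0 < e -> e < N -> lebP ((`]e, N[%classic `*` G) `\` B) = 0%E).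

(** [dec] ignores the off-diagonal blocks, so [Q] exceeds the range of [enc]; the pushforward under
    [enc] does not see the excess, and [Mk] depends on [dec] alone. *)
Let Q : set (mxborel R (n + 1)) := dec @^-1` (D0 `&` B).

Let mQ : measurable Q.
Proof. by rewrite -[X in measurable X]setTI; apply: mdec => //; exact: measurableI. Qed.

(** A truncation of finite measure, as regularity requires; [N.+2] keeps the lower end below the
    upper one, as [hB] demands. *)
Let box (N : nat) : set TT := `](N.+2%:R^-1 : R), (N.+2%:R : R)[%classic `*` G.

Let mbox N : measurable (box N).
Proof. by apply: measurableX => //; exact: measurable_itv. Qed.

Let box_fin N : (lebP (box N) < +oo)%E.
Proof.
pose I : set TR := `](N.+2%:R^-1 : R), (N.+2%:R : R)[%classic.
have -> : lebP (box N) = (leb I * PK G)%E by apply: product_measure1E => //; exact: measurable_itv.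
have -> : PK G = 1%E by case: hPK.
by rewrite mule1 lebesgue_measure_itv/=; case: ifP => _; rewrite ?ltry// -EFinB ltry.
Qed.

Let exists_compact N i : exists K : set 'M[R]_(n + 1),
  [/\ compact K, closed K, K `<=` Q & (lebP (box N `&` enc @^-1` (Q `\` K)) < (i.+1%:R^-1)%:E)%E].
Proof.
pose nu0 : {measure set TT -> \bar R} := mrestr lebP (mbox N).
pose nu : {measure set (mxborel R (n + 1)) -> \bar R} :=
  pushforward nu0 enc.
have nu_fin : (nu menc setT < +oo)%E.
  rewrite /nu/= /pushforward /mrestr preimage_setT setTI; exact: box_fin.
have i0 : 0 < i.+1%:R^-1 :> R by rewrite invr_gt0.
have [K [cK clK KQ nuK]] := inner_regular_compact nu_fin mQ i0.
by exists K; split=> //; rewrite setIC.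
Qed.

Let Mk (X : 'M[R]_(n + 1)) : 'M[R]_(n + 1) := polar_mx k (dec X).2 (dec X).1.

Let continuous_Mk : continuous Mk.
Proof.
apply: continuous_mulmx.
  apply: continuous_mx => i l.
  case: (fintype.split_ordP i) => i' ->; case: (fintype.split_ordP l) => l' ->.
  - rewrite (_ : (fun _ => _) = (fun X : 'M[R]_(n + 1) => X (lshift 1 i') (lshift 1 l'))).
      exact: coord_continuous.
    by apply/funext => X; rewrite /emb block_mxEul !mxE.
  - rewrite (_ : (fun _ => _) = (fun X : 'M[R]_(n + 1) => 0)); first exact: cst_continuous.
    by apply/funext => X; rewrite /emb block_mxEur mxE.
  - rewrite (_ : (fun _ => _) = (fun X : 'M[R]_(n + 1) => 0)); first exact: cst_continuous.
    by apply/funext => X; rewrite /emb block_mxEdl mxE.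
  - rewrite (_ : (fun _ => _) = (fun X : 'M[R]_(n + 1) => (1%:M : 'M[R]_1) i' l')).
      exact: cst_continuous.
    by apply/funext => X; rewrite /emb block_mxEdr.
have cN (x : R) : expR (- t) @[t --> x] --> expR (- x).
  by apply: (@continuous_comp _ _ _ -%R expR); [exact: continuousN|exact: continuous_expR].
have ccosh : continuous (fun X : 'M[R]_(n + 1) => cosh (X (last_ord n) (last_ord n))).
  move=> X; apply: (@continuous_comp _ _ _ (fun X : 'M[R]_(n + 1) => X _ _) (@cosh R)).
    exact: coord_continuous.
  by move=> ?; apply: cvgM; [apply: cvgD; [exact: continuous_expR|exact: cN]|exact: cvg_cst].
have csinh : continuous (fun X : 'M[R]_(n + 1) => sinh (X (last_ord n) (last_ord n))).
  move=> X; apply: (@continuous_comp _ _ _ (fun X : 'M[R]_(n + 1) => X _ _) (@sinh R)).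
    exact: coord_continuous.
  by move=> ?; apply: cvgM; [apply: cvgB; [exact: continuous_expR|exact: cN]|exact: cvg_cst].
apply: continuous_mx => a b.
rewrite (_ : (fun _ => _) = (fun X : 'M[R]_(n + 1) =>
    if ((a.+1 == n - k) && (b.+1 == n - k)) || ((a.+1 == n.+1) && (b.+1 == n.+1))
    then cosh (X (last_ord n) (last_ord n))
    else if ((a.+1 == n - k) && (b.+1 == n.+1)) || ((a.+1 == n.+1) && (b.+1 == n - k))
    then sinh (X (last_ord n) (last_ord n)) else (a == b)%:R)%N); last first.
  by apply/funext => X; rewrite mxE.
case: (_ || _) => //; case: (_ || _) => //; exact: cst_continuous.
Qed.

(* The planes with parameters in [B] need not form a visibly measurable set, so
   [B] is first exhausted, up to a null set, by countably many compacts. *)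
Lemma null_complement : exists D : set (hgr R n k),
  [/\ measurable D, muk (~` D) = 0%E &
   forall z, D z -> exists r a, [/\ 0 < r, G a, B (r, a) &
     z = act (emb a *m boost n (n - k) r) (@hplane R n k)]].
Proof.
have /choice[K hK] := fun Ni : nat * nat => exists_compact Ni.1 Ni.2.
pose D : set (hgr R n k) := \bigcup_Ni ((fun M => act M (@hplane R n k)) @` (Mk @` K Ni)).
have QL X : Q X -> lorentz (Mk X).
  by move=> [[_ GX] _]; exact: lorentz_polar_mx.
have mD : measurable D.
  apply: countable_bigcupT_measurable => // Ni; have [cK _ KQ _] := hK Ni.
  apply: measurable_plane_image; first exact: ltnW.
    apply: continuous_compact => //; apply: continuous_subspaceT.
    exact: continuous_Mk.
  by move=> _ [X /KQ QX <-]; exact: QL.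
exists D; split=> //; last first.
  move=> z [Ni _ [_ [X KX <-] <-]]; have [_ _ KQ _] := hK Ni.
  have [[r0 GX] BX] := KQ _ KX.
  exists (dec X).1, (dec X).2; split=> //; first by move: r0; rewrite /= in_itv/= andbT.
(* Tested on this indicator, [invariant_measure] turns the claim into one about parameters. *)
pose psi (t : hgr R n k) : \bar R := (\1_(~` D) t)%:E.
have mpsi : measurable_fun setT psi.
  by apply/measurable_EFinP; apply: measurable_indic; exact: measurableC.
have psi0 t : (0 <= psi t)%E by rewrite lee_fin.
have -> : muk (~` D) = (\int[muk]_t psi t)%E.
  by rewrite integral_indic ?setIT//; exact: measurableC.
rewrite (hmuk mpsi psi0).
pose g (x : TT) := plane_lift psi (polar_mx k x.2 x.1).
have mg : measurable_fun setT g.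
  apply: (measurableT_comp (measurable_plane_lift (ltnW kn) mpsi)).
  by apply: measurable_polar_mx; [exact: measurable_snd|exact: measurable_fst].
have g0 x : (0 <= g x)%E by exact: plane_lift_ge0.
pose h (x : TT) := (`|hweight (n - k - 1) k x.1|%:E * g x)%E.
have mh : measurable_fun setT h.
  apply: emeasurable_funM => //; apply/measurable_EFinP.
  apply: (measurableT_comp (@normr_measurable R setT)).
  exact: (measurableT_comp (measurable_hweight R _ _) measurable_fst).
have h0 x : (0 <= h x)%E by rewrite mule_ge0 ?lee_fin.
suff H : (\int[lebP]_(x in D0) h x = 0)%E.
  rewrite [X in (_ * X)%E](_ : _ = \int[leb]_(r in `]0%R, +oo[) \int[PK]_(a in G) h (r, a))%E.
    by rewrite -(ge0_fubini1 _ _ _ _ _ leb PK `]0, +oo[%classic G h) ?[X in (_ * X)%E]H ?mule0.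
  apply: eq_integral => r; rewrite inE/= in_itv/= andbT => r0.
  transitivity (\int[PK]_(a in G) ((hweight (n - k - 1) k r)%:E * g (r, a)))%E.
    rewrite ge0_integralZl//.
    + congr (_ * _)%E; apply: eq_integral => a; rewrite inE => Ga.
      by rewrite /g plane_liftE//; exact: lorentz_polar_mx.
    + apply: measurable_funTS; apply: (measurableT_comp mg).
      by apply: measurable_fun_pair; [exact: measurable_cst|exact: measurable_id].
    + by rewrite lee_fin hweight_ge0.
  by apply: eq_integral => a _; rewrite /h ger0_norm// hweight_ge0.
(* The parameters whose plane lies outside [D]. *)
pose Z := D0 `&` g @^-1` [set 1%E].
have mZ : measurable Z.
  by apply: measurableI => //; rewrite -[X in measurable X]setTI; exact: mg.
have gE x : D0 x -> g x = psi (act (polar_mx k x.2 x.1) (@hplane R n k)).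
  by move=> [_ Gx]; rewrite /g plane_liftE//; exact: lorentz_polar_mx.
suff Z0 : lebP Z = 0%E.
  rewrite (ge0_negligible_integral mZ)//; last exact: measurable_funTS.
  apply: integral0_eq => x [D0x nZ]; rewrite /h.
  suff -> : g x = 0%E by rewrite mule0.
  move: nZ; rewrite /Z /= => nZ; have := gE x D0x; rewrite /psi indicE.
  case: (_ \in _) => // g1; exfalso; apply: nZ; split=> //.
have Zbox N : lebP (Z `&` box N) = 0%E.
  apply/eqP; rewrite eq_le measure_ge0 andbT; apply/lee_addgt0Pr => e e0.
  rewrite add0e.
  have [i ie] : exists i : nat, i.+1%:R^-1 < e.
    exists (Num.bound e^-1); rewrite invf_plt ?posrE//.
    by rewrite (lt_le_trans (archi_boundP _))// ?ler_nat// invr_ge0 ltW.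
  have [_ clK KQ hKi] := hK (N, i).
  have mKc : measurable (K (N, i) : set (mxborel R (n + 1))).
    rewrite -[X in measurable X]setCK; apply: measurableC; apply: measurable_open_mxborel.
    exact: closed_openC.
  have mP : measurable (box N `&` enc @^-1` (Q `\` K (N, i))).
    apply: measurableI => //; rewrite -[X in measurable X]setTI; apply: menc => //.
    exact: measurableD.
  (* A parameter of [Z] in [box N] is either outside [B], a null part, or in [B] but missed by the
     compact [K (N, i)], a part of measure below [e]. *)
  apply: (@le_trans _ _ (lebP ((box N `&` enc @^-1` (Q `\` K (N, i))) `|` (box N `\` B)))).
    apply: le_measure; rewrite ?inE//.
    - exact: measurableI.
    - by apply: measurableU => //; exact: measurableD.
    move=> x [[D0x gx] bx]; have [Bx|nBx] := pselect (B x); last by right.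
    left; split=> //; split; first by rewrite /Q /= encK.
    move=> Kx; move: gx; rewrite /= gE// /psi indicE memNset.
      by move=> [] /eqP; rewrite eq_sym oner_eq0.
    apply; exists (N, i) => //; exists (Mk (enc x)); first by exists (enc x).
    by rewrite /Mk encK.
  apply: (le_trans (measureU2 _ _ _)) => //; first exact: measurableD.
  rewrite [X in (_ + X)%E](_ : _ = 0%E) ?adde0; last first.
    by apply: hB; rewrite ?invr_gt0// (@lt_trans _ _ 1)// ?invf_lt1// ?ltr1n.
  by apply: ltW; apply: (lt_trans hKi); rewrite lte_fin.
have Zcov : Z `<=` \bigcup_N (Z `&` box N).
  move=> x Zx; have [[x0 Gx] _] := Zx.
  have {}x0 : 0 < x.1 by move: x0; rewrite /= in_itv/= andbT.
  exists (Num.bound x.1 + Num.bound x.1^-1)%N => //; split=> //; split=> //=.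
  rewrite in_itv/=; apply/andP; split.
    rewrite invf_plt ?posrE// (lt_le_trans (archi_boundP _))// ?invr_ge0 ?ltW//.
    by rewrite ltr_nat ltnS leqW// leq_addl.
  rewrite (lt_le_trans (archi_boundP _))// ?ltW//.
  by rewrite ltr_nat ltnS leqW// leq_addr.
apply/eqP; rewrite eq_le measure_ge0 andbT.
apply: (@le_trans _ _ (\sum_(N <oo) lebP (Z `&` box N))%E).
  by apply: measure_sigma_subadditive => // N; exact: measurableI.
by rewrite eseries0.
Qed.

End null_sets.

Section complex_modulus.
Variable R : realType.
Local Notation normc := ComplexField.Normc.normc.

Lemma ge0_normc (z : R[i]) : 0 <= normc z.
Proof. by case: z => x y; exact: sqrtr_ge0. Qed.

Lemma normr_Re_le (z : R[i]) : `|complex.Re z| <= normc z.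
Proof.
by case: z => x y /=; rewrite -sqrtr_sqr ler_wsqrtr// lerDl sqr_ge0.
Qed.

Lemma normr_Im_le (z : R[i]) : `|complex.Im z| <= normc z.
Proof.
by case: z => x y /=; rewrite -sqrtr_sqr ler_wsqrtr// lerDr sqr_ge0.
Qed.

Lemma measurable_normc d (T : measurableType d) (f : T -> R[i]) :
  measurable_fun setT (fun x => complex.Re (f x) : measurableTypeR R) ->
  measurable_fun setT (fun x => complex.Im (f x) : measurableTypeR R) ->
  measurable_fun setT (fun x => normc (f x) : measurableTypeR R).
Proof.
move=> mRe mIm.
rewrite (_ : (fun _ => _) = (fun x => Num.sqrt (complex.Re (f x) ^+ 2 + complex.Im (f x) ^+ 2)
  : measurableTypeR R)); last first.
  by apply/funext => x; case: (f x).
apply: (measurableT_comp (continuous_measurable_fun (@sqrt_continuous R))).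
by apply: measurable_funD; exact: measurable_funX.
Qed.

End complex_modulus.

Lemma finite_norm_powR d (T : measurableType d) (R : realType)
  (mu : {measure set T -> \bar R}) (p : R) (F : T -> R) : 0 < p -> (forall t, 0 <= F t) ->
  finite_norm mu p%:E F -> (\int[mu]_t (F t `^ p)%:E < +oo)%E.
Proof.
move=> p0 F0 h.
have <- : (Lnorm mu p%:E (EFin \o F) `^ p = \int[mu]_t (F t `^ p)%:E)%E.
  rewrite (poweR_Lnorm mu (EFin \o F) (lt0r_neq0 p0)); apply: eq_integral => t _ /=.
  by rewrite ger0_norm.
exact: poweR_lty.
Qed.

(** * Absolute convergence in the chosen frame *)

Section finiteness.
Variables (R : realType) (n k j : nat) (pl : 'I_n).
Variables (PK Pk : probability (mxborel R n) R).
Hypotheses (hPK : is_haar (rotgrp n) PK) (hPk : is_haar (rotgrp k) Pk).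
Hypotheses (jk : (j < k)%N) (kn : (k <= n - 1)%N) (plE : (pl.+1 = n)%N).
Notation G := (@rotgrp R n n).
Notation Gk := (@rotgrp R n k).
Notation leb := (@lebesgue_measure R).
Notation TR := (measurableTypeR R).
Notation TT := (TR * mxborel R n)%type.
Notation lebP := (product_probability leb Pk).
Notation dom := (@radon_dom R n k).

Let mG : measurable (G : set (mxborel R n)) := @measurable_rotgrp R n n.
Let mGk : measurable (Gk : set (mxborel R n)) := @measurable_rotgrp R n k.
Let jn : (j < n)%N. Proof. lia. Qed.

Variable (F : hgr R n j -> R).
Hypotheses (mF : measurable_fun setT (F : hgr R n j -> TR)) (F0 : forall t, 0 <= F t).

Let E t := (F t)%:E.

Let mE : measurable_fun setT E.
Proof. exact/measurable_EFinP. Qed.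

Let E0 t : (0 <= E t)%E. Proof. by rewrite lee_fin. Qed.

(** Left invariance of [Pk] for each [rho] absorbs the rotation [b0] of [hpoint_act]. *)
Lemma radon_int_left s x b0 : Gk b0 ->
  (\int[lebP]_(q in dom) radon_integrand k pl E s (x, (q.1, b0 *m (q.2 : 'M[R]_n) : mxborel R n)) =
   radon_int k pl Pk E s x)%E.
Proof.
move=> Gb0.
pose g (q : TT) := radon_integrand k pl E s (x, q).
pose h (q : TT) := g (q.1, b0 *m (q.2 : 'M[R]_n) : mxborel R n).
have mg : measurable_fun setT g.
  apply: (measurableT_comp (measurable_radon_integrand jk kn plE mE s)).
  by apply: measurable_fun_pair; [exact: measurable_cst|exact: measurable_id].
have mh : measurable_fun setT h.
  apply: (measurableT_comp mg); apply: measurable_fun_pair; first exact: measurable_fst.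
  by apply: measurable_mulmx_borel; [exact: measurable_cst|exact: measurable_snd].
have g0 q : (0 <= g q)%E by exact: radon_integrand_ge0.
have h0 q : (0 <= h q)%E by exact: g0.
transitivity (\int[leb]_(rho in `]0%R, +oo[) \int[Pk]_(b in Gk) h (rho, b))%E.
  exact: (ge0_fubini1 _ _ _ _ _ leb Pk `]0, +oo[%classic Gk h (measurable_itv _) mGk mh h0).
transitivity (\int[leb]_(rho in `]0%R, +oo[) \int[Pk]_(b in Gk) g (rho, b))%E; last first.
  by symmetry; exact: (ge0_fubini1 _ _ _ _ _ leb Pk `]0, +oo[%classic Gk g (measurable_itv _) mGk mg g0).
apply: eq_integral => rho _.
have mgr : measurable_fun setT (fun b : mxborel R n => g (rho, b)).
  apply: (measurableT_comp mg).
  by apply: measurable_fun_pair; [exact: measurable_cst|exact: measurable_id].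
exact: (haar_left hPk mgr (fun b => g0 (rho, b)) Gb0).
Qed.

(** Serves for [u] the real and the imaginary part of [f]. The frame is picked without control of
    its sign, so finiteness is assumed for both [s]; measurability in [q] comes from rewriting
    [hpoint] as the plane of an explicit matrix. *)
Lemma integrable_hpoint (u : hgr R n j -> R) (r : R) (a : 'M[R]_n) :
  measurable_fun setT (u : hgr R n j -> TR) -> (forall t, `|u t| <= F t) ->
  0 < r -> G a -> (forall s, radon_int k pl Pk E s (r, a) < +oo)%E ->
  lebP.-integrable (dom) (fun q : TT =>
    (hweight (k - j - 1) j q.1 *
     u (hpoint k j (act (emb a *m boost n (n - k) r) (@hplane R n k)) q.1 q.2))%:E).
Proof.
move=> mu uF r0 Ga fin.
have [pk pkE] : exists pk : 'I_n, (pk.+1 = n - k)%N.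
  have h : ((n - k).-1 < n)%N by lia.
  by exists (Ordinal h) => /=; lia.
have [pj pjE] : exists pj : 'I_n, (pj.+1 = n - j)%N.
  have h : ((n - j).-1 < n)%N by lia.
  by exists (Ordinal h) => /=; lia.
have k0 : (0 < k)%N by lia.
have [s [b0 [Gb0 hE]]] := hpoint_act pkE plE k0 pjE jk Ga r0.
set z := act _ _.
pose N (q : TT) := frame_mx k j pl s (r, a : mxborel R n) (q.1, b0 *m (q.2 : 'M[R]_n) : mxborel R n).
have {}hE q : dom q -> hpoint k j z q.1 q.2 = plane j (N q).
  by move=> [_ Gq]; rewrite hE.
have LN q : dom q -> lorentz (N q).
  by move=> [_ Gq]; apply: lorentz_frame_mx => //; exact: rotgrp_mulmx.
have mN : measurable_fun setT N.
  apply: measurable_frame_mx; first exact: measurable_cst.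
  apply: measurable_fun_pair; first exact: measurable_fst.
  by apply: measurable_mulmx_borel; [exact: measurable_cst|exact: measurable_snd].
have mD := @measurable_radon_dom R n k.
have mv : measurable_fun dom (fun q : TT => hweight (k - j - 1) j q.1 * u (hpoint k j z q.1 q.2) : TR).
  apply: (@eq_measurable_fun _ _ TT TR dom
    (fun q => hweight (k - j - 1) j q.1 * u (plane j (N q)))).
    by move=> q; rewrite inE => /hE ->.
  apply: measurable_funM.
    by apply: measurable_funTS; exact: (measurableT_comp (measurable_hweight R _ _) measurable_fst).
  apply: (measurableT_comp mu).
  apply: (measurable_comp (@measurable_lorentz R n) _ (measurable_plane (ltnW jn))).
    by move=> _ [q Dq <-]; exact: LN.
  exact: measurable_funTS.
apply/integrableP; split; first exact/measurable_EFinP.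
apply: (le_lt_trans _ (fin s)); rewrite -(radon_int_left s _ Gb0).
apply: ge0_le_integral => //.
- by apply: (measurableT_comp (@abse_measurable R setT)); exact/measurable_EFinP.
- apply: measurable_funTS; apply: (measurableT_comp (measurable_radon_integrand jk kn plE mE s)).
  apply: measurable_fun_pair; first exact: measurable_cst.
  apply: measurable_fun_pair; first exact: measurable_fst.
  by apply: measurable_mulmx_borel; [exact: measurable_cst|exact: measurable_snd].
move=> q Dq; rewrite /radon_integrand/= plane_liftE; last exact: LN.
rewrite -EFinM lee_fin normrM ler_wpM2l// -/(plane j (N q)) -hE//.
Qed.

End finiteness.

Lemma ge0_integral_fin_null d1 d2 (T1 : measurableType d1) (T2 : measurableType d2)
  (R : realType) (m1 : {sigma_finite_measure set T1 -> \bar R}) (P : probability T2 R)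
  (D1 : set T1) (D2 : set T2) (f : T1 * T2 -> \bar R) :
  measurable D1 -> measurable D2 -> measurable_fun setT f -> (forall z, (0 <= f z)%E) ->
  (\int[m1]_(x in D1) \int[P]_(y in D2) f (x, y) < +oo)%E ->
  product_probability m1 P ((D1 `*` D2) `&` f @^-1` [set +oo%E]) = 0%E.
Proof.
move=> mD1 mD2 mf f0 fin.
have mD : measurable (D1 `*` D2) by exact: measurableX.
have mfD : measurable_fun (D1 `*` D2) f by exact: measurable_funTS.
have : (product_probability m1 P).-integrable (D1 `*` D2) f.
  apply/integrableP; split=> //.
  rewrite [X in (X < _)%E](_ : _ = \int[m1 \x P]_(z in D1 `*` D2) f z)%E.
    by rewrite (ge0_fubini1 _ _ _ _ _ m1 P D1 D2 f).
  by apply: eq_integral => z _; rewrite gee0_abs.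
move=> /(integrable_ae mD) nf; apply/negligibleP.
  by apply: mfD => //; exact: emeasurable_set1.
apply: negligibleS nf => z [Dz /= fz] /(_ Dz); rewrite fz //.
Qed.

Unset Implicit Arguments.
Set Strict Implicit.
Set Printing Implicit Defensive.

Theorem proposition5p9 (R : realType) (n j k : nat) (p : R)
  (PK Pk : probability (mxborel R n) R)
  (muj : {measure set (hgr R n j) -> \bar R})
  (muk : {measure set (hgr R n k) -> \bar R})
  (f : hgr R n j -> R[i])
  (hn : (2 <= n)%N) (hjk : (j < k)%N) (hkn : (k <= n - 1)%N)
  (hPK : is_haar (rotgrp n) PK) (hPk : is_haar (rotgrp k) Pk)
  (hmuj : invariant_measure PK muj) (hmuk : invariant_measure PK muk)
  (hp1 : 1 <= p)
  (hp2 : (1 < k)%N -> p < (n - 1)%:R / (k - 1)%:R)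
  (hf : cLp muj p f) :
  {ae muk, forall z, exists w : R[i], is_hradon Pk f z w}.

Proof.
pose F (t : hgr R n j) : R := ComplexField.Normc.normc (f t).
have [mRe mIm fin] := hf.
have F0 t : 0 <= F t by exact: ge0_normc.
have mF : measurable_fun setT (F : hgr R n j -> measurableTypeR R) by exact: measurable_normc.
have Fp := finite_norm_powR (lt_le_trans ltr01 hp1) F0 fin.
(* In product form the bound also covers [k = 1], where it reads [0 < n - 1]. *)
have kp : (k - 1)%:R * p < (n - 1)%:R.
  have [k1|k1] := leqP k 1%N.
    by rewrite (_ : (k - 1)%N = 0%N) ?mul0r ?ltr0n; lia.
  by rewrite mulrC -ltr_pdivlMr ?hp2// ltr0n; lia.
have [pl plE] : exists pl : 'I_n, (pl.+1 = n)%N.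
  have h : (n.-1 < n)%N by lia.
  by exists (Ordinal h) => /=; lia.
have jn : (j < n)%N by lia.
have jn2 : (2 <= n - j)%N by lia.
have kn : (k < n)%N by lia.
pose E t := (F t)%:E.
have mE : measurable_fun setT E by exact/measurable_EFinP.
have E0 t : (0 <= E t)%E by rewrite lee_fin.
pose Phi s := radon_int k pl Pk E s.
have mPhi s : measurable_fun setT (Phi s) by exact: measurable_radon_int.
have Phi0 s x : (0 <= Phi s x)%E by exact: radon_int_ge0.
pose bad s := Phi s @^-1` [set +oo%E].
have mbad s : measurable (bad s).
  by rewrite -[X in measurable X]setTI; apply: mPhi => //; exact: emeasurable_set1.
(* Both signs are excluded at once, whichever one the chosen frame of the plane carries. *)
pose B := ~` (bad true `|` bad false).
have mB : measurable B by apply: measurableC; exact: measurableU.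
have mG : measurable (rotgrp n : set (mxborel R n)) := @measurable_rotgrp R n n.
have [|D [mD D0 hD]] := null_complement hPK hmuk kn mB.
  move=> e N e0 eN.
  pose S : set (measurableTypeR R * mxborel R n) := `]e, N[%classic `*` rotgrp n.
  have mS : measurable S by apply: measurableX => //; exact: measurable_itv.
  have null s : product_probability lebesgue_measure PK (S `&` bad s) = 0%E.
    apply: ge0_integral_fin_null => //.
    apply: radon_int_fin => //.
    exact: (average_tail hPK jn mF F0 hp1 hmuj jn2 Fp kp e0).
  rewrite setDE setCK setIUr.
  have mSbad s : measurable (S `&` bad s) by exact: measurableI.
  exact: (etrans (measureU0 (mSbad true) (mSbad false) (null false)) (null true)).
exists (~` D); split=> //; first exact: measurableC.
move=> z /= nz Dz; apply: nz.
have [r [a [r0 Ga Bra ->]]] := hD z Dz.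
(* The value [w] is given by its formula; what remains is absolute convergence. *)
eexists; split; last by reflexivity.
have Phi_fin s : (Phi s (r, a) < +oo)%E.
  rewrite ltey; apply/eqP => Ps; apply: Bra.
  by case: s Ps => ?; [left|right].
split.
- have := integrable_hpoint hPk hjk hkn plE mF F0 mRe (fun t => normr_Re_le (f t)) r0 Ga Phi_fin.
  congr (_.-integrable _ _); apply/funext => q /=; congr (_%:E).
  by case: (f _) => x y /=; rewrite mul0r subr0.
- have := integrable_hpoint hPk hjk hkn plE mF F0 mIm (fun t => normr_Im_le (f t)) r0 Ga Phi_fin.
  congr (_.-integrable _ _); apply/funext => q /=; congr (_%:E).
  by case: (f _) => x y /=; rewrite mul0r addr0.
Qed.
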